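(* Let $\pi:E\to M$ be a bundle, $x\in E$ and $n$ a natural number. For any $D^n$-tangential $\nabla_x\in\mathbb{J}_x^{D^n}(\pi)$ over $\pi$ at $x$, the mapping $\widehat{\psi}_n(\nabla_x):(M\otimes\mathcal{W}_{D_n})_{\pi(x)}\to(E\otimes\mathcal{W}_{D_n})_x$ is a $D_n$-tangential over $\pi$ at $x$, i.e. $\widehat{\psi}_n(\nabla_x)\in\mathbb{J}_x^{D_n}(\pi)$.
   Context: **Frölicher spaces, Weil prolongation.** $\mathbf{FS}$ is the (cartesian closed) category of Frölicher spaces and smooth mappings; all mappings below are smooth, subsets carry the subspace structure. A Weil algebra is $W=C^\infty(\mathbb{R}^k)/I$, with $I$ contained in the ideal $\mathfrak m$ of functions vanishing at $0$ and containing a power of $\mathfrak m$. $X\otimes W$ is the quotient of $X^{\mathbb{R}^k}$ by $f\sim g$ iff $f(0)=g(0)$ and $h\circ f-h\circ g\in I$ for all smooth $h:X\to\mathbb{R}$. This is a bifunctor: $u\otimes\mathrm{id}_W$ sends $[f]$ to $[u\circ f]$, and $\mathrm{id}_X\otimes\phi$ sends $[f]$ to $[f\circ\theta]$ where the smooth map $\theta$ with $\theta(0)=0$ induces $\phi$. There is a canonical projection $X\otimes W\to X$; $(X\otimes W)_x$ is its fibre over $x$. Infinitesimal objects are formal duals of Weil algebras: $D=\{d:d^2=0\}$, $D_m=\{d:d^{m+1}=0\}$, $\mathcal{W}_{D^n}=\mathbb{R}[X_1,\dots,X_n]/(X_1^2,\dots,X_n^2)$, $\mathcal{W}_{D_m}=\mathbb{R}[X]/(X^{m+1})$;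 a polynomial map $f:\mathbb{D}\to\mathbb{D}'$ induces by substitution $\mathcal{W}_f:\mathcal{W}_{\mathbb{D}'}\to\mathcal{W}_{\mathbb{D}}$; products of infinitesimal objects correspond to tensor products $\otimes_\infty$. $X$ is Weil exponentiable if $(X\otimes(W_1\otimes_\infty W_2))^Y=(X\otimes W_1)^Y\otimes W_2$ naturally for all Frölicher spaces $Y$ and Weil algebras $W_1,W_2$ (in particular $X\otimes\mathcal{W}_{\mathbb{D}\times\mathbb{D}'}=(X\otimes\mathcal{W}_{\mathbb{D}})\otimes\mathcal{W}_{\mathbb{D}'}$). $X$ is microlinear if $X\otimes-$ sends finite limit diagrams of Weil algebras to limit diagrams in $\mathbf{FS}$. Convention: all Frölicher spaces occurring are microlinear and Weil exponentiable; a bundle is just a smooth mapping $\pi:E\to M$ of such spaces. Weil functors $-\otimes W$ preserve finite limits. **Operations.** For $\gamma\in X\otimes\mathcal{W}_{D^n}$: $\gamma^\sigma=(\mathrm{id}_X\otimes\mathcal{W}_{(d_1,\dots,d_n)\mapsto(d_{\sigma(1)},\dots,d_{\sigma(n)})})(\gamma)$ for $\sigma\in\mathbf{S}_n$; $\alpha\underset{i}{\cdot}\gamma=(\mathrm{id}_X\otimes\mathcal{W}_{(d_1,\dots,d_n)\mapsto(d_1,\dots,\alpha d_i,\dots,d_n)})(\gamma)$ for $\alpha\in\mathbb{R}$; $\mathbf{s}_i:X\otimes\mathcal{W}_{D^n}\to X\otimes\mathcal{W}_{D^{n+1}}$ is induced by the map $D^{n+1}\to D^n$ deleting $d_i$;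 $\mathbf{d}_i:X\otimes\mathcal{W}_{D^{n+1}}\to X\otimes\mathcal{W}_{D^n}$ is induced by the map $D^n\to D^{n+1}$ inserting $0$ at the $i$-th place. For $\gamma\in X\otimes\mathcal{W}_{D_n}$, $\alpha\gamma=(\mathrm{id}_X\otimes\mathcal{W}_{d\mapsto\alpha d})(\gamma)$. **$D^n$-pseudotangentials and $D^n$-tangentials.** A $D^n$-pseudotangential over $\pi$ at $x\in E$ is a mapping $\nabla_x:(M\otimes\mathcal{W}_{D^n})_{\pi(x)}\to(E\otimes\mathcal{W}_{D^n})_x$ such that: (1) $(\pi\otimes\mathrm{id})(\nabla_x(\gamma))=\gamma$; (2) $\nabla_x(\alpha\underset{i}{\cdot}\gamma)=\alpha\underset{i}{\cdot}\nabla_x(\gamma)$ for $\alpha\in\mathbb{R}$, $1\le i\le n$; (3) for all $m$ and $1\le i\le n$, with $\mu_i:D^n\times D_m\to D^n$, $(d_1,\dots,d_n,e)\mapsto(d_1,\dots,ed_i,\dots,d_n)$, one has $(\nabla_x\otimes\mathrm{id}_{\mathcal{W}_{D_m}})\circ(\mathrm{id}_M\otimes\mathcal{W}_{\mu_i})=(\mathrm{id}_E\otimes\mathcal{W}_{\mu_i})\circ\nabla_x$; (4) $\nabla_x(\gamma^\sigma)=(\nabla_x(\gamma))^\sigma$ for $\sigma\in\mathbf{S}_n$. $\hat\pi_{n+1,n}(\nabla_x)=\mathbf{d}_{n+1}\circ\nabla_x\circ\mathbf{s}_{n+1}$ is a $D^n$-pseudotangential when $\nabla_x$ is a $D^{n+1}$-pseudotangential.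 A $D$-tangential is a $D$-pseudotangential. Inductively, a $D^{n+1}$-pseudotangential $\nabla_x$ is a $D^{n+1}$-tangential if $\hat\pi_{n+1,n}(\nabla_x)$ is a $D^n$-tangential and, with $\kappa:D^{n+1}\to D^n$, $(d_1,\dots,d_{n+1})\mapsto(d_1,\dots,d_{n-1},d_nd_{n+1})$, $\nabla_x((\mathrm{id}_M\otimes\mathcal{W}_\kappa)(\gamma))=(\mathrm{id}_E\otimes\mathcal{W}_\kappa)(\hat\pi_{n+1,n}(\nabla_x)(\gamma))$ for all $\gamma\in(M\otimes\mathcal{W}_{D^n})_{\pi(x)}$. $\mathbb{J}^{D^n}_x(\pi)$ is the set of $D^n$-tangentials at $x$ (for $n=0$, just the point $x$). **$D_n$-pseudotangentials and $D_n$-tangentials.** A $D_n$-pseudotangential over $\pi$ at $x$ is a mapping $\nabla_x:(M\otimes\mathcal{W}_{D_n})_{\pi(x)}\to(E\otimes\mathcal{W}_{D_n})_x$ such that: (1) $(\pi\otimes\mathrm{id})(\nabla_x(\gamma))=\gamma$; (2) $\nabla_x(\alpha\gamma)=\alpha\nabla_x(\gamma)$ for $\alpha\in\mathbb{R}$; (3) for all $m$, with $\mathbf{m}:D_n\times D_m\to D_n$ the multiplication $(d_1,d_2)\mapsto d_1d_2$, $(\nabla_x\otimes\mathrm{id}_{\mathcal{W}_{D_m}})\circ(\mathrm{id}_M\otimes\mathcal{W}_{\mathbf m})=(\mathrm{id}_E\otimes\mathcal{W}_{\mathbf m})\circ\nabla_x$. For a $D_{n+1}$-pseudotangential $\nabla_x$,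 $\hat\pi_{n+1,n}(\nabla_x)$ is the $D_n$-pseudotangential characterized by $(\mathrm{id}_E\otimes\mathcal{W}_{\mathbf m'})(\hat\pi_{n+1,n}(\nabla_x)(\gamma))=(\nabla_x\otimes\mathrm{id}_{\mathcal{W}_{D_n}})((\mathrm{id}_M\otimes\mathcal{W}_{\mathbf m'})(\gamma))$, where $\mathbf m':D_{n+1}\times D_n\to D_n$ is multiplication; $\hat\pi_{n,l}=\hat\pi_{l+1,l}\circ\cdots\circ\hat\pi_{n,n-1}$. A simple polynomial of $d\in D_n$ is a polynomial $\rho$ with all coefficients $0$ or $1$ and zero constant term; its dimension is the least $l$ with $\rho^{l+1}=0$ in $\mathbb{R}[d]/(d^{n+1})$, so that $\rho:D_n\to D_l$. $D_0$- and $D_1$-tangentials are $D_0$- and $D_1$-pseudotangentials. Inductively, a $D_{n+1}$-pseudotangential $\nabla_x$ is a $D_{n+1}$-tangential if $\hat\pi_{n+1,n}(\nabla_x)$ is a $D_n$-tangential and for any simple polynomial $\rho$ of $d\in D_{n+1}$ of dimension $l$ and any $\gamma\in(M\otimes\mathcal{W}_{D_l})_{\pi(x)}$, $\nabla_x((\mathrm{id}_M\otimes\mathcal{W}_\rho)(\gamma))=(\mathrm{id}_E\otimes\mathcal{W}_\rho)(\hat\pi_{n+1,l}(\nabla_x)(\gamma))$. $\mathbb{J}^{D_n}_x(\pi)$ is the set of $D_n$-tangentials at $x$. **$\widehat\psi_n$.** For a $D^n$-pseudotangential $\nabla_x$ and $\gamma\in(M\otimes\mathcal{W}_{D_n})_{\pi(x)}$,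 $\widehat\psi_n(\nabla_x)(\gamma)$ is the unique $\gamma'\in(E\otimes\mathcal{W}_{D_n})_x$ with $\nabla_x((\mathrm{id}_M\otimes\mathcal{W}_{+})(\gamma))=(\mathrm{id}_E\otimes\mathcal{W}_{+})(\gamma')$, where $+:D^n\to D_n$, $(d_1,\dots,d_n)\mapsto d_1+\dots+d_n$. *)

(* Defs.v *)
From HB Require Import structures.
From mathcomp Require Import all_boot all_order all_algebra all_fingroup.
From mathcomp Require Import all_classical all_reals topology normedtype landau derive.
Set Implicit Arguments.
Unset Strict Implicit.
Unset Printing Implicit Defensive.
Import Order.TTheory GRing.Theory Num.Theory.
From mathcomp Require Import zify.
Import numFieldNormedType.Exports.
Local Open Scope ring_scope.
Local Open Scope classical_set_scope.

Section Smooth.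
Context {R : realType}.

(* n-fold Frechet differentiability; used with V = R^o and V = 'rV[R]_k. *)
Fixpoint Ck {V : normedModType R} (n : nat) (f : V -> R) : Prop :=
  if n is m.+1 then
    (forall x, differentiable (f : V -> R^o) x) /\
    forall v, Ck m (fun x => 'D_v (f : V -> R^o) x)
  else continuous f.

Definition Cinf {V : normedModType R} (f : V -> R) : Prop := forall n, Ck n f.

Section Closure.
Context {V : normedModType R}.
Implicit Types f g : V -> R.

Lemma CkS n f : Ck n.+1 f -> Ck n f.
Proof.
elim: n f => [|n IH] f [df Df]; first by move=> x; apply: differentiable_continuous.
by split=> // v; apply: IH.
Qed.

Lemma Ck_cst n (c : R) : Ck n (fun _ : V => c).
Proof.
elim: n c => [|n IH] c; first by move=> x; apply: cst_continuous.
split=> [x|v]; first exact: differentiable_cst.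
have -> : (fun x : V => 'D_v (fun=> c : R^o) x) = fun=> 0.
  by apply/funext => x; rewrite (derive_cst (c : R^o)).
exact: IH.
Qed.

Lemma CkD n f g : Ck n f -> Ck n g -> Ck n (fun x => f x + g x).
Proof.
elim: n f g => [|n IH] f g.
  by move=> cf cg x; exact: (@cvgD _ R^o _ _ _ f g _ _ (cf x) (cg x)).
move=> [df Df] [dg Dg]; split=> [x|v].
  exact: (@differentiableD _ _ R^o f g).
have -> : (fun x => 'D_v (fun x => f x + g x : R^o) x) =
          fun x => 'D_v (f : V -> R^o) x + 'D_v (g : V -> R^o) x.
  by apply/funext=> x; exact: (@deriveD _ _ R^o f g x v (diff_derivable (df x)) (diff_derivable (dg x))).
exact: (IH _ _ (Df v) (Dg v)).
Qed.

Lemma CkM n f g : Ck n f -> Ck n g -> Ck n (fun x => f x * g x).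
Proof.
elim: n f g => [|n IH] f g.
  by move=> cf cg x; exact: (@cvgM _ _ _ _ f g _ _ (cf x) (cg x)).
move=> Cf Cg; have [df Df] := Cf; have [dg Dg] := Cg; split=> [x|v].
  exact: (@differentiableM _ _ f g).
have -> : (fun x => 'D_v (fun x => f x * g x : R^o) x) =
    fun x => f x * 'D_v (g : V -> R^o) x + g x * 'D_v (f : V -> R^o) x.
  by apply/funext=> x; exact: (@deriveM _ _ f g x v (diff_derivable (df x)) (diff_derivable (dg x))).
exact: (CkD (IH _ _ (CkS Cf) (Dg v)) (IH _ _ (CkS Cg) (Df v))).
Qed.

Lemma Ck_sum n (I : Type) (r : seq I) (F : I -> V -> R) :
  (forall i, Ck n (F i)) -> Ck n (fun x => \sum_(i <- r) F i x).
Proof.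
move=> CF; elim: r => [|i r IH].
  under eq_fun do rewrite big_nil; exact: Ck_cst.
under eq_fun do rewrite big_cons; exact: CkD.
Qed.

Lemma Ck_lin n (f : {linear V -> R^o}) : continuous f -> Ck n (f : V -> R).
Proof.
move=> cf; case: n => [//|n]; split=> [x|v]; first exact: linear_differentiable.
have -> : (fun x => 'D_v (f : V -> R^o) x) = fun=> f v.
  apply/funext=> x; rewrite deriveE ?diff_lin //; exact: linear_differentiable.
exact: Ck_cst.
Qed.

Lemma diff_comb (W : normedModType R) (J : Type) (e : J -> W) (t : J -> V -> R)
    (r : seq J) (x : V) :
  (forall j, differentiable (t j : V -> R^o) x) ->
  is_diff x (fun x => \sum_(j <- r) t j x *: e j)
    (fun v => \sum_(j <- r) 'd (t j : V -> R^o) x v *: e j).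
Proof.
move=> dt; elim: r => [|j r IH].
  have -> : (fun x => \sum_(j <- [::]) t j x *: e j) = cst 0.
    by apply/funext => v; rewrite big_nil.
  have -> : (fun v => \sum_(j <- [::]) 'd (t j : V -> R^o) x v *: e j) = 0.
    by apply/funext => v; rewrite big_nil.
  exact: is_diff_cst.
have -> : (fun x => \sum_(j <- j :: r) t j x *: e j) =
    (fun x => t j x *: e j) + (fun x => \sum_(j <- r) t j x *: e j).
  by apply/funext => v; rewrite big_cons.
have -> : (fun v => \sum_(j <- j :: r) 'd (t j : V -> R^o) x v *: e j) =
    (fun v => 'd (t j : V -> R^o) x v *: e j) +
    (fun v => \sum_(j <- r) 'd (t j : V -> R^o) x v *: e j).
  by apply/funext => v; rewrite big_cons.
apply: is_diffD; apply: DiffDef; first exact: (@differentiableZl _ _ _ (t j) (e j)).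
by rewrite (@diffZl _ _ _ (t j) (e j)).
Qed.

Lemma Ck_comp n (W : normedModType R) (J : finType) (e : J -> W) (f : W -> R)
    (t : J -> V -> R) : Ck n f -> (forall j, Ck n (t j)) ->
  Ck n (fun x => f (\sum_j t j x *: e j)).
Proof.
elim: n f => [|n IH] f.
  move=> cf ct x; apply: continuous_comp; last exact: cf.
  apply: cvg_big => [|j _]; first exact: add_continuous.
  by apply: cvgZr_tmp; apply: ct.
move=> [df Df] Ct; have Ct' j := CkS (Ct j).
have dt j x : differentiable (t j : V -> R^o) x by case: (Ct j).
pose T x := \sum_j t j x *: e j.
have dT x : is_diff x T (fun v => \sum_j 'd (t j : V -> R^o) x v *: e j).
  exact: diff_comb.
split=> [x|v]; first exact: (@differentiable_comp _ _ _ R^o T f).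
have -> : (fun x => 'D_v (fun x => f (T x) : R^o) x) =
    fun x => \sum_j 'D_v (t j : V -> R^o) x * 'D_(e j) (f : W -> R^o) (T x).
  apply/funext=> x; rewrite deriveE; last exact: (@differentiable_comp _ _ _ R^o T f).
  rewrite (@diff_comp _ _ _ R^o T f) //= diff_val.
  rewrite linear_sum; apply: eq_bigr => j _.
  by rewrite linearZ /= !deriveE.
apply: Ck_sum => j; apply: (CkM (proj2 (Ct j) v)).
exact: (IH _ (Df (e j)) Ct').
Qed.
End Closure.

Section CinfTheory.
Context {V : normedModType R}.
Implicit Types f g : V -> R.

Lemma Cinf_cst (c : R) : Cinf (fun _ : V => c).
Proof. by move=> n; apply: Ck_cst. Qed.

Lemma CinfD f g : Cinf f -> Cinf g -> Cinf (fun x => f x + g x).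
Proof. by move=> Cf Cg n; apply: CkD. Qed.

Lemma CinfM f g : Cinf f -> Cinf g -> Cinf (fun x => f x * g x).
Proof. by move=> Cf Cg n; apply: CkM. Qed.

Lemma CinfX f m : Cinf f -> Cinf (fun x => f x ^+ m).
Proof.
move=> Cf; elim: m => [|m IH]; first exact: Cinf_cst.
by under eq_fun do rewrite exprS; apply: CinfM.
Qed.

Lemma Cinf_sum (I : Type) (r : seq I) (F : I -> V -> R) :
  (forall i, Cinf (F i)) -> Cinf (fun x => \sum_(i <- r) F i x).
Proof. by move=> CF n; apply: Ck_sum => i; apply: CF. Qed.

Lemma Cinf_horner (p : {poly R}) f : Cinf f -> Cinf (fun x => p.[f x]).
Proof.
move=> Cf; under eq_fun do rewrite horner_coef.
apply: Cinf_sum => i; apply: CinfM; [exact: Cinf_cst | exact: CinfX].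
Qed.

Lemma Cinf_comp k (f : 'rV[R]_k -> R) (t : V -> 'rV[R]_k) :
  Cinf f -> (forall j, Cinf (fun x => t x 0 j)) -> Cinf (f \o t).
Proof.
move=> Cf Ct n.
have := @Ck_comp _ n _ _ (fun j => delta_mx 0 j) f (fun j x => t x 0 j) (Cf n)
  (fun j => Ct j n).
by congr Ck; apply/funext => x /=; rewrite -row_sum_delta.
Qed.

Lemma Cinf_comp1 (f : R^o -> R) (a : V -> R) :
  Cinf f -> Cinf a -> Cinf (f \o a).
Proof.
move=> Cf Ca n.
have := @Ck_comp _ n R^o _ (fun _ : 'I_1 => 1) f (fun _ => a) (Cf n) (fun _ => Ca n).
congr Ck; apply/funext => x /=; rewrite big_ord_recl big_ord0 addr0.
by rewrite /GRing.scale /= mulr1.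
Qed.

End CinfTheory.

Lemma Cinf_coord k (i : 'I_k) : Cinf (fun v : 'rV[R]_k => v 0 i).
Proof.
have lin : linear (fun v : 'rV[R]_k => v 0 i : R^o) by move=> a u v; rewrite !mxE.
pose glM := GRing.isLinear.Build _ _ _ _ _ lin.
pose gL : {linear 'rV[R]_k -> R^o} := HB.pack (fun v : 'rV[R]_k => v 0 i : R^o) glM.
move=> n; apply: (@Ck_lin _ n gL) => v.
exact: coord_continuous.
Qed.

Lemma Cinf_id : Cinf (id : R^o -> R).
Proof. by move=> n; apply: (@Ck_lin _ n idfun) => v; apply: cvg_id. Qed.

End Smooth.

Section Frolicher.
Context {R : realType}.

Record frolicher := Frolicher {
  carrier :> Type;
  curve : set (R -> carrier);
  func : set (carrier -> R);
  curveE : forall c, curve c <-> forall f, func f -> Cinf (f \o c : R^o -> R);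
  funcE : forall f, func f <-> forall c, curve c -> Cinf (f \o c : R^o -> R) }.
Arguments curve : clear implicits.
Arguments func : clear implicits.

Definition initial_curve T (F0 : set (T -> R)) : set (R -> T) :=
  [set c : R -> T | forall f, F0 f -> Cinf (f \o c : R^o -> R)].

Definition final_func T (C0 : set (R -> T)) : set (T -> R) :=
  [set f : T -> R | forall c, C0 c -> Cinf (f \o c : R^o -> R)].

Program Definition initial T (F0 : set (T -> R)) : frolicher :=
  @Frolicher T (initial_curve F0) (final_func (initial_curve F0)) _ _.
Next Obligation.
move=> T F0 c; split=> [Cc f Ff|Cc f Ff]; first exact: Ff.
by apply: Cc => c' Cc'; apply: Cc'.
Qed.
Next Obligation. by []. Qed.

Program Definition final T (C0 : set (R -> T)) : frolicher :=
  @Frolicher T (initial_curve (final_func C0)) (final_func C0) _ _.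
Next Obligation. by []. Qed.
Next Obligation.
move=> T C0 f; split=> [Ff c Cc|Ff c Cc]; first exact: Cc.
by apply: Ff => f' Ff'; apply: Ff'.
Qed.

Definition smooth (X Y : frolicher) (u : X -> Y) : Prop :=
  forall c, curve X c -> curve Y (u \o c).

Record smap (X Y : frolicher) := Smap { sfun :> X -> Y; sfunP : smooth sfun }.

Lemma smap_ext (X Y : frolicher) (u v : smap X Y) : u =1 v -> u = v.
Proof.
case: u v => [u Su] [v Sv] /= /funext uv; subst v.
by congr Smap; apply: Prop_irrelevance.
Qed.

Lemma smooth_func (X Y : frolicher) (u : X -> Y) h :
  smooth u -> func Y h -> func X (h \o u).
Proof. by move=> Su /funcE Fh; apply/funcE => c /Su /Fh. Qed.

Lemma smooth_into (Z X : frolicher) (u : Z -> X) :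
  (forall h, func X h -> func Z (h \o u)) -> smooth u.
Proof.
by move=> Su c Cc; apply/curveE => h /Su; rewrite funcE => /(_ _ Cc).
Qed.

Lemma smooth_initial (Z : frolicher) T (F0 : set (T -> R)) (u : Z -> initial F0) :
  (forall h, F0 h -> func Z (h \o u)) -> smooth u.
Proof. by move=> Su c Cc h /Su; rewrite funcE => /(_ _ Cc). Qed.

Lemma smooth_final (Z : frolicher) T (C0 : set (R -> T)) (u : final C0 -> Z) :
  (forall c, C0 c -> curve Z (u \o c)) -> smooth u.
Proof.
move=> Su; apply: smooth_into => h Fh c Cc.
by move: (Su c Cc); rewrite curveE => /(_ _ Fh).
Qed.

Lemma curve_final T (C0 : set (R -> T)) c : C0 c -> curve (final C0) c.
Proof. by move=> Cc f; apply. Qed.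

Lemma func_initial T (F0 : set (T -> R)) f : F0 f -> func (initial F0) f.
Proof. by move=> Ff c; apply. Qed.

Definition sid (X : frolicher) : smap X X := @Smap X X id (fun c Cc => Cc).

Definition scomp (X Y Z : frolicher) (v : smap Y Z) (u : smap X Y) : smap X Z :=
  @Smap X Z (v \o u) (fun c Cc => sfunP v (sfunP u Cc)).

Program Definition scst (X Y : frolicher) (y : Y) : smap X Y :=
  @Smap X Y (fun _ => y) _.
Next Obligation.
move=> X Y y; apply: smooth_into => h _; apply/funcE => c _; exact: Cinf_cst.
Qed.

Definition siso (X Y : frolicher) (u : smap X Y) : Prop :=
  exists v : smap Y X, cancel u v /\ cancel v u.

(* The structure functions of [line] are the smooth functions R -> R. *)
Definition line : frolicher := initial [set (id : R -> R)].

(* R^k as a product of lines. By Boman's theorem its structure functions are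
   exactly the elements of [Cinf]. *)
Definition space (k : nat) : frolicher :=
  initial [set f : 'rV[R]_k -> R | exists i, f = fun v => v 0 i].

Definition prodf (X Y : frolicher) : frolicher :=
  initial ([set f : X * Y -> R | exists2 g, func X g & f = g \o fst] `|`
           [set f : X * Y -> R | exists2 g, func Y g & f = g \o snd]).

Definition subf (X : frolicher) (P : X -> Prop) : frolicher :=
  initial [set f : {x : X | P x} -> R | exists2 g, func X g & f = g \o sval].

(* The exponential X^Y: cartesian closedness of the category forces the curves
   of X^Y to be the maps with smooth transpose, so its structure is the one
   they generate. *)
Definition expo (Y X : frolicher) : frolicher :=
  final [set c : R -> smap Y X |
    smooth (fun p : prodf line Y => c p.1 p.2 : X)].

Lemma curve_line (a : R -> R) : curve (line) a <-> Cinf (a : R^o -> R).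
Proof. by split=> [/(_ id erefl)|Ca _ ->]. Qed.

Lemma curve_space k (c : R -> 'rV[R]_k) :
  curve (space k) c <-> forall i, Cinf (fun t : R^o => c t 0 i).
Proof.
split=> [Cc i|Cc f [i ->]]; last exact: Cc.
by apply: (Cc (fun v => v 0 i)); exists i.
Qed.

Lemma curve_prodf (X Y : frolicher) (c : R -> X * Y) :
  curve (prodf X Y) c <-> curve X (fst \o c) /\ curve Y (snd \o c).
Proof.
split=> [Cc|[C1 C2] f].
  by split; apply/curveE => g Fg;
    [apply: (Cc (g \o fst)); left; exists g | apply: (Cc (g \o snd)); right; exists g].
by case=> -[g Fg ->]; [move/curveE: C1 | move/curveE: C2]; apply.
Qed.

Lemma curve_comp (X : frolicher) (c : R -> X) (a : R -> R) :
  curve X c -> Cinf (a : R^o -> R) -> curve X (c \o a).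
Proof.
move=> /curveE Cc Ca; apply/curveE => f /Cc Cfc.
exact: (Cinf_comp1 Cfc Ca).
Qed.

Lemma smooth_curry (Z Y X : frolicher) (g : Z -> smap Y X) :
  (forall a b, curve Z a -> curve Y b -> curve X (fun t => g (a t) (b t))) ->
  smooth (g : Z -> expo Y X).
Proof.
move=> Sg c Cc; apply: curve_final => /= p /curve_prodf[/curve_line C1 C2].
exact: (Sg (c \o (fst \o p)) (snd \o p) (curve_comp Cc C1) C2).
Qed.

Program Definition ev (Y X : frolicher) (y : Y) : smap (expo Y X) X :=
  @Smap (expo Y X) X (fun u : smap Y X => u y) _.
Next Obligation.
move=> Y X y; apply: smooth_final => c /= Sc.
apply: (Sc (fun t => (t, y))); apply/curve_prodf; split.
  by apply/curve_line; apply: Cinf_id.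
by apply: (@sfunP _ _ (scst line y) id); apply/curve_line; apply: Cinf_id.
Qed.

Program Definition sval_smap (X : frolicher) (P : X -> Prop) : smap (subf P) X :=
  @Smap (subf P) X sval _.
Next Obligation.
move=> X P; apply: smooth_into => h Fh.
by apply: (@func_initial _ _ (h \o sval)); exists h.
Qed.

Lemma smooth_subf (Z X : frolicher) (P : X -> Prop) (u : Z -> subf P) :
  smooth (fun z => sval (u z) : X) -> smooth u.
Proof.
by move=> Su; apply: smooth_initial => _ [g Fg ->]; apply: smooth_func Su Fg.
Qed.

End Frolicher.
Arguments frolicher : clear implicits.
Arguments curve {R}.
Arguments func {R}.

Section Weil.
Context {R : realType}.

Definition is_ideal k (I : set ('rV[R]_k -> R)) : Prop :=
  [/\ I `<=` Cinf, I (fun=> 0),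
      forall a b, I a -> I b -> I (fun s => a s + b s) &
      forall c a, Cinf c -> I a -> I (fun s => c s * a s)].

Record walg := Walg {
  wdim : nat;
  widl : set ('rV[R]_wdim -> R);
  widlP : is_ideal widl }.
Arguments widl : clear implicits.

(* [Walg] is C^oo(R^k)/I for an arbitrary ideal I; [weil] says that I is contained
   in the ideal m of functions vanishing at 0 and contains m^r, which is
   generated by the products of r elements of m. *)
Definition weil (W : walg) : Prop :=
  (forall a, widl W a -> a 0 = 0) /\
  exists r, forall a : 'I_r -> 'rV[R]_(wdim W) -> R,
    (forall i, Cinf (a i) /\ a i 0 = 0) -> widl W (fun s => \prod_i a i s).

Definition ideal_gen k (G : set ('rV[R]_k -> R)) : set ('rV[R]_k -> R) :=
  [set a : 'rV[R]_k -> R | forall K, is_ideal K -> G `<=` K -> K a].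

Lemma is_ideal_Cinf k : is_ideal (Cinf : set ('rV[R]_k -> R)).
Proof.
by split=> [//||a b|c a]; [exact: Cinf_cst | exact: CinfD | exact: CinfM].
Qed.

Lemma is_ideal_gen k (G : set ('rV[R]_k -> R)) :
  G `<=` Cinf -> is_ideal (ideal_gen G).
Proof.
move=> GC; split=> [a Ia|K [_ K0 _ _] _ //|a b Ia Ib K IK GK|c a Cc Ia K IK GK].
- by apply: Ia => //; apply: is_ideal_Cinf.
- by have [_ _ KD _] := IK; apply: KD; [apply: Ia | apply: Ib].
- by have [_ _ _ KM] := IK; apply: KM => //; apply: Ia.
Qed.

Definition walg_gen k (G : set ('rV[R]_k -> R)) (GC : G `<=` Cinf) : walg :=
  Walg (is_ideal_gen GC).

Lemma ideal_gen_sub k (G : set ('rV[R]_k -> R)) : G `<=` ideal_gen G.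
Proof. by move=> a Ga K _; apply. Qed.

Definition Cinf_map k l (t : 'rV[R]_l -> 'rV[R]_k) : Prop :=
  forall j, Cinf (fun s => t s 0 j).

Lemma ideal_gen_comp k l (G : set ('rV[R]_k -> R)) (J : set ('rV[R]_l -> R))
    (t : 'rV[R]_l -> 'rV[R]_k) :
  Cinf_map t -> is_ideal J -> (forall g, G g -> J (g \o t)) ->
  G `<=` Cinf -> forall a, ideal_gen G a -> J (a \o t).
Proof.
move=> Ct [JC J0 JD JM] GJ GC a Ia.
pose K := [set a : 'rV[R]_k -> R | Cinf a /\ J (a \o t)].
suff [] : K a by [].
apply: Ia => [|g Gg]; last by split; [apply: GC | apply: GJ].
split=> [b []//||b c [Cb Jb] [Cc Jc]|c b Cc [Cb Jb]]; split=> //.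
- exact: Cinf_cst.
- exact: CinfD.
- exact: (JD (b \o t) (c \o t)).
- exact: CinfM.
- by apply: (JM (c \o t) (b \o t)) => //; apply: Cinf_comp.
Qed.

Lemma wprod_subproof (W1 W2 : walg) :
  [set b : 'rV[R]_(wdim W1 + wdim W2) -> R |
     exists2 a, widl W1 a & b = a \o lsubmx] `|`
  [set b | exists2 a, widl W2 a & b = a \o rsubmx] `<=` Cinf.
Proof.
move=> b [] [a Ia ->]; apply: Cinf_comp => [|j].
- by have [+ _ _ _] := widlP W1; apply.
- by under eq_fun do rewrite mxE; apply: Cinf_coord.
- by have [+ _ _ _] := widlP W2; apply.
- by under eq_fun do rewrite mxE; apply: Cinf_coord.
Qed.

(* W1 (x)_oo W2: the ideal generated in C^oo(R^(k+l)) by the pullbacks of both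
   ideals. *)
Definition wprod (W1 W2 : walg) : walg := walg_gen (@wprod_subproof W1 W2).

(* A morphism of algebras W -> W', presented by a smooth map in the opposite
   direction that fixes 0 and induces it by substitution. *)
Record wmor (W W' : walg) := Wmor {
  wfun :> 'rV[R]_(wdim W') -> 'rV[R]_(wdim W);
  wfunC : Cinf_map wfun;
  wfun0 : wfun 0 = 0;
  wfunI : forall a, widl W a -> widl W' (a \o wfun) }.

End Weil.
Arguments walg : clear implicits.
Arguments widl {R}.

Section Prolongation.
Context {R : realType}.
Implicit Types (X Y Z : frolicher R) (W : walg R).

Definition weq X W (f g : smap (space (wdim W)) X) : Prop :=
  f 0 = g 0 /\ forall h, func X h -> widl W (fun s => h (f s) - h (g s)).

(* The underlying set of X (x) W: equivalence classes for [weq]. *)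
Record wclass X W := Wclass {
  wset : set (smap (space (wdim W)) X);
  wsetP : exists f, wset = weq f }.

Definition wpi_ X W (f : smap (space (wdim W)) X) : wclass X W :=
  @Wclass X W (weq f) (ex_intro _ f erefl).

Definition tens X W : frolicher R :=
  final [set c : R -> wclass X W |
    exists2 c', curve (expo (space (wdim W)) X) c' & c = wpi_ (W := W) \o c'].

Program Definition wpi X W : smap (expo (space (wdim W)) X) (tens X W) :=
  @Smap _ (expo (space (wdim W)) X) (tens X W) (@wpi_ X W) _.
Next Obligation. by move=> X W c Cc; apply: curve_final; exists c. Qed.

Lemma weq_refl X W f : @weq X W f f.
Proof.
split=> // h Fh; under eq_fun do rewrite subrr.
by have [] := widlP W.
Qed.

Lemma weq_sym X W f g : @weq X W f g -> weq g f.
Proof.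
move=> [fg0 fg]; split=> // h /fg; have [_ _ _ IM] := widlP W.
move=> /(IM (fun=> -1) _ (Cinf_cst _)).
by under eq_fun do rewrite mulN1r opprB.
Qed.

Lemma weq_trans X W f g k : @weq X W f g -> weq g k -> weq f k.
Proof.
move=> [fg0 fg] [gk0 gk]; split=> [|h Fh]; first by rewrite fg0.
have [_ _ ID _] := widlP W; have := ID _ _ (fg h Fh) (gk h Fh).
by under eq_fun do rewrite subrKA.
Qed.

Lemma wpiP X W (f g : smap (space (wdim W)) X) : wpi X W f = wpi X W g <-> weq f g.
Proof.
split=> [[]/(congr1 (@^~ g)) -> |fg]; first exact: weq_refl.
rewrite /wpi /= /wpi_.
have E : weq f = weq g.
  apply/funext=> k; apply/propext; split; first exact/weq_trans/weq_sym.
  exact: weq_trans.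
by move: (ex_intro _ _ _) (ex_intro _ _ _); rewrite E => p q; congr Wclass; apply: Prop_irrelevance.
Qed.

Definition wrepr X W (z : tens X W) : smap (space (wdim W)) X :=
  sval (cid (wsetP z)).

Lemma wreprK X W (z : tens X W) : wpi X W (wrepr z) = z.
Proof.
rewrite /wrepr; case: z => A PA /=; case: cid => f /= E.
by rewrite /wpi_; move: (PA) (ex_intro _ _ _); rewrite E => p q; congr Wclass; apply: Prop_irrelevance.
Qed.

Lemma weq_repr X W (f : smap (space (wdim W)) X) : weq (wrepr (wpi X W f)) f.
Proof. by apply/wpiP; rewrite wreprK. Qed.

Lemma smooth_tens X W Z (u : tens X W -> Z) :
  smooth (fun f : expo (space (wdim W)) X => u (wpi X W f)) -> smooth u.
Proof. by move=> Su; apply: smooth_final => _ [c Cc ->]; apply: Su. Qed.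

(* The canonical projection X (x) W -> X. *)
Definition base X W (z : tens X W) : X := wrepr z 0.

Lemma base_pi X W (f : smap (space (wdim W)) X) : base (wpi X W f) = f 0.
Proof. by case: (weq_repr f). Qed.

Lemma smooth_Cinf_map k l (t : 'rV[R]_l -> 'rV[R]_k) :
  Cinf_map t -> smooth (t : space l -> space k).
Proof.
move=> Ct c /curve_space Cc; apply/curve_space => i.
exact: (Cinf_comp (Ct i) Cc).
Qed.

Definition wsmap W W' (t : wmor W W') : smap (space (wdim W')) (space (wdim W)) :=
  Smap (smooth_Cinf_map (wfunC t)).

Lemma smooth_post X Y Z (u : smap X Y) :
  smooth (fun f : expo Z X => scomp u f : expo Z Y).
Proof.
apply: smooth_final => c /= Sc; apply: curve_final => /= p Cp.
exact: (sfunP u (Sc p Cp)).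
Qed.

Lemma smooth_pre X Y Z (v : smap Y Z) :
  smooth (fun f : expo Z X => scomp f v : expo Y X).
Proof.
apply: smooth_final => c /= Sc; apply: curve_final => /= p /curve_prodf[Cp1 Cp2].
apply: (Sc (fun t => ((p t).1, v (p t).2))); apply/curve_prodf; split=> //.
exact: (sfunP v Cp2).
Qed.

Definition tensl_fun X Y (u : smap X Y) W (z : tens X W) : tens Y W :=
  wpi Y W (scomp u (wrepr z)).

Lemma tenslE X Y (u : smap X Y) W (f : smap (space (wdim W)) X) :
  tensl_fun u (wpi X W f) = wpi Y W (scomp u f).
Proof.
apply/wpiP; have [f0 fh] := weq_repr f; split=> /= [|h Fh]; first by rewrite f0.
by apply: (fh (h \o u)); apply: smooth_func Fh; apply: sfunP.
Qed.

Program Definition tensl X Y (u : smap X Y) W : smap (tens X W) (tens Y W) :=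
  @Smap _ (tens X W) (tens Y W) (@tensl_fun X Y u W) _.
Next Obligation.
move=> X Y u W; apply: smooth_tens.
under eq_fun do rewrite tenslE.
move=> c Cc; exact: (sfunP (wpi Y W) (@smooth_post X Y (space (wdim W)) u c Cc)).
Qed.

Definition tensr_fun X W W' (t : wmor W W') (z : tens X W) : tens X W' :=
  wpi X W' (scomp (wrepr z) (wsmap t)).

Lemma tensrE X W W' (t : wmor W W') (f : smap (space (wdim W)) X) :
  tensr_fun t (wpi X W f) = wpi X W' (scomp f (wsmap t)).
Proof.
apply/wpiP; have [f0 fh] := weq_repr f; split=> /= [|h Fh]; first by rewrite wfun0 f0.
exact: (wfunI t (fh h Fh)).
Qed.

Program Definition tensr X W W' (t : wmor W W') : smap (tens X W) (tens X W') :=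
  @Smap _ (tens X W) (tens X W') (@tensr_fun X W W' t) _.
Next Obligation.
move=> X W W' t; apply: smooth_tens.
under eq_fun do rewrite tensrE.
move=> c Cc; exact: (sfunP (wpi X W') (@smooth_pre X _ _ (wsmap t) c Cc)).
Qed.

(* A cone over a finite diagram, indexed by a finite graph, that is a limit of
   R-algebras. Such limits are created by the underlying sets: every compatible
   family comes from exactly one element of the apex. The limit is deliberately
   not taken in the category of Weil algebras, where R is terminal, so that the
   empty diagram would force every microlinear space to be a point. *)
Definition alg_limit (V E : finType) (src tgt : E -> V) (D : V -> walg R)
    (a : forall e, wmor (D (src e)) (D (tgt e)))
    (W : walg R) (p : forall v, wmor W (D v)) : Prop :=
  [/\ forall e b, Cinf b -> widl (D (tgt e))
        (fun s => b (p (src e) (a e s)) - b (p (tgt e) s)),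
      forall b : forall v, 'rV[R]_(wdim (D v)) -> R, (forall v, Cinf (b v)) ->
        (forall e, widl (D (tgt e)) (fun s => b (src e) (a e s) - b (tgt e) s)) ->
        exists2 c, Cinf c & forall v, widl (D v) (fun s => c (p v s) - b v s) &
      forall c, Cinf c -> (forall v, widl (D v) (c \o p v)) -> widl W c].

Definition frolicher_limit (V E : finType) (src tgt : E -> V) (D : V -> frolicher R)
    (a : forall e, smap (D (src e)) (D (tgt e)))
    (L : frolicher R) (p : forall v, smap L (D v)) : Prop :=
  (forall e z, a e (p (src e) z) = p (tgt e) z) /\
  forall (Z : frolicher R) (q : forall v, smap Z (D v)),
    (forall e z, a e (q (src e) z) = q (tgt e) z) ->
    exists! u : smap Z L, forall v z, p v (u z) = q v z.

Definition microlinear X : Prop :=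
  forall (V E : finType) (src tgt : E -> V) (D : V -> walg R)
    (a : forall e, wmor (D (src e)) (D (tgt e)))
    (W : walg R) (p : forall v, wmor W (D v)),
    (forall v, weil (D v)) -> weil W -> alg_limit a p ->
    frolicher_limit (fun e => tensr X (a e)) (fun v => tensr X (p v)).

Section Iterate.
Context {X : frolicher R} {W1 W2 : walg R}.

Lemma curve_row_mx k l (a : R -> 'rV[R]_k) (b : R -> 'rV[R]_l) :
  curve (space k) a -> curve (space l) b ->
  curve (space (k + l)) (fun t => row_mx (a t) (b t)).
Proof.
move=> /curve_space Ca /curve_space Cb; apply/curve_space => i.
under eq_fun do rewrite mxE; case: (fintype.split i) => j; [exact: Ca | exact: Cb].
Qed.

Lemma curve_cst Y (y : Y) : curve Y (fun _ => y).
Proof.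
by apply: (@sfunP _ _ _ (scst line y) id); apply/curve_line; apply: Cinf_id.
Qed.

Program Definition sslice (f : smap (space (wdim W1 + wdim W2)) X)
    (r : 'rV[R]_(wdim W2)) : smap (space (wdim W1)) X :=
  @Smap _ (space (wdim W1)) X (fun s => f (row_mx s r)) _.
Next Obligation.
move=> f r c Cc; apply: (sfunP f (curve_row_mx Cc _)).
exact: (@curve_cst (space _)).
Qed.

Program Definition scurry (f : smap (space (wdim W1 + wdim W2)) X) :
    smap (space (wdim W2)) (tens X W1) :=
  @Smap _ (space (wdim W2)) (tens X W1) (fun r => wpi X W1 (sslice f r)) _.
Next Obligation.
move=> f c Cc; apply: (@sfunP _ _ _ (wpi X W1)).
apply: (smooth_curry (Z := space (wdim W2)) (g := sslice f)) Cc => a b Ca Cb.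
exact: (sfunP f (curve_row_mx Cb Ca)).
Qed.

(* The identification of X (x) (W1 (x)_oo W2) with (X (x) W1) (x) W2 by currying
   a representative; [iter_tensE] shows that the choice of the representative is
   irrelevant for Weil exponentiable X. *)
Definition iter_tens (z : tens X (wprod W1 W2)) : tens (tens X W1) W2 :=
  wpi (tens X W1) W2 (scurry (wrepr z)).

End Iterate.

(* (X (x) (W1 (x)_oo W2))^Y = (X (x) W1)^Y (x) W2 through the canonical map:
   evaluation at any y of Y turns the isomorphism Phi into the currying of
   representatives. This determines Phi and makes it natural. *)
Definition weil_exponentiable X : Prop :=
  forall (W1 W2 : walg R), weil W1 -> weil W2 -> forall Y : frolicher R,
  exists2 Phi : smap (expo Y (tens X (wprod W1 W2))) (tens (expo Y (tens X W1)) W2),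
    siso Phi &
    forall (u : smap Y (tens X (wprod W1 W2))) (y : Y)
      (f : smap (space (wdim W1 + wdim W2)) X),
      u y = wpi X (wprod W1 W2) f ->
      tensl (ev (tens X W1) y) W2 (Phi u) = wpi (tens X W1) W2 (scurry f).

Lemma iter_tensE X W1 W2 (f : smap (space (wdim W1 + wdim W2)) X) :
  weil_exponentiable X -> weil W1 -> weil W2 ->
  iter_tens (wpi X (wprod W1 W2) f) = wpi (tens X W1) W2 (scurry f).
Proof.
move=> EX w1 w2; have [Phi _ PhiE] := EX W1 W2 w1 w2 line.
set z := wpi X (wprod W1 W2) f.
by rewrite -(PhiE (scst line z) 0 f erefl) (PhiE (scst line z) 0 (wrepr z)) ?wreprK.
Qed.

(* The fibre (X (x) W)_x. *)
Definition fib X W (x : X) : frolicher R := subf (fun z : tens X W => base z = x).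

Program Definition srestr X Z (P : X -> Prop) (u : smap Z X) (uP : forall z, P (u z)) :
    smap Z (subf P) :=
  @Smap _ Z (subf P) (fun z => exist _ (u z) (uP z)) _.
Next Obligation. by move=> X Z P u uP; apply: smooth_subf; apply: sfunP. Qed.

Lemma base_tensr X W W' (t : wmor W W') (z : tens X W) : base (tensr X t z) = base z.
Proof. by apply: etrans (base_pi _) _; rewrite /= wfun0. Qed.

Definition fibr X W W' (x : X) (t : wmor W W') : smap (fib W x) (fib W' x) :=
  srestr (u := scomp (tensr X t) (sval_smap _))
    (fun z => etrans (base_tensr t (sval z)) (proj2_sig z)).

Section Family.
Context {X : frolicher R} {W W1 W2 : walg R}.

(* Morphisms t for which id (x) t maps (X (x) W)_x into (X (x) W1)_x (x) W2. *)
Definition wfibred (t : wmor W (wprod W1 W2)) : Prop := forall r, t (row_mx 0 r) = 0.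

Program Definition sfamily (t : wmor W (wprod W1 W2)) (tP : wfibred t) (x : X)
    (z : fib W x) : smap (space (wdim W2)) (fib W1 x) :=
  srestr (u := scurry (scomp (wrepr (sval z)) (wsmap t))) _.
Next Obligation. by move=> t tP x z r; apply: etrans (base_pi _) _; rewrite /= tP; exact: (proj2_sig z). Qed.

(* The restriction of id (x) t to (X (x) W)_x, with values in
   (X (x) W1)_x (x) W2: the class of r |-> [s |-> f (t (s, r))] for a
   representative f, which stays in the fibre by [wfibred]. It lies over
   [iter_tens] of the unrestricted map, by [fibr_iterE]. *)
Definition fibr_iter (t : wmor W (wprod W1 W2)) (tP : wfibred t) (x : X) (z : fib W x) :
    tens (fib W1 x) W2 :=
  wpi (fib W1 x) W2 (sfamily tP z).

Lemma fibr_iterE (t : wmor W (wprod W1 W2)) (tP : wfibred t) (x : X) (z : fib W x) :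
  weil_exponentiable X -> weil W1 -> weil W2 ->
  tensl (sval_smap _) W2 (fibr_iter tP z) = iter_tens (tensr X t (sval z)).
Proof.
move=> EX w1 w2; rewrite /= /tensr_fun iter_tensE // /fibr_iter tenslE.
by congr (wpi _ _ _); apply: smap_ext.
Qed.

End Family.

End Prolongation.

Section Infinitesimal.
Context {R : realType}.

Lemma widlM (W : walg R) c a : Cinf c -> widl W a -> widl W (fun s => c s * a s).
Proof. by case: (widlP W) => _ _ _; apply. Qed.

Lemma widl_sum (W : walg R) (I : Type) (r : seq I) (F : I -> 'rV[R]_(wdim W) -> R) :
  (forall i, widl W (F i)) -> widl W (fun s => \sum_(i <- r) F i s).
Proof.
have [_ W0 WD _] := widlP W; move=> WF; elim: r => [|i r IH].
  by under eq_fun do rewrite big_nil.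
by under eq_fun do rewrite big_cons; apply: WD.
Qed.

Lemma widl_prodl (W1 W2 : walg R) a : widl W1 a -> widl (wprod W1 W2) (a \o lsubmx).
Proof. by move=> Wa; apply: ideal_gen_sub; left; exists a. Qed.

Lemma widl_prodr (W1 W2 : walg R) a : widl W2 a -> widl (wprod W1 W2) (a \o rsubmx).
Proof. by move=> Wa; apply: ideal_gen_sub; right; exists a. Qed.

Definition wmor_gen k (G : set ('rV[R]_k -> R)) (GC : G `<=` Cinf) (W : walg R)
    (t : 'rV[R]_(wdim W) -> 'rV[R]_k) (tC : Cinf_map t) (t0 : t 0 = 0)
    (tG : forall g, G g -> widl W (g \o t)) : wmor (walg_gen GC) W :=
  Wmor (W := walg_gen GC) tC t0 (ideal_gen_comp tC (widlP W) tG GC).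

(* The ideals (X_1^2, ..., X_n^2) of W_{D^n} and (X^(m+1)) of W_{D_m}. *)
Definition cube_gen n : set ('rV[R]_n -> R) :=
  [set b : 'rV[R]_n -> R | exists i, b = fun d => d 0 i ^+ 2].

Definition ord_gen m : set ('rV[R]_1 -> R) :=
  [set b : 'rV[R]_1 -> R | b = fun d => d 0 0 ^+ m.+1].

Lemma cube_genC n : @cube_gen n `<=` Cinf.
Proof. by move=> _ [i ->]; apply/CinfX/Cinf_coord. Qed.

Lemma ord_genC m : @ord_gen m `<=` Cinf.
Proof. by move=> _ ->; apply/CinfX/Cinf_coord. Qed.

Definition cubeW n : walg R := walg_gen (@cube_genC n).
Definition ordW m : walg R := walg_gen (@ord_genC m).

Lemma cubeW_sqr n i : widl (cubeW n) (fun d => d 0 i ^+ 2).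
Proof. by apply: ideal_gen_sub; exists i. Qed.

Lemma ordW_exp m : widl (ordW m) (fun d => d 0 0 ^+ m.+1).
Proof. exact: ideal_gen_sub. Qed.

Definition perm_map n (sigma : 'S_n) (d : 'rV[R]_n) : 'rV[R]_n :=
  \row_j d 0 (sigma j).

Definition scale_map n (alpha : R) (i : 'I_n) (d : 'rV[R]_n) : 'rV[R]_n :=
  \row_j if j == i then alpha * d 0 j else d 0 j.

Definition del_map n (i : 'I_n.+1) (d : 'rV[R]_n.+1) : 'rV[R]_n :=
  \row_j d 0 (lift i j).

Definition ins_map n (i : 'I_n.+1) (d : 'rV[R]_n) : 'rV[R]_n.+1 :=
  \row_j if unlift i j is Some k then d 0 k else 0.

(* (d_1, ..., d_n, e) |-> (d_1, ..., e d_i, ..., d_n) *)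
Definition mu_map n (i : 'I_n) (de : 'rV[R]_(n + 1)) : 'rV[R]_n :=
  \row_j if j == i then rsubmx de 0 0 * lsubmx de 0 j else lsubmx de 0 j.

(* (d_1, ..., d_(n+1)) |-> (d_1, ..., d_(n-1), d_n d_(n+1)), relevant for n > 0 *)
Definition kappa_map n (d : 'rV[R]_n.+1) : 'rV[R]_n :=
  \row_j if j.+1 == n :> nat then d 0 (widen_ord (leqnSn n) j) * d 0 ord_max
         else d 0 (widen_ord (leqnSn n) j).

Definition plus_map n (d : 'rV[R]_n) : 'rV[R]_1 := const_mx (\sum_i d 0 i).

Definition mul_map (de : 'rV[R]_(1 + 1)) : 'rV[R]_1 :=
  const_mx (lsubmx de 0 0 * rsubmx de 0 0).

Definition poly_map (rho : {poly R}) (d : 'rV[R]_1) : 'rV[R]_1 :=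
  const_mx rho.[d 0 0].

Program Definition wperm n (sigma : 'S_n) : wmor (cubeW n) (cubeW n) :=
  @wmor_gen _ _ (@cube_genC n) (cubeW n) (perm_map sigma) _ _ _.
Next Obligation.
by move=> n sigma j; under eq_fun do rewrite mxE; apply: Cinf_coord.
Qed.
Next Obligation. by move=> n sigma; apply/rowP => j; rewrite !mxE. Qed.
Next Obligation.
move=> n sigma _ [i ->]; rewrite /comp; under eq_fun do rewrite mxE.
exact: cubeW_sqr.
Qed.

Program Definition wscale n (alpha : R) (i : 'I_n) : wmor (cubeW n) (cubeW n) :=
  @wmor_gen _ _ (@cube_genC n) (cubeW n) (scale_map alpha i) _ _ _.
Next Obligation.
move=> n alpha i j; under eq_fun do rewrite mxE.
case: eqP => _; last exact: Cinf_coord.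
apply: CinfM; [exact: Cinf_cst | exact: Cinf_coord].
Qed.
Next Obligation.
by move=> n alpha i; apply/rowP => j; rewrite !mxE mulr0 if_same.
Qed.
Next Obligation.
move=> n alpha i _ [j ->]; rewrite /comp; under eq_fun do rewrite mxE.
case: eqP => _; last exact: cubeW_sqr.
under eq_fun do rewrite exprMn.
by apply: (@widlM (cubeW n)); [apply: Cinf_cst | apply: cubeW_sqr].
Qed.

Program Definition wdel n (i : 'I_n.+1) : wmor (cubeW n) (cubeW n.+1) :=
  @wmor_gen _ _ (@cube_genC n) (cubeW n.+1) (del_map i) _ _ _.
Next Obligation.
by move=> n i j; under eq_fun do rewrite mxE; apply: Cinf_coord.
Qed.
Next Obligation. by move=> n i; apply/rowP => j; rewrite !mxE. Qed.
Next Obligation.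
move=> n i _ [j ->]; rewrite /comp; under eq_fun do rewrite mxE.
exact: cubeW_sqr.
Qed.

Program Definition wins n (i : 'I_n.+1) : wmor (cubeW n.+1) (cubeW n) :=
  @wmor_gen _ _ (@cube_genC n.+1) (cubeW n) (ins_map i) _ _ _.
Next Obligation.
move=> n i j; under eq_fun do rewrite mxE.
by case: (unlift i j) => [k|]; [apply: Cinf_coord | apply: Cinf_cst].
Qed.
Next Obligation.
by move=> n i; apply/rowP => j; rewrite !mxE; case: unlift => [k|//]; rewrite mxE.
Qed.
Next Obligation.
move=> n i _ [j ->]; rewrite /comp; under eq_fun do rewrite mxE.
case: (unlift i j) => [k|]; first exact: cubeW_sqr.
by under eq_fun do rewrite expr0n; case: (widlP (cubeW n)).
Qed.

Lemma Cinf_lsub k l (j : 'I_k) : Cinf (fun v : 'rV[R]_(k + l) => lsubmx v 0 j).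
Proof. by under eq_fun do rewrite mxE; apply: Cinf_coord. Qed.

Lemma Cinf_rsub k l (j : 'I_l) : Cinf (fun v : 'rV[R]_(k + l) => rsubmx v 0 j).
Proof. by under eq_fun do rewrite mxE; apply: Cinf_coord. Qed.

Program Definition wmu n m (i : 'I_n) : wmor (cubeW n) (wprod (cubeW n) (ordW m)) :=
  @wmor_gen _ _ (@cube_genC n) (wprod (cubeW n) (ordW m)) (mu_map i) _ _ _.
Next Obligation.
move=> n m i j; under eq_fun do rewrite mxE.
case: eqP => _; last exact: Cinf_lsub.
apply: CinfM; [exact: Cinf_rsub | exact: Cinf_lsub].
Qed.
Next Obligation.
by move=> n m i; apply/rowP => j; rewrite !mxE mulr0 if_same.
Qed.
Next Obligation.
move=> n m i _ [j ->].
have -> : (fun d : 'rV[R]_n => d 0 j ^+ 2) \o @mu_map n i =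
    (fun de => (if j == i then rsubmx de 0 0 else 1) ^+ 2 *
               ((fun d : 'rV[R]_n => d 0 j ^+ 2) \o lsubmx) de).
  apply/funext => de; rewrite /= [in LHS]mxE.
  by case: eqP => _; rewrite ?exprMn ?expr1n ?mul1r.
apply: (@widlM (wprod (cubeW n) (ordW m))); last exact: (widl_prodl (cubeW_sqr j)).
by apply: CinfX; case: eqP => _; [apply: Cinf_rsub | apply: Cinf_cst].
Qed.

Program Definition wkappa n : wmor (cubeW n) (cubeW n.+1) :=
  @wmor_gen _ _ (@cube_genC n) (cubeW n.+1) (@kappa_map n) _ _ _.
Next Obligation.
move=> n j; under eq_fun do rewrite mxE.
case: eqP => _; last exact: Cinf_coord.
by apply: CinfM; apply: Cinf_coord.
Qed.
Next Obligation.
by move=> n; apply/rowP => j; rewrite !mxE mulr0 if_same.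
Qed.
Next Obligation.
move=> n _ [j ->]; rewrite /comp; under eq_fun do rewrite mxE.
case: eqP => _; last exact: cubeW_sqr.
under eq_fun do rewrite exprMn.
by apply: (@widlM (cubeW n.+1)); [apply/CinfX/Cinf_coord | apply: cubeW_sqr].
Qed.

Lemma widl_sum_exp n (r : seq 'I_n) p : (size r < p)%N ->
  widl (cubeW n) (fun d => (\sum_(i <- r) d 0 i) ^+ p).
Proof.
elim: r p => [|i r IH] p /= rp.
  under eq_fun do rewrite big_nil expr0n gtn_eqF //.
  by case: (widlP (cubeW n)).
under eq_fun do rewrite big_cons exprDn.
have CS : Cinf (fun d : 'rV[R]_n => \sum_(i <- r) d 0 i).
  by apply: Cinf_sum => j; apply: Cinf_coord.
apply: (widl_sum (W := cubeW n)) => j.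
under eq_fun do rewrite -mulr_natl.
apply: (@widlM (cubeW n)); first exact: Cinf_cst.
have [rj|jr] := ltnP (size r) j.
  by apply: (@widlM (cubeW n)); [apply/CinfX/Cinf_coord | apply: IH].
have -> : (p - j = (p - j - 2) + 2)%N by rewrite subnK // leq_subRL; lia.
under eq_fun do rewrite exprD mulrAC.
apply: (@widlM (cubeW n)); last exact: cubeW_sqr.
by apply: CinfM; apply: CinfX => //; apply: Cinf_coord.
Qed.

Program Definition wplus n : wmor (ordW n) (cubeW n) :=
  @wmor_gen _ _ (@ord_genC n) (cubeW n) (@plus_map n) _ _ _.
Next Obligation.
move=> n j; under eq_fun do rewrite mxE.
by apply: Cinf_sum => i; apply: Cinf_coord.
Qed.
Next Obligation.
by move=> n; apply/rowP => j; rewrite !mxE big1 // => i _; rewrite mxE.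
Qed.
Next Obligation.
move=> n _ ->; rewrite /comp; under eq_fun do rewrite mxE.
by apply: widl_sum_exp; rewrite /index_enum -enumT size_enum_ord.
Qed.

Program Definition woscale n (alpha : R) : wmor (ordW n) (ordW n) :=
  @wmor_gen _ _ (@ord_genC n) (ordW n) ( *:%R alpha) _ _ _.
Next Obligation.
move=> n alpha j; under eq_fun do rewrite mxE.
by apply: CinfM; [apply: Cinf_cst | apply: Cinf_coord].
Qed.
Next Obligation. by move=> n alpha; rewrite scaler0. Qed.
Next Obligation.
move=> n alpha _ ->; rewrite /comp; under eq_fun do rewrite mxE exprMn.
by apply: (@widlM (ordW n)); [apply: Cinf_cst | apply: ordW_exp].
Qed.

Lemma Cinf_mul_map : Cinf_map mul_map.
Proof.
move=> j; under eq_fun do rewrite mxE.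
by apply: CinfM; [apply: Cinf_lsub | apply: Cinf_rsub].
Qed.

Lemma mul_map0 : mul_map 0 = 0.
Proof. by apply/rowP => j; rewrite !mxE mulr0. Qed.

(* Multiplication D_n x D_m -> D_n, and below D_(n+1) x D_n -> D_n *)
Program Definition wmul n m : wmor (ordW n) (wprod (ordW n) (ordW m)) :=
  @wmor_gen _ _ (@ord_genC n) (wprod (ordW n) (ordW m)) mul_map Cinf_mul_map mul_map0 _.
Next Obligation.
move=> n m _ ->.
have -> : (fun d : 'rV[R]_1 => d 0 0 ^+ n.+1) \o mul_map =
    (fun de => rsubmx de 0 0 ^+ n.+1 *
               ((fun d : 'rV[R]_1 => d 0 0 ^+ n.+1) \o lsubmx) de).
  by apply/funext => de; rewrite /= [in LHS]mxE exprMn mulrC.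
apply: (@widlM (wprod (ordW n) (ordW m))); last exact: (@widl_prodl (ordW n) (ordW m) _ (@ordW_exp n)).
exact/CinfX/Cinf_rsub.
Qed.

Program Definition wmul' n : wmor (ordW n) (wprod (ordW n.+1) (ordW n)) :=
  @wmor_gen _ _ (@ord_genC n) (wprod (ordW n.+1) (ordW n)) mul_map Cinf_mul_map mul_map0 _.
Next Obligation.
move=> n _ ->.
have -> : (fun d : 'rV[R]_1 => d 0 0 ^+ n.+1) \o mul_map =
    (fun de => lsubmx de 0 0 ^+ n.+1 *
               ((fun d : 'rV[R]_1 => d 0 0 ^+ n.+1) \o rsubmx) de).
  by apply/funext => de; rewrite /= [in LHS]mxE exprMn.
apply: (@widlM (wprod (ordW n.+1) (ordW n))); last exact: (@widl_prodr (ordW n.+1) (ordW n) _ (@ordW_exp n)).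
exact/CinfX/Cinf_lsub.
Qed.

Definition simple_poly (rho : {poly R}) : Prop :=
  rho`_0 = 0 /\ forall i, rho`_i = 0 \/ rho`_i = 1.

Definition poly_dim n (rho : {poly R}) (l : nat) : Prop :=
  'X^(n.+1) %| rho ^+ l.+1 /\ forall k, 'X^(n.+1) %| rho ^+ k.+1 -> (l <= k)%N.

Program Definition wpoly n l (rho : {poly R}) (rho0 : simple_poly rho)
    (rhol : poly_dim n rho l) : wmor (ordW l) (ordW n) :=
  @wmor_gen _ _ (@ord_genC l) (ordW n) (poly_map rho) _ _ _.
Next Obligation.
move=> n l rho _ _ j; under eq_fun do rewrite mxE.
exact/Cinf_horner/Cinf_coord.
Qed.
Next Obligation.
by move=> n l rho [rho0 _] _; apply/rowP => j; rewrite !mxE horner_coef0.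
Qed.
Next Obligation.
move=> n l rho _ [/Pdiv.Field.dvdpP[q qE] _] _ ->; rewrite /comp.
under eq_fun do rewrite mxE -horner_exp qE hornerM hornerXn.
by apply: (@widlM (ordW n)); [apply/Cinf_horner/Cinf_coord | apply: ordW_exp].
Qed.

End Infinitesimal.

Section Jets.
Context {R : realType} {E M : frolicher R} (p : smap E M) (x : E).

(* Smooth maps (M (x) W)_(p x) -> (E (x) W)_x *)
Definition fmap (W : walg R) : Type := smap (@fib R M W (p x)) (@fib R E W x).

(* (nabla1 (x) id) o (id_M (x) t) = (id_E (x) t) o nabla, where both sides are
   compared in (E (x) W1) (x) W2, of which (E (x) W1)_x (x) W2 is a subobject. *)
Definition intertwines (W W1 W2 : walg R) (t : wmor W (wprod W1 W2))
    (tP : wfibred t) (nabla : fmap W) (nabla1 : fmap W1) : Prop :=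
  forall g, tensl (sval_smap _) W2 (tensl nabla1 W2 (fibr_iter tP g)) =
            iter_tens (tensr E t (sval (nabla g))).

Lemma wmu_fibred n m (i : 'I_n) : wfibred (@wmu R n m i).
Proof.
by move=> r; apply/rowP => j; rewrite /= mxE row_mxKl !mxE mulr0 if_same.
Qed.

Lemma wmul_fibred n m : wfibred (@wmul R n m).
Proof. by move=> r; apply/rowP => j; rewrite /= mxE row_mxKl !mxE mul0r. Qed.

Lemma wmul'_fibred n : wfibred (@wmul' R n).
Proof. by move=> r; apply/rowP => j; rewrite /= mxE row_mxKl !mxE mul0r. Qed.

Definition cube_pseudotangential n (nabla : fmap (cubeW n)) : Prop :=
  [/\ forall g, tensl p _ (sval (nabla g)) = sval g,
      forall alpha i g, nabla (fibr _ (wscale alpha i) g) = fibr _ (wscale alpha i) (nabla g),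
      forall m i, intertwines (@wmu_fibred n m i) nabla nabla &
      forall sigma g, nabla (fibr _ (wperm sigma) g) = fibr _ (wperm sigma) (nabla g)].

(* d_(n+1) o nabla o s_(n+1) *)
Definition cube_proj n (nabla : fmap (cubeW n.+1)) : fmap (cubeW n) :=
  scomp (fibr _ (wins ord_max)) (scomp nabla (fibr _ (wdel ord_max))).

Fixpoint cube_tangential n : fmap (cubeW n) -> Prop :=
  if n is m.+1 then fun nabla =>
    cube_pseudotangential nabla /\
    ((0 < m)%N ->
       cube_tangential (cube_proj nabla) /\
       forall g, nabla (fibr _ (wkappa m) g) = fibr _ (wkappa m) (cube_proj nabla g))
  else @cube_pseudotangential 0.

Definition ord_pseudotangential n (nabla : fmap (ordW n)) : Prop :=
  [/\ forall g, tensl p _ (sval (nabla g)) = sval g,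
      forall alpha g, nabla (fibr _ (woscale n alpha) g) = fibr _ (woscale n alpha) (nabla g) &
      forall m, intertwines (@wmul_fibred n m) nabla nabla].

(* nabla' is the pseudotangential hat-pi_(n+1,n) nabla; for microlinear and Weil
   exponentiable E and M the equation determines nabla'. *)
Definition is_ord_proj n (nabla : fmap (ordW n.+1)) (nabla' : fmap (ordW n)) : Prop :=
  ord_pseudotangential nabla' /\ intertwines (@wmul'_fibred n) nabla' nabla.

(* nabla'' is the iterated projection hat-pi_(n,l) nabla. *)
Inductive is_ord_projs : forall n l, fmap (ordW n) -> fmap (ordW l) -> Prop :=
| ord_projs0 n (nabla : fmap (ordW n)) : is_ord_projs nabla nabla
| ord_projsS n l (nabla : fmap (ordW n.+1)) (nabla' : fmap (ordW n))
    (nabla'' : fmap (ordW l)) :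
    is_ord_proj nabla nabla' -> is_ord_projs nabla' nabla'' ->
    is_ord_projs nabla nabla''.

Fixpoint ord_tangential n : fmap (ordW n) -> Prop :=
  if n is m.+1 then fun nabla =>
    ord_pseudotangential nabla /\
    ((0 < m)%N ->
       (exists2 nabla' : fmap (ordW m), is_ord_proj nabla nabla' & ord_tangential nabla') /\
       forall rho l (rhoS : simple_poly rho) (rhol : poly_dim m.+1 rho l),
         exists2 nablal : fmap (ordW l), is_ord_projs nabla nablal &
           forall g, nabla (fibr _ (wpoly rhoS rhol) g) =
                     fibr _ (wpoly rhoS rhol) (nablal g))
  else @ord_pseudotangential 0.

Definition is_psi n (nabla : fmap (cubeW n)) (psi : fmap (ordW n)) : Prop :=
  forall g, unique (fun g' => nabla (fibr _ (wplus n) g) = fibr _ (wplus n) g') (psi g).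

End Jets.

(* Main.v *)
(** The elements of [W_(D_n)] are, through substitution of [d_1 + ... + d_n], exactly
    the symmetric elements of [W_(D^n)]; microlinearity turns this equalizer of the
    permutations into the existence and uniqueness of [psi]. Conditions (3) follow
    from the homogeneity (2), because a class in [(X (x) W)_x (x) W_(D_m)] is
    represented by a family indexed by real parameters.

    The main point is the compatibility of [psi] with a simple polynomial [rho].
    Modulo the squares, [rho (d_1 + ... + d_n)] is the sum over [S] of
    [|S|! rho_|S| d_S]. Put a real parameter [t_S] in front of each [d_S], let [f]
    represent an element of [M (x) W_(D_l)] and [F] its image, and compare
    [Z t = nabla (f (sum t_S c_S d_S))] with [K t = F (sum t_S c_S d_S)].
    - If the [S] with [t_S <> 0] are pairwise disjoint, then [Z t = K t]: the
      substitution [d |-> (d_S)_S] is a composite of permutations, deletions and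
      multiplications of two coordinates, with which a tangential commutes.
    - Hence [Z] and [K] agree as infinitesimal families over the [t] with
      [t_S t_T = 0] whenever [S] meets [T], since this locus is covered by its
      coordinate subspaces with pairwise disjoint [S].
    - The point [t_S = r_S] for [r] in [D^n] lies in that locus, and by
      homogeneity [Z (r_S) (d) = Z 1 (r d)]. As [d |-> r d] is injective on
      [W_(D^n)], we get [Z 1 = K 1].

    The algebra takes place in quotients of [C^oo(R^k)] and is reduced to
    multilinear polynomials by Hadamard's lemma. *)

Require Import Defs.
From HB Require Import structures.
From mathcomp Require Import all_boot all_order all_algebra all_fingroup.
From mathcomp Require Import all_classical all_reals topology normedtype landau derive.
From mathcomp Require Import ereal measure lebesgue_measure lebesgue_integral ftc.
From mathcomp Require Import ring.
Set Implicit Arguments.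
Unset Strict Implicit.
Unset Printing Implicit Defensive.
(* [vector] and [seq] also export a [space] and a [perm_map]; this restores those
   of Defs. *)
Import Defs Order.TTheory GRing.Theory Num.Theory.
Import numFieldNormedType.Exports.
Local Open Scope ring_scope.
Local Open Scope classical_set_scope.

(** * Hadamard's lemma *)

Section Hadamard.
Context {R : realType}.
Notation mu := (@lebesgue_measure R).

Definition unit_int (f : R -> R) : R := \int[mu]_(t in `[0, 1]) f t.

Lemma unit_integrable (f : R -> R) :
  continuous f -> mu.-integrable `[0, 1] (EFin \o f).
Proof.
move=> cf; apply: continuous_compact_integrable; first exact: segment_compact.
exact: continuous_subspaceT.
Qed.

Lemma unit_intB (f g : R -> R) : continuous f -> continuous g ->
  unit_int (fun t => f t - g t) = unit_int f - unit_int g.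
Proof.
by move=> cf cg; apply: RintegralB => //; exact: unit_integrable.
Qed.

Lemma unit_intZ (c : R) (f : R -> R) : continuous f -> unit_int (fun t => c * f t) = c * unit_int f.
Proof. by move=> cf; apply: RintegralZl => //; exact: unit_integrable. Qed.

Lemma continuous_lin (I : Type) (r : seq I) (c : I -> R) (f : I -> R -> R) :
  (forall j, continuous (f j)) -> continuous (fun t => \sum_(j <- r) c j * f j t).
Proof.
move=> cf; elim: r => [|j r IH].
  by under eq_fun do rewrite big_nil; exact: cst_continuous.
under eq_fun do rewrite big_cons.
move=> t; apply: cvgD; last exact: IH.
by apply: (@cvgM _ _ _ _ (fun=> c j) (f j)); [exact: cvg_cst | exact: cf].
Qed.

Lemma continuous_sub (f g : R -> R) :
  continuous f -> continuous g -> continuous (fun t => f t - g t).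
Proof. by move=> cf cg t; apply: (@cvgB _ R^o _ _ _ f g _ _ (cf t) (cg t)). Qed.

Lemma unit_int_lin (I : Type) (r : seq I) (c : I -> R) (f : I -> R -> R) :
  (forall j, continuous (f j)) ->
  unit_int (fun t => \sum_(j <- r) c j * f j t) = \sum_(j <- r) c j * unit_int (f j).
Proof.
move=> cf; elim: r => [|j r IH].
  rewrite big_nil; have -> : (fun t => \sum_(j <- [::]) c j * f j t) = fun=> 0.
    by apply/funext => t; rewrite big_nil.
  by rewrite /unit_int Rintegral_cst // mul0r.
rewrite big_cons -IH -unit_intZ // /unit_int -RintegralD //.
- by congr Rintegral; apply/funext => t; rewrite big_cons.
- apply: (@unit_integrable (fun t => c j * f j t)) => t.
  by apply: (@cvgM _ _ _ _ (fun=> c j) (f j)); [exact: cvg_cst | exact: cf].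
- exact: (@unit_integrable (fun t => \sum_(i <- r) c i * f i t) (continuous_lin cf)).
Qed.

Lemma unit_int_le (f : R -> R) (e : R) : continuous f -> (forall t, 0 <= t <= 1 -> `|f t| <= e) ->
  `|unit_int f| <= e.
Proof.
move=> cf fe; apply: le_trans (le_normr_Rintegral _ (unit_integrable cf)) _ => //.
have -> : e = unit_int (fun=> e).
  by rewrite /unit_int Rintegral_cst //= lebesgue_measure_itv /= lte01 /= subr0 mulr1.
apply: le_Rintegral => //.
- apply: (@unit_integrable (fun t => `|f t|)) => t.
  exact: (continuous_comp (cf t) (@norm_continuous _ R^o _)).
- by apply: (@unit_integrable (fun=> e)); exact: cst_continuous.
Qed.

Lemma is_derive_line (V : normedModType R) (f : V -> R) p v (s : R) :
  differentiable (f : V -> R^o) (p + s *: v) ->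
  is_derive (s : R^o) 1 (fun s => f (p + s *: v) : R^o) ('D_v (f : V -> R^o) (p + s *: v)).
Proof.
move=> /(@diff_derivable _ _ _ _ _ v) df.
have E : (fun h : R => h^-1 *: (((fun s : R^o => f (p + s *: v) : R^o) \o shift (s : R^o)) (h *: (1 : R^o))
    - f (p + s *: v) : R^o)) =
  (fun h : R => h^-1 *: (((f : V -> R^o) \o shift (p + s *: v)) (h *: v) - f (p + s *: v) : R^o)).
  apply/funext => h /=; congr (_ *: (f _ - _)).
  by rewrite [h *: 1]mulr1 scalerDl addrCA.
by split; [rewrite /derivable E | rewrite /derive E].
Qed.

Lemma unit_int_FTC (V : normedModType R) (f : V -> R) p v : @Ck R V 1 f ->
  unit_int (fun t => 'D_v (f : V -> R^o) (p + t *: v)) = f (p + v) - f p.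
Proof.
move=> [df Df].
have cl : continuous (fun t : R => p + t *: v).
  by move=> t; apply: cvgD; [exact: cvg_cst | apply: cvgZr_tmp; exact: cvg_id].
have dl (t : R^o) := is_derive_line (df (p + t *: v)).
have cF : continuous (fun t : R^o => f (p + t *: v) : R^o).
  move=> t; apply: differentiable_continuous; apply/derivable1_diffP.
  by have [] := dl t.
have := @continuous_FTC2 R (fun t => 'D_v (f : V -> R^o) (p + t *: v))
   (fun t => f (p + t *: v)) 0 1 ltr01.
rewrite /unit_int /Rintegral => ->.
- by rewrite /= scale1r scale0r addr0.
- apply: continuous_subspaceT => t.
  exact: (continuous_comp (cl t) (Df v _)).
- split; first by move=> t _; have [] := dl t.
    by apply: cvg_at_right_filter; apply: cF.
  by apply: cvg_at_left_filter; apply: cF.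
- by move=> t _; rewrite derive1E; have [_] := dl t.
Qed.


(** Compactness of [[0, 1]] makes the closeness in [w'] uniform in [t]. Both continuity and
    differentiability of an integral with a parameter rest on this. *)
Lemma tube (V : normedModType R) (f : (R^o * V)%type -> R) (w : V) (e : R) :
  continuous f -> 0 < e ->
  \forall w' \near w, forall t, 0 <= t <= 1 -> `|f (t, w') - f (t, w)| <= e.
Proof.
move=> cf e0.
have := @segment_compact R 0 1; rewrite compact_near_coveringP.
move=> /(_ V (nbhs w) (fun w' t => `|f (t, w') - f (t, w)| <= e) _) H.
have {H} : \forall w' \near w, `[0, 1] `<=` (fun t => `|f (t, w') - f (t, w)| <= e).
  apply: H => t _.
  have e2 : 0 < e / 2 by rewrite divr_gt0.
  have H1 : \forall p \near (nbhs t, nbhs w), `|f (t, w) - f p| < e / 2.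
    by have /cvgrPdist_lt := cf (t, w); apply.
  have H2 : \forall p \near (nbhs t, nbhs w), `|f (t, w) - f (p.1, w)| < e / 2.
    have c1 : (fun p : R * V => (p.1 : R^o, w)) @ (nbhs t, nbhs w) --> ((t : R^o, w) : (R^o * V)%type).
      apply: (@cvg_pair _ _ _ (filter_prod (nbhs t) (nbhs w)) (nbhs t) (nbhs w) _ _ _ fst (fun=> w)).
        exact: cvg_fst.
      exact: cvg_cst.
    by have /cvgrPdist_lt := cvg_comp _ _ c1 (cf (t, w)); apply.
  apply: filterS2 H1 H2 => -[t' w'] /= h1 h2.
  apply: le_trans (ler_distD (f (t, w)) _ _) _.
  by rewrite distrC (splitr e) lerD // ltW.
by apply: filterS => w' H t t01; apply: H; rewrite /= in_itv.
Qed.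

Section ParametricIntegral.
Variables (m : nat).
Notation W := 'rV[R]_m.
Notation V := (R^o * W)%type.
Implicit Type f : V -> R.

Definition param_int f (w : W) : R := unit_int (fun t => f (t, w)).

Lemma continuous_slice f w : continuous f -> continuous (fun t : R => f (t, w)).
Proof.
move=> cf t; apply: (@continuous_comp _ _ _ (fun t : R => (t : R^o, w)) f); last exact: cf.
apply: (@cvg_pair _ _ _ (nbhs t) (nbhs t) (nbhs w) _ _ _ id (fun=> w)); first exact: cvg_id.
exact: cvg_cst.
Qed.

Lemma continuous_param f : continuous f -> continuous (param_int f).
Proof.
move=> cf w; apply/(@cvgrPdist_le _ R^o _ _ (nbhs_filter w)) => e e0.
apply: (@filterS _ _ (nbhs_filter w) _ _ _ (tube w cf e0)) => w' H.
rewrite /param_int -unit_intB; [|exact: continuous_slice..].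
apply: unit_int_le => [t|t t01]; last by rewrite distrC; exact: H.
by apply: (@cvgB _ R^o _ _ _ (fun t => f (t, w)) (fun t => f (t, w')));
  apply: continuous_slice.
Qed.

Definition vdir (v : W) : V := (0, v).

(** A linear form on a space of row vectors is continuous, so a first-order expansion with remainder
    o(h) identifies the differential by its uniqueness. *)
Lemma differentiable_of (f : W -> R) (x : W) (g : 'I_m -> R) :
  (forall e, 0 < e -> \forall h \near (0 : W),
     `|f (h + x) - f x - \sum_j h 0 j * g j| <= e * `|h|) ->
  differentiable (f : W -> R^o) x /\
  forall v, 'D_v (f : W -> R^o) x = \sum_j v 0 j * g j.
Proof.
move=> H.
have lin : linear (fun h : W => \sum_j h 0 j * g j : R^o).
  move=> a u v; rewrite scaler_sumr -big_split; apply: eq_bigr => j _.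
  by rewrite !mxE mulrDl [RHS]/= /GRing.scale /= mulrA.
pose lM := GRing.isLinear.Build _ _ _ _ _ lin.
pose L : {linear W -> R^o} := HB.pack (fun h : W => \sum_j h 0 j * g j : R^o) lM.
have cL : continuous L.
  apply: (@Ck_sum _ W 0%N _ _ (fun j h => h 0 j * g j)) => j.
  exact: (@CkM _ W 0%N (fun h => h 0 j) (fun=> g j) (Cinf_coord j 0) (@Ck_cst _ W 0%N _)).
have E e : 0 < e -> \forall h \near (0 : W),
    `|((f : W -> R^o) \o shift x - (cst (f x : R^o) + L)) h| <= e * `|h|.
  move=> e0; apply: (@filterS _ _ (nbhs_filter (0 : W)) _ _ _ (H e e0)) => h.
  by rewrite [(_ - _) h]/= opprD addrA.
have dE : 'd (f : W -> R^o) x = L :> (W -> R^o).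
  by apply: (@diff_unique R W R^o) cL _; apply/(@eqaddoP _ W R^o W).
have df : differentiable (f : W -> R^o) x.
  by apply/diff_locallyP; rewrite dE; split=> //; apply/(@eqaddoP _ W R^o W).
by split=> // v; rewrite deriveE // dE.
Qed.

(** The mean value theorem writes each increment of [f] at fixed [t] as a directional derivative at
    an intermediate point, and [tube] makes the partial derivatives there close to those at [w],
    uniformly in [t]. *)
Lemma differentiable_param f (w : W) : @Ck R V 1 f ->
  differentiable (param_int f : W -> R^o) w /\
  forall v, 'D_v (param_int f : W -> R^o) w = param_int (fun p => 'D_(vdir v) (f : V -> R^o) p) w.
Proof.
move=> [df Df].
have cf : continuous f by move=> p; exact: differentiable_continuous.
pose g j := param_int (fun p => 'D_(vdir (delta_mx 0 j)) (f : V -> R^o) p) w.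
have Dlin v p : 'D_(vdir v) (f : V -> R^o) p =
    \sum_j v 0 j * 'D_(vdir (delta_mx 0 j)) (f : V -> R^o) p.
  rewrite deriveE //.
  have -> : vdir v = \sum_j v 0 j *: vdir (delta_mx 0 j).
    apply/eqP; rewrite -pair_eqE; apply/andP; split; apply/eqP => /=.
      elim/big_rec: _ => //= j y _ <-; first by rewrite scaler0 addr0.
    rewrite {1}(row_sum_delta v); elim/big_rec2: _ => //= j y z _ <-.
    by [].
  rewrite linear_sum; apply: eq_bigr => j _.
  by rewrite linearZ deriveE.
have main e : 0 < e -> \forall h \near (0 : W),
     `|param_int f (h + w) - param_int f w - \sum_j h 0 j * g j| <= e * `|h|.
  (* The error is a sum of [m] terms of size at most e' |h|; the denominator [m.+1] is nonzero even
     for [m = 0]. *)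
  move=> e0; pose e' := e / m.+1%:R.
  have e'0 : 0 < e' by rewrite divr_gt0.
  have /nbhs_ballP[r /= r0 rP] : \forall w' \near w, forall j t, 0 <= t <= 1 ->
      `|'D_(vdir (delta_mx 0 j)) (f : V -> R^o) (t, w')
        - 'D_(vdir (delta_mx 0 j)) (f : V -> R^o) (t, w)| <= e'.
    by apply: (@filter_forall _ _ _ _ (nbhs_filter w)) => j; exact: (tube w (Df (vdir (delta_mx 0 j))) e'0).
  apply/nbhs_ballP; exists r => //= h.
  rewrite -ball_normE /= sub0r normrN => hr.
  have cs w' : continuous (fun t => f (t, w')) by exact: continuous_slice.
  have csj j : continuous (fun t => 'D_(vdir (delta_mx 0 j)) (f : V -> R^o) (t, w)).
    exact: continuous_slice (Df _).
  rewrite /g /param_int -unit_intB // -unit_int_lin // -unit_intB //; first last.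
  - exact: continuous_lin.
  - exact: continuous_sub.
  apply: unit_int_le.
    by apply: continuous_sub; [exact: continuous_sub | exact: continuous_lin].
  move=> t t01.
  have lineE (s : R) : (t, w) + s *: vdir h = (t, w + s *: h) :> V.
    by congr pair; rewrite /= scaler0 addr0.
  have dl (s : R) := @is_derive_line V f (t, w) (vdir h) s (df _).
  have cl : {within `[0, 1], continuous (fun s : R => f ((t, w) + s *: vdir h))}.
    apply: continuous_subspaceT => s; apply: differentiable_continuous.
    by apply/derivable1_diffP; have [] := dl s.
  have := @MVT R (fun s => f ((t, w) + s *: vdir h)) _ 0 1 ltr01 (fun s _ => dl s) cl.
  move=> [c]; rewrite in_itv /= => /andP[c0 c1].
  rewrite !lineE scale1r scale0r addr0 subr0 mulr1 [h + w]addrC => ->.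
  rewrite Dlin -sumrB.
  apply: le_trans (ler_norm_sum _ _ _) _.
  have bound j : `|h 0 j * 'D_(vdir (delta_mx 0 j)) (f : V -> R^o) (t, w + c *: h)
     - h 0 j * 'D_(vdir (delta_mx 0 j)) (f : V -> R^o) (t, w)| <= `|h| * e'.
    rewrite -mulrBr normrM ler_pM //; last first.
      apply: rP => //; rewrite -ball_normE /= opprD addNKr normrN normrZ.
      rewrite ger0_norm ?ltW //; apply: le_lt_trans hr.
      by rewrite ler_piMl // ltW.
    rewrite [leRHS]/Num.norm /= mx_normrE; apply/bigmax_geP; right => /=.
    by exists (0, j).
  apply: le_trans (ler_sum _ (fun j _ => bound j)) _.
  rewrite sumr_const card_ord -mulrnAr mulrC ler_wpM2r //.
  by rewrite /e' -mulr_natr -mulrA ger_pMr // ler_pdivrMl // mulr1 ler_nat.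
have [d Dv] := differentiable_of main; split=> // v; rewrite Dv.
rewrite /param_int; under [in RHS]eq_fun do rewrite Dlin.
by rewrite unit_int_lin // => j; exact: continuous_slice (Df _).
Qed.

(** The induction generalizes over [f], because a derivative of the integral is the integral of
    another smooth function. *)
Lemma Cinf_param f : Cinf f -> Cinf (param_int f).
Proof.
move=> Cf n; elim: n f Cf => [|n IH] f Cf.
  exact: continuous_param (Cf 0%N).
split=> [w|v]; first by have [] := differentiable_param w (Cf 1%N).
have -> : (fun x : W => 'D_v (param_int f : W -> R^o) x) =
    param_int (fun p => 'D_(vdir v) (f : V -> R^o) p).
  by apply/funext => w; have [_] := differentiable_param w (Cf 1%N).
by apply: IH => k; have [_ D] := Cf k.+1; exact: D.
Qed.

End ParametricIntegral.

(** By the fundamental theorem of calculus on the segment from [v] to [u], [g j] can be the integral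
    of the j-th partial derivative of [c] along it. The form with two points serves to compare [c]
    along two maps that are congruent coordinatewise. *)
Lemma Hadamard k (c : 'rV[R]_k -> R) : Cinf c ->
  exists2 g : 'I_k -> 'rV[R]_(k + k) -> R, (forall j, Cinf (g j)) &
    forall u v, c u - c v = \sum_j (u 0 j - v 0 j) * g j (row_mx u v).
Proof.
move=> Cc; pose V := (R^o * 'rV[R]_(k + k))%type.
have Cfst : Cinf (fun p : V => p.1 : R).
  by move=> n; apply: (@Ck_lin _ _ n fst) => p; exact: cvg_fst.
have Csnd i : Cinf (fun p : V => p.2 0 i : R).
  have lin : linear (fun p : V => p.2 0 i : R^o) by move=> a u v /=; rewrite !mxE.
  pose glM := GRing.isLinear.Build _ _ _ _ _ lin.
  pose gL : {linear V -> R^o} := HB.pack (fun p : V => p.2 0 i : R^o) glM.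
  move=> n; apply: (@Ck_lin _ _ n gL) => p.
  apply: (@continuous_comp _ _ _ snd (fun v : 'rV[R]_(k + k) => v 0 i)).
    exact: cvg_snd.
  exact: coord_continuous.
pose l (p : V) : 'rV[R]_k := rsubmx p.2 + p.1 *: (lsubmx p.2 - rsubmx p.2).
have Cl j : Cinf (fun p => l p 0 j).
  have -> : (fun p => l p 0 j) = fun p : V =>
      p.2 0 (rshift k j) + p.1 * (p.2 0 (lshift k j) + (-1) * p.2 0 (rshift k j)).
    by apply/funext => p; rewrite !mxE mulN1r.
  apply: CinfD; first exact: Csnd.
  apply: CinfM; first exact: Cfst.
  apply: CinfD; first exact: Csnd.
  by apply: CinfM; [exact: Cinf_cst | exact: Csnd].
pose d j (x : 'rV[R]_k) := 'D_(delta_mx 0 j) (c : 'rV[R]_k -> R^o) x.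
have Cd j : Cinf (d j) by move=> n; have [_ D] := Cc n.+1; exact: D.
exists (fun j => param_int (fun p => d j (l p))) => [j|u v].
  by apply: Cinf_param; apply: (@Cinf_comp _ V k (d j) l).
have -> : c u - c v = c (v + (u - v)) - c v by rewrite [v + _]addrC subrK.
rewrite -(unit_int_FTC v (u - v) (Cc 1%N)) /param_int -unit_int_lin; last first.
  by move=> j; apply: (@continuous_slice _ (fun p => d j (l p))); apply: (@Cinf_comp _ V k (d j) l _ _ 0%N).
congr unit_int; apply/funext => t.
have [dc _] := Cc 1%N.
have Dlin x h : 'D_h (c : 'rV[R]_k -> R^o) x = \sum_j h 0 j * d j x.
  rewrite deriveE // {1}(row_sum_delta h) linear_sum; apply: eq_bigr => j _.
  by rewrite linearZ /d deriveE.
rewrite Dlin; apply: eq_bigr => j _.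
by rewrite !mxE /l row_mxKl row_mxKr.
Qed.

End Hadamard.

(** * Ideals of smooth functions *)

Section Ideals.
Context {R : realType} {k : nat}.
Implicit Types (I : set ('rV[R]_k -> R)) (a b c : 'rV[R]_k -> R) (w : seq 'I_k).

Lemma Hadamard0 a : Cinf a ->
  exists2 h : 'I_k -> 'rV[R]_k -> R, (forall j, Cinf (h j)) &
    forall u, a u = a 0 + \sum_j u 0 j * h j u.
Proof.
move=> /Hadamard[g Cg aE].
exists (fun j u => g j (row_mx u 0)) => [j|u].
  apply: (@Cinf_comp _ _ _ (g j) (fun u => row_mx u 0)) => // i.
  under eq_fun do rewrite mxE.
  by case: (fintype.split i) => l; [exact: Cinf_coord | under eq_fun do rewrite mxE; exact: Cinf_cst].
rewrite -[LHS](subrK (a 0)) addrC aE; congr (_ + _).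
by apply: eq_bigr => j _; rewrite mxE subr0.
Qed.

(** Words with repetitions stand for monomials, so that one more variable is one more letter. *)
Definition monom w : 'rV[R]_k -> R := fun v => \prod_(i <- w) v 0 i.

Lemma Cinf_monom w : Cinf (monom w).
Proof.
rewrite /monom; elim: w => [|i w IH].
  by under eq_fun do rewrite big_nil; exact: Cinf_cst.
by under eq_fun do rewrite big_cons; apply: CinfM => //; exact: Cinf_coord.
Qed.

Section Ideal.
Variable I : set ('rV[R]_k -> R).
Hypothesis idealI : is_ideal I.

Lemma idealC a : I a -> Cinf a. Proof. by case: idealI => + _ _ _; apply. Qed.
Lemma ideal0 : I (fun=> 0). Proof. by case: idealI. Qed.
Lemma idealD a b : I a -> I b -> I (fun v => a v + b v).
Proof. by case: idealI => _ _ + _; apply. Qed.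
Lemma idealM c a : Cinf c -> I a -> I (fun v => c v * a v).
Proof. by case: idealI => _ _ _; apply. Qed.
Lemma idealZ (x : R) a : I a -> I (fun v => x * a v).
Proof. exact/idealM/Cinf_cst. Qed.
Lemma ideal_sum (T : Type) (r : seq T) (Q : pred T) (F : T -> 'rV[R]_k -> R) :
  (forall i, Q i -> I (F i)) -> I (fun v => \sum_(i <- r | Q i) F i v).
Proof.
move=> IF; elim: r => [|i r IH]; first by under eq_fun do rewrite big_nil; exact: ideal0.
under eq_fun do rewrite big_cons.
by case Qi: (Q i) => //; apply: idealD => //; exact: IF.
Qed.

Definition cong a b := I (fun v => a v - b v).

Lemma cong_refl a : cong a a.
Proof. by rewrite /cong; under eq_fun do rewrite subrr; exact: ideal0. Qed.
Lemma cong_sym a b : cong a b -> cong b a.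
Proof.
move=> /(idealZ (-1)); rewrite /cong; congr I; apply/funext => v.
by rewrite mulN1r opprB.
Qed.
Lemma cong_trans b a c : cong a b -> cong b c -> cong a c.
Proof.
move=> ab bc; have := idealD ab bc; rewrite /cong; congr I; apply/funext => v.
by rewrite subrKA.
Qed.
Lemma congD a b a' b' : cong a b -> cong a' b' ->
  cong (fun v => a v + a' v) (fun v => b v + b' v).
Proof.
move=> ab bc; have := idealD ab bc; rewrite /cong; congr I; apply/funext => v.
by rewrite opprD addrACA.
Qed.
Lemma congMl c a b : Cinf c -> cong a b -> cong (fun v => c v * a v) (fun v => c v * b v).
Proof.
move=> Cc ab; have := idealM Cc ab; rewrite /cong; congr I; apply/funext => v.
by rewrite mulrBr.
Qed.
Lemma cong_sum (T : Type) (r : seq T) (Q : pred T) (F G : T -> 'rV[R]_k -> R) :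
  (forall i, Q i -> cong (F i) (G i)) ->
  cong (fun v => \sum_(i <- r | Q i) F i v) (fun v => \sum_(i <- r | Q i) G i v).
Proof.
move=> FG; rewrite /cong; under eq_fun do rewrite -sumrB.
exact: ideal_sum.
Qed.
Lemma cong_mem a b : cong a b -> I b -> I a.
Proof.
move=> ab Ib; have := idealD ab Ib; congr I; apply/funext => v.
by rewrite subrK.
Qed.

(* By iterating the first-order expansion [a u = a 0 + sum_j u_j h_j u]. *)
Lemma ideal_span (r : nat) (N : set ('rV[R]_k -> R)) :
  (forall w, size w = r -> I (monom w)) ->
  I `<=` N -> (forall a b, N a -> N b -> N (fun v => a v + b v)) ->
  (forall x, N (fun=> x)) -> (forall i a, N a -> N (fun v => v 0 i * a v)) ->
  forall a, Cinf a -> N a.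
Proof.
move=> Ir IN ND Nc NX.
have Nw w a : N a -> N (fun v => monom w v * a v).
  move=> Na; rewrite /monom; elim: w => [|i w IH].
    by under eq_fun do rewrite big_nil mul1r.
  by under eq_fun do rewrite big_cons -mulrA; apply: NX.
suff H m w a : (r <= size w + m)%N -> Cinf a -> N (fun v => monom w v * a v).
  move=> a Ca; have := H r [::] a (leqnn _) Ca.
  by congr N; apply/funext => v; rewrite /monom big_nil mul1r.
elim: m w a => [|m IH] w a; rewrite ?addn0 => rw Ca.
  apply: IN; rewrite -(cat_take_drop r w).
  have := idealM (CinfM Ca (Cinf_monom (drop r w))) (Ir (take r w) (size_takel rw)).
  by congr I; apply/funext => v; rewrite /monom big_cat /=; ring.
have [h Ch aE] := Hadamard0 Ca.
have -> : (fun v => monom w v * a v) =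
   fun v => monom w v * a 0 + \sum_(j <- index_enum 'I_k) monom (j :: w) v * h j v.
  apply/funext => v; rewrite aE mulrDr mulr_sumr; congr (_ + _).
  by apply: eq_bigr => j _; rewrite /monom big_cons; ring.
apply: (ND); first exact: Nw.
elim: (index_enum _) => [|j s IHs].
  by under eq_fun do rewrite big_nil; exact: Nc.
under eq_fun do rewrite big_cons; apply: (ND) => //.
by apply: IH => //=; rewrite addSnnS.
Qed.

(** Expanding one factor [a i], which vanishes at 0, by [Hadamard0] turns it into one more letter of
    [w]. So the monomials of degree [r] suffice to get all of m^r into [I]. *)
Lemma ideal_prod_span (r : nat) (T : Type) (l : seq T) (a : T -> 'rV[R]_k -> R) w :
  (forall w, size w = r -> I (monom w)) ->
  (forall i, Cinf (a i) /\ a i 0 = 0) -> (size w + size l)%N = r ->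
  I (fun v => monom w v * \prod_(i <- l) a i v).
Proof.
move=> Ir am; elim: l w => [|i l IH] w /=.
  rewrite addn0 => /Ir; congr I; apply/funext => v.
  by rewrite big_nil mulr1.
move=> wl; have [Ca a0] := am i; have [h Ch aE] := Hadamard0 Ca.
have -> : (fun v => monom w v * \prod_(j <- i :: l) a j v) =
   fun v => \sum_j h j v * (monom (j :: w) v * \prod_(j <- l) a j v).
  apply/funext => v; rewrite big_cons aE a0 add0r mulr_suml mulr_sumr.
  by apply: eq_bigr => j _; rewrite /monom big_cons; ring.
apply: ideal_sum => j _; apply: idealM => //; apply: IH => /=.
by rewrite addSnnS.
Qed.

Lemma ideal_nonuniq w : (forall i, I (fun v => v 0 i ^+ 2)) -> ~~ uniq w -> I (monom w).
Proof.
move=> sq; elim: w => [//|i w IH] /=; rewrite negb_and negbK => /orP[iw|/IH Iw].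
  have := idealM (Cinf_monom (rem i w)) (sq i); congr I; apply/funext => v.
  by rewrite /monom big_cons (perm_big _ (perm_to_rem iw)) big_cons /=; ring.
by have := idealM (Cinf_coord i) Iw; congr I; apply/funext => v; rewrite /monom big_cons.
Qed.

Lemma ideal_sq_monom w : (forall i, I (fun v => v 0 i ^+ 2)) ->
  size w = k.+1 -> I (monom w).
Proof.
move=> sq sw; apply: ideal_nonuniq => //; apply/negP => /card_uniqP wE.
by have := max_card (mem w); rewrite wE sw card_ord ltnn.
Qed.

End Ideal.

Lemma ideal_gen_min (G I : set ('rV[R]_k -> R)) : is_ideal I -> G `<=` I ->
  ideal_gen G `<=` I.
Proof. by move=> II GI a; apply. Qed.

(** * Partial derivatives and multilinear polynomials *)

Definition pd (i : 'I_k) a : 'rV[R]_k -> R :=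
  fun x => 'D_(delta_mx 0 i) (a : 'rV[R]_k -> R^o) x.

Lemma Cinf_pd i a : Cinf a -> Cinf (pd i a).
Proof. by move=> Ca n; have [_ D] := Ca n.+1; exact: D. Qed.

Lemma Cinf_derivable i a v : Cinf a -> derivable (a : _ -> R^o) v (delta_mx 0 i).
Proof. by move=> Ca; apply: diff_derivable; have [] := Ca 1%N. Qed.

Lemma pd_cst i (x : R) : pd i (fun=> x) = fun=> 0.
Proof. by apply/funext => v; exact: (derive_cst (x : R^o)). Qed.

Lemma pdD i a b : Cinf a -> Cinf b ->
  pd i (fun v => a v + b v) = fun v => pd i a v + pd i b v.
Proof.
move=> Ca Cb; apply/funext => v.
by apply: (@deriveD _ _ R^o a b); exact: Cinf_derivable.
Qed.

Lemma pdM i a b : Cinf a -> Cinf b ->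
  pd i (fun v => a v * b v) = fun v => a v * pd i b v + b v * pd i a v.
Proof.
move=> Ca Cb; apply/funext => v.
by apply: (@deriveM _ _ a b); exact: Cinf_derivable.
Qed.

Lemma pd_coord i j : pd i (fun v => v 0 j) = fun=> (j == i)%:R.
Proof.
apply/funext => v; rewrite /pd.
have lin : linear (fun v : 'rV[R]_k => v 0 j : R^o) by move=> x u w; rewrite !mxE.
pose glM := GRing.isLinear.Build _ _ _ _ _ lin.
pose gL : {linear 'rV[R]_k -> R^o} := HB.pack (fun v : 'rV[R]_k => v 0 j : R^o) glM.
have cL : continuous gL by move=> u; exact: coord_continuous.
rewrite deriveE; last exact: (@linear_differentiable _ _ _ gL).
by rewrite (@diff_lin _ _ _ gL) //= mxE eqxx.
Qed.

(* For duplicate-free [r] this ideal contains all squares of coordinates, and it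
   detects the coefficients of the monomials with variables in [r]. *)
Fixpoint jet0 (r : seq 'I_k) a : Prop :=
  if r is i :: r' then jet0 r' a /\ jet0 r' (pd i a) else Cinf a /\ a 0 = 0.

Lemma jet0_ideal r : is_ideal (jet0 r).
Proof.
elim: r => [|i r [JC J0 JD JM]].
  split=> [a []//||a b [Ca a0] [Cb b0]|c a Cc [Ca a0]] /=.
  - by split=> //; exact: Cinf_cst.
  - by rewrite a0 b0 addr0; split=> //; exact: CinfD.
  - by rewrite a0 mulr0; split=> //; exact: CinfM.
split=> [a [/JC]//||a b [Ja Da] [Jb Db]|c a Cc [Ja Da]] /=.
- by rewrite pd_cst.
- by rewrite pdD; [split; exact: JD | exact: JC..].
- rewrite pdM //; last exact: JC.
  split; first exact: JM.
  apply: JD; first exact: JM.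
  have := JM _ _ (Cinf_pd i Cc) Ja; congr jet0; apply/funext => v.
  by rewrite mulrC.
Qed.

Lemma jet0_coord r j : j \notin r -> jet0 r (fun v => v 0 j).
Proof.
elim: r => [_|i r IH] /=; first by rewrite mxE; split=> //; exact: Cinf_coord.
rewrite in_cons negb_or => /andP[/negPf ji jr]; split; first exact: IH.
by rewrite pd_coord ji; case: (jet0_ideal r).
Qed.

(** When [j] is the head of the list, the derivative 2 x_j lies in the ideal of the tail, where [j]
    no longer occurs. *)
Lemma jet0_sqr r j : uniq r -> jet0 r (fun v => v 0 j ^+ 2).
Proof.
elim: r => [_|i r IH] /=.
  by rewrite mxE expr0n; split=> //; exact/CinfX/Cinf_coord.
move=> /andP[ir ur]; split; first exact: IH.
rewrite pdM ?pd_coord; [|exact: Cinf_coord..].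
have [ji|_] := eqVneq j i; last first.
  by under eq_fun do rewrite mulr0 addr0; case: (jet0_ideal r).
under eq_fun do rewrite mulr1.
by apply: idealD (jet0_ideal r) _ _ _ _; apply: jet0_coord; rewrite ji.
Qed.

Definition setmon (S : {set 'I_k}) : 'rV[R]_k -> R := fun v => \prod_(i in S) v 0 i.

(** The normal forms modulo squares of coordinates: [sq_normal] provides them and [jet0_mlin] reads
    off their coefficients. *)
Definition mlin (c : {set 'I_k} -> R) : 'rV[R]_k -> R :=
  fun v => \sum_S c S * setmon S v.

Lemma Cinf_setmon S : Cinf (setmon S).
Proof.
have -> : setmon S = monom (enum S) by apply/funext => v; rewrite /setmon /monom big_enum.
exact: Cinf_monom.
Qed.

Lemma Cinf_mlin (c : {set 'I_k} -> R) : Cinf (mlin c).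
Proof.
by apply: Cinf_sum => S; apply: CinfM; [exact: Cinf_cst | exact: Cinf_setmon].
Qed.

Lemma setmonU1 i (S : {set 'I_k}) v : i \notin S -> setmon (i |: S) v = v 0 i * setmon S v.
Proof. exact: finset.big_setU1. Qed.

Lemma setmonD1 i (S : {set 'I_k}) v : i \in S -> setmon S v = v 0 i * setmon (S :\ i) v.
Proof. exact: finset.big_setD1. Qed.

Lemma setmon0 v : setmon finset.set0 v = 1.
Proof. exact: finset.big_set0. Qed.

Lemma sum_setU1 i (F : {set 'I_k} -> R) :
  \sum_(S : {set 'I_k} | i \notin S) F (i |: S)%SET = \sum_(S : {set 'I_k} | i \in S) F S.
Proof.
rewrite [RHS](reindex_onto (fun S : {set 'I_k} => i |: S)%SET (fun S : {set 'I_k} => S :\ i)%SET) /=; last first.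
  by move=> S iS; rewrite finset.setD1K.
apply: eq_bigl => S; rewrite finset.setU11 /=; apply/idP/eqP => [iS|<-]; first by rewrite finset.setU1K.
by rewrite finset.setD11.
Qed.

Lemma pd_setmon i (S : {set 'I_k}) : pd i (setmon S) = fun v => if i \in S then setmon (S :\ i) v else 0.
Proof.
have pd0 : forall T : {set 'I_k}, i \notin T -> pd i (setmon T) = fun=> 0.
  move=> T iT; have -> : setmon T = monom (enum T).
    by apply/funext => v; rewrite /setmon /monom big_enum.
  have : i \notin enum T by rewrite mem_enum.
  elim: (enum T) => [_|j w IH]; rewrite /monom.
    by under eq_fun do rewrite big_nil; rewrite pd_cst.
  rewrite in_cons negb_or eq_sym => /andP[/negPf ij /IH Dw].
  under eq_fun do rewrite big_cons.
  rewrite pdM ?pd_coord; [|exact: Cinf_coord | exact: Cinf_monom].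
  by apply/funext => v; rewrite [pd i _ v](congr1 (@^~ v) Dw) ij !mulr0 addr0.
have [iS|iS] := boolP (i \in S); last exact: pd0.
have -> : setmon S = fun v => v 0 i * setmon (S :\ i) v.
  by apply/funext => v; exact: setmonD1.
rewrite pdM ?pd_coord; [|exact: Cinf_coord | exact: Cinf_setmon].
apply/funext => v; rewrite pd0 ?finset.setD11 // mulr0 add0r eqxx mulr1.
by [].
Qed.

Lemma pd_sum i (T : Type) (r : seq T) (F : T -> 'rV[R]_k -> R) :
  (forall j, Cinf (F j)) ->
  pd i (fun v => \sum_(j <- r) F j v) = fun v => \sum_(j <- r) pd i (F j) v.
Proof.
move=> CF; elim: r => [|j r IH].
  under eq_fun do rewrite big_nil; rewrite pd_cst.
  by apply/funext => v; rewrite big_nil.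
under eq_fun do rewrite big_cons.
rewrite pdD //; last exact: Cinf_sum.
by rewrite IH; apply/funext => v; rewrite big_cons.
Qed.

Lemma pd_mlin i (c : {set 'I_k} -> R) : pd i (mlin c) = mlin (fun S : {set 'I_k} => if i \in S then 0 else c (i |: S)).
Proof.
rewrite pd_sum => [|S]; last by apply: CinfM; [exact: Cinf_cst | exact: Cinf_setmon].
apply/funext => v; rewrite /mlin [RHS](bigID (fun S : {set 'I_k} => i \notin S)) /=.
rewrite [X in _ = _ + X]big1 ?addr0 => [|S]; last by rewrite negbK => ->; rewrite mul0r.
have := sum_setU1 i (fun S => c S * setmon (S :\ i) v).
rewrite (eq_bigr (fun S : {set 'I_k} => (if i \in S then 0 else c (i |: S)) * setmon S v)); last first.
  by move=> S iS; rewrite (negPf iS) finset.setU1K.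
move=> ->; rewrite [LHS](bigID (fun S : {set 'I_k} => i \in S)) /=.
rewrite [X in _ + X]big1 ?addr0 => [|S iS]; last first.
  by rewrite pdM ?pd_cst ?pd_setmon ?(negPf iS) ?mulr0 ?addr0 //; [exact: Cinf_cst | exact: Cinf_setmon].
apply: eq_bigr => S iS; rewrite pdM ?pd_cst ?pd_setmon ?iS ?mulr0 ?addr0 //.
  exact: Cinf_cst.
exact: Cinf_setmon.
Qed.

Lemma mlin_at0 (c : {set 'I_k} -> R) : mlin c 0 = c finset.set0.
Proof.
rewrite /mlin (bigD1 finset.set0) //= setmon0 mulr1 big1 ?addr0 // => S /finset.set0Pn[i iS].
by rewrite (setmonD1 _ iS) mxE mul0r mulr0.
Qed.

(** Differentiation by [i] carries the coefficient of [S] to that of [S :\ i], until evaluation at 0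
    gives the coefficient of the empty set. Variables of [r] outside [S] are skipped. *)
Lemma jet0_mlin r (c : {set 'I_k} -> R) (S : {set 'I_k}) : jet0 r (mlin c) -> {subset S <= r} -> c S = 0.
Proof.
elim: r c S => [|i r IH] c S /=.
  by move=> [_ +] Sr; rewrite mlin_at0; have -> : S = finset.set0 by apply/finset.setP => j; rewrite finset.in_set0; apply/negP => /Sr.
move=> [J0 J1] Sr; have [iS|iS] := boolP (i \in S); last first.
  apply: IH J0 _ => j jS; have := Sr j jS; rewrite in_cons => /predU1P[ji|//].
  by rewrite -ji jS in iS.
move: J1; rewrite pd_mlin => /(IH _ (S :\ i)); rewrite finset.setD11 finset.setD1K //; apply.
move=> j; rewrite finset.in_setD1 => /andP[/negPf ji /Sr]; rewrite in_cons ji //.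
Qed.

Section Squares.
Variable I : set ('rV[R]_k -> R).
Hypothesis idealI : is_ideal I.
Hypothesis sqI : forall i, I (fun v => v 0 i ^+ 2).

(** Multiplying a term with [i] in [S] produces the square of the coordinate [i], which lies in
    [I]. *)
Lemma mlin_coordM i (c : {set 'I_k} -> R) : cong I (fun v : 'rV[R]_k => v 0 i * mlin c v)
  (mlin (fun S : {set 'I_k} => if i \in S then c (S :\ i) else 0)).
Proof.
rewrite /cong; have -> : (fun v : 'rV[R]_k => v 0 i * mlin c v -
     mlin (fun S : {set 'I_k} => if i \in S then c (S :\ i) else 0) v) =
   fun v => \sum_(S : {set 'I_k} | i \in S) (c S * setmon (S :\ i) v) * v 0 i ^+ 2.
  apply/funext => v; rewrite /mlin (bigID (fun S : {set 'I_k} => i \in S)) /=.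
  rewrite [X in _ - X](bigID (fun S : {set 'I_k} => i \in S)) /=.
  rewrite [X in _ - (_ + X)]big1 ?addr0 => [|S /negPf ->]; last by rewrite mul0r.
  rewrite mulrDr -addrA -[RHS]addr0; congr (_ + _).
    rewrite mulr_sumr; apply: eq_bigr => S iS; rewrite (setmonD1 v iS); ring.
  apply/eqP; rewrite subr_eq0 mulr_sumr -sum_setU1; apply/eqP.
  by apply: eq_bigr => S iS; rewrite finset.setU11 finset.setU1K // setmonU1 //; ring.
apply: ideal_sum => // S _; apply: idealM => //; apply: CinfM; first exact: Cinf_cst.
exact: Cinf_setmon.
Qed.

Lemma mlinD (c c' : {set 'I_k} -> R) v : mlin (fun S => c S + c' S) v = mlin c v + mlin c' v.
Proof. by rewrite /mlin -big_split; apply: eq_bigr => S _; rewrite mulrDl. Qed.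

Lemma mlin_sum (T : Type) (r : seq T) (c : T -> {set 'I_k} -> R) v :
  mlin (fun S => \sum_(i <- r) c i S) v = \sum_(i <- r) mlin (c i) v.
Proof.
rewrite /mlin exchange_big; apply: eq_bigr => S _.
by rewrite mulr_suml.
Qed.

Lemma mlinZ (x : R) (c : {set 'I_k} -> R) v : mlin (fun S => x * c S) v = x * mlin c v.
Proof. by rewrite /mlin mulr_sumr; apply: eq_bigr => S _; rewrite mulrA. Qed.

Lemma mlin_cst x v : mlin (fun S : {set 'I_k} => if S == finset.set0 then x else 0) v = x.
Proof.
rewrite /mlin (bigD1 finset.set0) //= eqxx setmon0 mulr1 big1 ?addr0 // => S /negPf ->.
by rewrite mul0r.
Qed.

Lemma sq_normal a : Cinf a -> exists c : {set 'I_k} -> R, cong I a (mlin c).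
Proof.
apply: (@ideal_span I idealI k.+1 [set a | exists c : {set 'I_k} -> R, cong I a (mlin c)]).
- by move=> w; exact: ideal_sq_monom.
- move=> b Ib; exists (fun=> 0); rewrite /cong.
  under eq_fun do (rewrite /mlin big1 ?subr0 => [|S _]; last by rewrite mul0r).
  exact: Ib.
- move=> b b' [c cE] [c' cE']; exists (fun S : {set 'I_k} => c S + c' S).
  have -> : mlin (fun S => c S + c' S) = fun v => mlin c v + mlin c' v.
    by apply/funext => v; exact: mlinD.
  exact: congD.
- move=> x; exists (fun S : {set 'I_k} => if S == finset.set0 then x else 0).
  by rewrite /cong; under eq_fun do rewrite mlin_cst subrr; exact: ideal0.
- move=> i b [c cE]; exists (fun S : {set 'I_k} => if i \in S then c (S :\ i) else 0).
  apply: cong_trans (mlin_coordM i c) => //.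
  by apply: congMl => //; exact: Cinf_coord.
Qed.

(** A set with j+1 elements arises from one with j elements in j+1 ways, which turns j! into (j+1)!
    at each multiplication by the sum. *)
Lemma sum_expE j : cong I (fun v : 'rV[R]_k => (\sum_i v 0 i) ^+ j)
  (mlin (fun S : {set 'I_k} => if #|S| == j then (j`!)%:R else 0)).
Proof.
elim: j => [|j IH].
  rewrite /cong; have -> : mlin (fun S : {set 'I_k} => if #|S| == 0%N then (0`!)%:R else 0) = fun=> 1.
    apply/funext => v; rewrite -[RHS](mlin_cst 1 v).
    by apply: eq_bigr => S _; rewrite finset.cards_eq0.
  by under eq_fun do rewrite expr0 subrr; exact: ideal0.
under eq_fun do rewrite exprS.
have Cs : Cinf (fun v : 'rV[R]_k => \sum_i v 0 i) by apply: Cinf_sum => i; exact: Cinf_coord.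
apply: (cong_trans idealI (congMl idealI Cs IH)).
set c : {set 'I_k} -> R := fun S => _.
under eq_fun do rewrite mulr_suml.
apply: (cong_trans idealI (cong_sum idealI _ (fun i _ => mlin_coordM i c))).
rewrite /cong; set F := fun v => _.
suff -> : F = fun=> 0 by exact: ideal0.
apply/funext => v; rewrite /F -mlin_sum; apply/eqP; rewrite subr_eq0; apply/eqP.
apply: eq_bigr => S _; congr (_ * _).
rewrite -big_mkcond /= (eq_bigr (fun=> if #|S| == j.+1 then (j`!)%:R else 0)); last first.
  by move=> i iS; rewrite /c (finset.cardsD1 i S) iS.
rewrite sumr_const; case: eqP => [->|_]; last by rewrite mul0rn.
by rewrite factS natrM mulr_natl.
Qed.

Lemma horner_sumE (p : {poly R}) : cong I (fun v : 'rV[R]_k => p.[\sum_i v 0 i])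
  (mlin (fun S : {set 'I_k} => p`_(#|S|) * ((#|S|)`!)%:R)).
Proof.
under eq_fun do rewrite horner_coef.
pose c (j : 'I_(size p)) (S : {set 'I_k}) := p`_j * (if #|S| == j then (j`!)%:R else 0).
apply: (@cong_trans _ idealI (fun v => \sum_j mlin (c j) v)).
  apply: cong_sum => // j _.
  have -> : mlin (c j) = fun v => p`_j * mlin (fun S : {set 'I_k} => if #|S| == j then (j`!)%:R else 0) v.
    by apply/funext => v; exact: mlinZ.
  by apply: congMl => //; [exact: Cinf_cst | exact: sum_expE].
rewrite /cong; set F := fun v => _.
suff -> : F = fun=> 0 by exact: ideal0.
apply/funext => v; rewrite /F -mlin_sum; apply/eqP; rewrite subr_eq0; apply/eqP.
apply: eq_bigr => S _; congr (_ * _).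
have [lt|ge] := ltnP #|S| (size p).
  rewrite (bigD1 (Ordinal lt)) //= /c eqxx big1 ?addr0 // => j jS.
  case: eqP => [Sj|_]; last by rewrite mulr0.
  by case/eqP: jS; apply: val_inj.
rewrite nth_default // mul0r big1 // => j _; rewrite /c.
case: eqP => [Sj|_]; last by rewrite mulr0.
by have := ltn_ord j; rewrite -Sj ltnNge ge.
Qed.

End Squares.
End Ideals.

Definition sqfree {R : realType} (W : walg R) : Prop :=
  (forall i, widl W (fun v => v 0 i ^+ 2)) /\ forall a, widl W a -> a 0 = 0.

Lemma weil_monom {R : realType} (W : walg R) r :
  (forall w, size w = r -> widl W (monom w)) ->
  (forall a, widl W a -> a 0 = 0) -> weil W.
Proof.
move=> Wr W0; split=> //; exists r => a am.
have s0 : (size ([::] : seq 'I_(wdim W)) + size (index_enum 'I_r))%N = r.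
  by rewrite add0n /index_enum -enumT size_enum_ord.
have := ideal_prod_span (widlP W) Wr am s0.
by congr (widl W); apply/funext => v; rewrite /monom big_nil mul1r.
Qed.

Lemma sqfree_weil {R : realType} (W : walg R) : sqfree W -> weil W.
Proof.
move=> [W2 W0]; apply: (weil_monom (r := (wdim W).+1)) => // w.
exact: (ideal_sq_monom (widlP W)).
Qed.

(** * Weil algebras *)

Section WeilFacts.
Context {R : realType}.

Lemma widl_comp (W W' : walg R) (t : wmor W W') a b :
  cong (widl W) a b -> cong (widl W') (a \o t) (b \o t).
Proof. by move=> /(wfunI t). Qed.

Lemma wprod_min (W1 W2 : walg R) (J : set ('rV[R]_(wdim W1 + wdim W2) -> R)) :
  is_ideal J -> (forall a, widl W1 a -> J (a \o lsubmx)) ->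
  (forall a, widl W2 a -> J (a \o rsubmx)) -> widl (wprod W1 W2) `<=` J.
Proof.
move=> JI J1 J2; apply: ideal_gen_min => // b [] [a Ia ->]; [exact: J1 | exact: J2].
Qed.

Lemma sqfree_wprod (W1 W2 : walg R) : sqfree W1 -> sqfree W2 -> sqfree (wprod W1 W2).
Proof.
move=> [s1 z1] [s2 z2]; split=> [i|].
  rewrite -(splitK i); case: (fintype.split i) => j /=.
    have := widl_prodl (W2 := W2) (s1 j); congr (widl _).
    by apply/funext => v /=; rewrite mxE.
  have := widl_prodr (W1 := W1) (s2 j); congr (widl _).
  by apply/funext => v /=; rewrite mxE.
(* For the empty list, [jet0] is the ideal of all smooth functions vanishing at 0. *)
suff H : widl (wprod W1 W2) `<=` jet0 [::] by move=> a /H[].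
apply: wprod_min; first exact: jet0_ideal.
  move=> a Ia; split; last by rewrite /= linear0 z1.
  by apply: Cinf_comp => [|j]; [exact: idealC (widlP W1) _ Ia | exact: Cinf_lsub].
move=> a Ia; split; last by rewrite /= linear0 z2.
by apply: Cinf_comp => [|j]; [exact: idealC (widlP W2) _ Ia | exact: Cinf_rsub].
Qed.

Lemma cubeW_jet n r : uniq r -> widl (cubeW n : walg R) `<=` jet0 r.
Proof.
move=> ur; apply: ideal_gen_min; first exact: jet0_ideal.
by move=> _ [i ->]; exact: jet0_sqr.
Qed.

(** The ideal lies in [jet0] over all variables, which detects every coefficient. *)
Lemma cubeW_mlin n (c : {set 'I_n} -> R) S : widl (cubeW n) (mlin c) -> c S = 0.
Proof.
move=> /(cubeW_jet (enum_uniq 'I_n)) /jet0_mlin; apply=> i _.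
by rewrite mem_enum.
Qed.

Lemma sqfree_cubeW n : sqfree (cubeW n : walg R).
Proof.
split=> [i|a /(@cubeW_jet n [::] erefl) []//].
exact: cubeW_sqr.
Qed.

Lemma weil_cubeW n : weil (cubeW n : walg R).
Proof. exact/sqfree_weil/sqfree_cubeW. Qed.

Lemma weil_ordW n : weil (ordW n : walg R).
Proof.
apply: (weil_monom (r := n.+1)) => [w sw|].
  suff -> : monom w = fun v : 'rV[R]_1 => v 0 0 ^+ n.+1 by exact: ordW_exp.
  apply/funext => v; rewrite /monom (eq_bigr (fun=> v 0 0)); last by move=> i _; rewrite ord1.
  by rewrite big_const_seq count_predT sw iter_mulr_1.
suff H : widl (ordW n : walg R) `<=` jet0 [::] by move=> a /H[].
apply: ideal_gen_min; first exact: jet0_ideal.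
by move=> _ ->; split; [exact/CinfX/Cinf_coord | rewrite mxE expr0n].
Qed.

Lemma ordW_normal n (a : 'rV[R]_1 -> R) : Cinf a ->
  exists p : {poly R}, cong (widl (ordW n)) a (fun v => p.[v 0 0]).
Proof.
have II := widlP (ordW n : walg R).
apply: (@ideal_span R 1 _ II n.+1 [set a | exists p : {poly R}, cong _ a (fun v => p.[v 0 0])]).
- move=> w sw; suff -> : monom w = fun v : 'rV[R]_1 => v 0 0 ^+ n.+1 by exact: ordW_exp.
  apply/funext => v; rewrite /monom (eq_bigr (fun=> v 0 0)); last by move=> i _; rewrite ord1.
  by rewrite big_const_seq count_predT sw iter_mulr_1.
- by move=> b Ib; exists 0; rewrite /cong; under eq_fun do rewrite horner0 subr0.
- move=> b b' [p pE] [p' pE']; exists (p + p'); have := congD II pE pE'.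
  by congr (cong _ _); apply/funext => v; rewrite hornerD.
- move=> x; exists x%:P; have := cong_refl II (fun=> x).
  by congr (cong _ _); apply/funext => v; rewrite hornerC.
- move=> i b [p pE]; exists ('X * p); rewrite ord1; have := congMl II (Cinf_coord 0) pE.
  by congr (cong _ _); apply/funext => v; rewrite hornerM hornerX.
Qed.

Lemma ordW_mem n (p : {poly R}) : (forall j, (j <= n)%N -> p`_j = 0) ->
  widl (ordW n) (fun v => p.[v 0 0]).
Proof.
move=> p0; have -> : (fun v : 'rV[R]_1 => p.[v 0 0]) = fun v => \sum_(j < size p) p`_j * v 0 0 ^+ j.
  by apply/funext => v; rewrite horner_coef.
apply: (@widl_sum _ (ordW n)) => j; have [jn|nj] := leqP j n.
  have := ideal0 (widlP (ordW n : walg R)); congr widl; apply/funext => v.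
  by rewrite p0 // mul0r.
have := @widlM _ (ordW n) (fun v => p`_j * v 0 0 ^+ (j - n.+1)) _ _ (@ordW_exp R n).
have C : Cinf (fun v : 'rV[R]_1 => p`_j * v 0 0 ^+ (j - n.+1)).
  by apply: CinfM; [exact: Cinf_cst | exact/CinfX/Cinf_coord].
move=> /(_ C); congr widl; apply/funext => v.
by rewrite -mulrA -exprD subnK.
Qed.

Lemma exists_card n j : (j <= n)%N -> exists S : {set 'I_n}, #|S| = j.
Proof.
move=> jn; exists [set x in take j (enum 'I_n)]%SET.
rewrite cardsE (card_uniqP _) ?take_uniq ?enum_uniq //.
by rewrite size_takel // size_enum_ord.
Qed.

(** In p (d_1 + ... + d_n) a set with j elements has the coefficient j! p_j. Each j <= n is the size
    of some set, and j! is nonzero in R. *)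
Lemma plus_mono n (c : 'rV[R]_1 -> R) : Cinf c ->
  widl (cubeW n) (c \o @plus_map R n) -> widl (ordW n) c.
Proof.
move=> Cc Ic; have [p pE] := ordW_normal n Cc.
have [s0 _] := sqfree_cubeW n; have II := widlP (cubeW n : walg R).
apply: (cong_mem (widlP (ordW n)) pE).
apply: ordW_mem => j /exists_card[S Sj].
have := widl_comp (wplus n) pE => /(cong_sym II) E1.
have E2 := cong_mem II E1 Ic.
have : widl (cubeW n) (mlin (fun S : {set 'I_n} => p`_(#|S|) * ((#|S|)`!)%:R)).
  refine (cong_mem II (cong_sym II (horner_sumE II s0 p)) _).
  by move: E2; congr (widl (cubeW n)); apply/funext => v; rewrite /= mxE.
move=> /(cubeW_mlin S)/eqP.
by rewrite Sj mulf_eq0 pnatr_eq0 -leqn0 leqNgt fact_gt0 orbF => /eqP.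
Qed.

Lemma setmon_perm n (sigma : 'S_n) (S : {set 'I_n}) (v : 'rV[R]_n) :
  setmon S (perm_map sigma v) = setmon (sigma @: S)%SET v.
Proof.
rewrite /setmon big_imset /=; last by move=> i j _ _; exact: perm_inj.
by apply: eq_bigr => i _; rewrite mxE.
Qed.

(** Exchanging an element of [S] outside [T] with one of [T] outside [S] keeps the value of [c] and
    shrinks [S :\: T]. *)
Lemma card_swap n (c : {set 'I_n} -> R) :
  (forall i j (S : {set 'I_n}), i \in S -> j \notin S -> c (tperm i j @: S)%SET = c S) ->
  forall S T : {set 'I_n}, #|S| = #|T| -> c S = c T.
Proof.
move=> cs S T; move: {2}#|_| (leqnn #|S :\: T|%SET) => m.
elim: m S => [|m IH] S Sm ST.
  congr c; apply/eqP; rewrite finset.eqEcard ST leqnn andbT.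
  by move: Sm; rewrite leqn0 finset.cards_eq0 finset.setD_eq0.
have [ST0|] := boolP (S \subset T).
  by congr c; apply/eqP; rewrite finset.eqEcard ST leqnn andbT.
move=> /fintype.subsetPn[i iS iT].
have : ~~ (T \subset S).
  apply/negP => TS; have /eqP E : T == S by rewrite finset.eqEcard TS ST leqnn.
  by rewrite E iS in iT.
move=> /fintype.subsetPn[j jT jS].
rewrite -(cs i j) //; apply: IH; last by rewrite card_imset //; exact: perm_inj.
rewrite -ltnS; apply: leq_trans Sm; apply: proper_card.
apply/properP; split; last first.
  exists i; first by rewrite finset.in_setD iS iT.
  rewrite finset.in_setD iT; apply/imsetP => -[x xS /(congr1 (tperm i j))].
  by rewrite tpermK tpermL => jx; rewrite jx xS in jS.
apply/fintype.subsetP => x; rewrite !finset.in_setD => /andP[xT].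
rewrite xT => /imsetP[y yS xE]; move: xT; rewrite xE.
by case: tpermP => [_|_|//]; [rewrite jT | rewrite iS].
Qed.

(** Symmetry makes the coefficient of [S] depend on its cardinality alone; division by the factorial
    then gives a polynomial in the sum. The function [b'] is the component at the target of the
    equalizer diagram. *)
Lemma plus_equalizer n (b b' : 'rV[R]_n -> R) : Cinf b ->
  (forall sigma, cong (widl (cubeW n)) (b \o perm_map sigma) b') ->
  exists2 c : 'rV[R]_1 -> R, Cinf c & cong (widl (cubeW n)) (c \o @plus_map R n) b'.
Proof.
move=> Cb bs; have [s0 _] := sqfree_cubeW n; have II := widlP (cubeW n : walg R).
have [c cE] : exists c : {set 'I_n} -> R, cong (widl (cubeW n)) b (mlin c) := sq_normal II s0 Cb.
have E2 : cong (widl (cubeW n)) b' (mlin c).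
  refine (cong_trans II (cong_sym II (bs 1%g)) _).
  by move: cE; congr (cong _ _); apply/funext => v /=; congr b; apply/rowP => i; rewrite mxE perm1.
have cs (sigma : 'S_n) (S : {set 'I_n}) : c (sigma^-1%g @: S)%SET = c S.
  have : widl (cubeW n) (mlin (fun S : {set 'I_n} => c (sigma^-1%g @: S)%SET - c S)).
    have E1 : cong (widl (cubeW n)) (mlin (fun S : {set 'I_n} => c (sigma^-1%g @: S)%SET))
        (b \o perm_map sigma).
      have := cong_sym II (widl_comp (wperm sigma) cE).
      congr (cong (widl (cubeW n))); apply/funext => v; rewrite /= /mlin.
      rewrite (reindex_inj (@imset_inj _ _ sigma^-1%g perm_inj)) /=.
      apply: eq_bigr => T _; rewrite setmon_perm; congr (_ * setmon _ _).
      rewrite -imset_comp -[RHS]imset_id; apply: eq_imset => x.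
      by rewrite /= permKV.
    have := cong_trans II (cong_trans II E1 (bs sigma)) E2.
    rewrite /cong; congr (widl _); apply/funext => v.
    by rewrite /mlin -sumrB; apply: eq_bigr => T _; rewrite mulrBl.
  by move=> /(cubeW_mlin S)/eqP; rewrite subr_eq0 => /eqP.
have cc : forall S T : {set 'I_n}, #|S| = #|T| -> c S = c T.
  by apply: card_swap => i j S _ _; rewrite -[tperm i j]invgK cs.
(* The first [j] indices serve as a sample set of cardinality [j]. *)
pose ck j := c [set x in take j (enum 'I_n)]%SET.
pose p := \poly_(j < n.+1) (ck j / (j`!)%:R).
exists (fun v => p.[v 0 0]); first exact/Cinf_horner/Cinf_coord.
suff H : cong (widl (cubeW n)) ((fun v : 'rV[R]_1 => p.[v 0 0]) \o @plus_map R n) (mlin c).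
  exact (cong_trans II H (cong_sym II E2)).
have := horner_sumE II s0 p; congr (cong _ _ _); apply/funext => v; first by rewrite /= mxE.
apply: eq_bigr => S _; congr (_ * _).
have Sn : (#|S| <= n)%N by rewrite -[leqRHS]card_ord max_card.
rewrite coef_poly ltnS Sn divfK ?pnatr_eq0 -?lt0n ?fact_gt0 //.
apply: cc; rewrite cardsE (card_uniqP _) ?take_uniq ?enum_uniq //.
by rewrite size_takel // size_enum_ord.
Qed.

End WeilFacts.

(** * Infinitesimal parameters with prescribed vanishing products *)

Section Conflict.
Context {R : realType}.

Lemma Cinf_map_lsub k l : Cinf_map (lsubmx : 'rV[R]_(k + l) -> 'rV[R]_k).
Proof. by move=> j; exact: Cinf_lsub. Qed.

Lemma Cinf_map_rsub k l : Cinf_map (rsubmx : 'rV[R]_(k + l) -> 'rV[R]_l).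
Proof. by move=> j; exact: Cinf_rsub. Qed.

Lemma Cinf_map_row_mx j k l (s : 'rV[R]_j -> 'rV[R]_k) (t : 'rV[R]_j -> 'rV[R]_l) :
  Cinf_map s -> Cinf_map t -> Cinf_map (fun v => row_mx (s v) (t v)).
Proof.
move=> Cs Ct i; under eq_fun do rewrite mxE.
by case: (fintype.split i) => x; [exact: Cs | exact: Ct].
Qed.

Lemma Cinf_map_comp j k l (s : 'rV[R]_j -> 'rV[R]_k) (t : 'rV[R]_k -> 'rV[R]_l) :
  Cinf_map s -> Cinf_map t -> Cinf_map (t \o s).
Proof. by move=> Cs Ct i; exact: (Cinf_comp (Ct i) Cs). Qed.

Program Definition wprodr (W1 W2 W2' : walg R) (t : wmor W2 W2') :
    wmor (wprod W1 W2) (wprod W1 W2') :=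
  @wmor_gen _ _ _ (@wprod_subproof _ W1 W2) (wprod W1 W2')
    (fun v => row_mx (lsubmx v) (t (rsubmx v))) _ _ _.
Next Obligation.
move=> W1 W2 W2' t; apply: Cinf_map_row_mx; first exact: Cinf_map_lsub.
exact: (Cinf_map_comp (@Cinf_map_rsub _ _) (wfunC t)).
Qed.
Next Obligation.
move=> W1 W2 W2' t.
have -> : lsubmx (0 : 'rV[R]_(wdim W1 + wdim W2')) = 0 by apply/rowP => i; rewrite !mxE.
have -> : rsubmx (0 : 'rV[R]_(wdim W1 + wdim W2')) = 0 by apply/rowP => i; rewrite !mxE.
by rewrite wfun0 row_mx0.
Qed.
Next Obligation.
move=> W1 W2 W2' t g [] [a Ia ->].
  have := widl_prodl (W2 := W2') Ia; congr widl; apply/funext => v /=.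
  by rewrite row_mxKl.
have := widl_prodr (W1 := W1) (wfunI t Ia); congr widl; apply/funext => v /=.
by rewrite row_mxKr.
Qed.

(** The case [a == b] adds the squares. The quotient is the Stanley-Reisner algebra of the
    independent sets of the graph [e], taken modulo squares. *)
Definition conflict_gen N (e : rel 'I_N) : set ('rV[R]_N -> R) :=
  [set g : 'rV[R]_N -> R | exists a b, (a == b) || e a b /\ g = fun t => t 0 a * t 0 b].

Lemma conflict_genC N (e : rel 'I_N) : conflict_gen e `<=` Cinf.
Proof. by move=> _ [a [b [_ ->]]]; apply: CinfM; exact: Cinf_coord. Qed.

Definition conflictW N (e : rel 'I_N) : walg R := walg_gen (@conflict_genC N e).

Definition indep N (e : rel 'I_N) (A : {set 'I_N}) : bool :=
  [forall a in A, forall b in A, (a != b) ==> ~~ e a b].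

Lemma sqfree_conflictW N (e : rel 'I_N) : sqfree (conflictW e).
Proof.
split=> [i|].
  by apply: ideal_gen_sub; exists i, i; rewrite eqxx; split.
suff H : widl (conflictW e) `<=` jet0 [::] by move=> a /H[].
apply: ideal_gen_min; first exact: jet0_ideal.
move=> _ [a [b [_ ->]]]; split; last by rewrite mxE mul0r.
by apply: CinfM; exact: Cinf_coord.
Qed.

Definition keep_map N (A : {set 'I_N}) (t : 'rV[R]_N) : 'rV[R]_N :=
  \row_a if a \in A then t 0 a else 0.

Program Definition wkeep N (e : rel 'I_N) (A : {set 'I_N}) :
    wmor (conflictW e) (conflictW e) :=
  @wmor_gen _ _ _ (@conflict_genC N e) (conflictW e) (keep_map A) _ _ _.
Next Obligation.
move=> N e A i; under eq_fun do rewrite mxE.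
by case: (i \in A); [exact: Cinf_coord | exact: Cinf_cst].
Qed.
Next Obligation. by move=> N e A; apply/rowP => i; rewrite !mxE if_same. Qed.
Next Obligation.
move=> N e A _ [a [b [ab ->]]].
have -> : (fun t : 'rV[R]_N => t 0 a * t 0 b) \o keep_map A =
    fun t => ((a \in A)%:R * (b \in A)%:R) * (t 0 a * t 0 b).
  apply/funext => t; rewrite /= !mxE.
  by case: (a \in A); case: (b \in A); rewrite ?(mul0r, mulr0, mul1r, mulr1).
apply: (@widlM _ (conflictW e)); first exact: Cinf_cst.
by apply: ideal_gen_sub; exists a, b.
Qed.

Lemma conflictW_monom n N (e : rel 'I_N) (U : {set 'I_(n + N)}) :
  ~~ indep e [set a | rshift n a \in U]%SET ->
  widl (wprod (cubeW n) (conflictW e)) (setmon U).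
Proof.
move=> /forall_inPn[a]; rewrite inE => aU /forall_inPn[b]; rewrite inE => bU.
rewrite negb_imply negbK => /andP[ab eab].
have Iab : widl (conflictW e) (fun t => t 0 a * t 0 b).
  by apply: ideal_gen_sub; exists a, b; rewrite eab orbT.
have := idealM (widlP (wprod (cubeW n) (conflictW e)))
  (Cinf_setmon (U :\ rshift n a :\ rshift n b)%SET) (widl_prodr (W1 := cubeW n) Iab).
congr widl; apply/funext => v; rewrite (setmonD1 v aU) (@setmonD1 _ _ (rshift n b) (U :\ rshift n a)%SET); last first.
  by rewrite finset.in_setD1 bU andbT (inj_eq (@rshift_inj _ _)) eq_sym.
by rewrite /= !mxE; ring.
Qed.

(** Of two distinct conflicting parameters at least one is missing from the variables of [U], so
    their product lies in the jet ideal; equal ones give a square. *)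
Lemma conflictW_jet n N (e : rel 'I_N) (U : {set 'I_(n + N)}) :
  indep e [set a | rshift n a \in U]%SET ->
  widl (wprod (cubeW n) (conflictW e)) `<=` jet0 (enum U).
Proof.
move=> /forall_inP indU; have uU := enum_uniq U.
have JI := @jet0_ideal R _ (enum U).
apply: wprod_min => // a Ia.
  apply: (ideal_gen_comp (@Cinf_map_lsub _ _) JI _ (@cube_genC R n)) Ia => _ [i ->].
  have := jet0_sqr (R := R) (lshift N i) uU; congr jet0; apply/funext => v.
  by rewrite /= mxE.
apply: (ideal_gen_comp (@Cinf_map_rsub _ _) JI _ (@conflict_genC N e)) Ia.
move=> _ [b [c [bc ->]]].
have -> : (fun t : 'rV[R]_N => t 0 b * t 0 c) \o rsubmx =
    fun v : 'rV[R]_(n + N) => v 0 (rshift n b) * v 0 (rshift n c).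
  by apply/funext => v; rewrite /= !mxE.
have [<-|bNc] := eqVneq b c; first by have := jet0_sqr (R := R) (rshift n b) uU.
have [bU|bU] := boolP (rshift n b \in U); last first.
  have := idealM JI (Cinf_coord (rshift n c)) (@jet0_coord R _ (enum U) (rshift n b) _).
  by rewrite mem_enum => /(_ bU); congr jet0; apply/funext => v; rewrite mulrC.
have [cU|cU] := boolP (rshift n c \in U); last first.
  apply: (idealM JI (Cinf_coord (rshift n b))); apply: jet0_coord.
  by rewrite mem_enum.
have := indU b; rewrite inE => /(_ bU) /forall_inP /(_ c).
rewrite inE => /(_ cU); rewrite bNc /= => /negP; case.
by move: bc; rewrite (negPf bNc).
Qed.

Lemma setmon_keep n N (e : rel 'I_N) (A : {set 'I_N}) (U : {set 'I_(n + N)}) v :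
  setmon U (wprodr (cubeW n : walg R) (wkeep e A) v) =
  if [set a | rshift n a \in U]%SET \subset A then setmon U v else 0.
Proof.
have KE (i : 'I_(n + N)) : (wprodr (cubeW n : walg R) (wkeep e A) v) 0 i =
    if fintype.split i is inr a then if a \in A then v 0 i else 0 else v 0 i.
  by rewrite -(splitK i); case: (fintype.split i) => j; rewrite !mxE unsplitK /= !mxE.
case: ifPn => [UA|/fintype.subsetPn[a]].
  apply: eq_bigr => i iU; rewrite KE -[i](splitK i); move: iU; rewrite -{1}[i](splitK i).
  rewrite !unsplitK; case: (fintype.split i) => //= a aU.
  by rewrite (fintype.subsetP UA) // inE.
by rewrite inE => aU /negPf aA; rewrite (setmonD1 _ aU) KE (unsplitK (inr a)) aA mul0r.
Qed.

(** The independent coordinate subspaces cover the infinitesimal locus: a monomial with dependent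
    parameters is in the ideal already, and an independent one survives restriction to its own
    parameters, where [conflictW_jet] detects its coefficient. *)
Lemma keep_mono n N (e : rel 'I_N) (c : 'rV[R]_(n + N) -> R) : Cinf c ->
  (forall A, indep e A ->
     widl (wprod (cubeW n) (conflictW e)) (c \o wprodr (cubeW n) (wkeep e A))) ->
  widl (wprod (cubeW n) (conflictW e)) c.
Proof.
move=> Cc Ic; set W := wprod _ _ in Ic *; have II := widlP W.
have [s0 _] := sqfree_wprod (sqfree_cubeW (R := R) n) (sqfree_conflictW e).
have [x xE] : exists x : {set 'I_(n + N)} -> R, cong (widl W) c (mlin x) := sq_normal II s0 Cc.
refine (cong_mem II xE _); apply: (ideal_sum II) => U _.
have [iU|iU] := boolP (indep e [set a | rshift n a \in U]%SET); last first.
  by apply: (idealM II (Cinf_cst _)); exact: conflictW_monom.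
set A := finset _ in iU; pose y (V : {set 'I_(n + N)}) :=
  if [set a | rshift n a \in V]%SET \subset A then x V else 0.
have yE : mlin x \o wprodr (cubeW n) (wkeep e A) = mlin y.
  apply/funext => v; apply: eq_bigr => V _; rewrite setmon_keep /y.
  by case: ifP => _; rewrite ?mulr0 ?mul0r.
have xm := cong_mem II (cong_sym II (widl_comp (wprodr (cubeW n) (wkeep e A)) xE)) (Ic A iU).
have : jet0 (enum U) (mlin y) by rewrite -yE; exact: conflictW_jet xm.
move=> /jet0_mlin H.
have : y U = 0 by apply: H => i; rewrite mem_enum.
rewrite /y fintype.subxx => ->.
by have := ideal0 II; congr widl; apply/funext => v; rewrite mul0r.
Qed.

Definition sprod_map n (v : 'rV[R]_(n + n)) : 'rV[R]_n :=
  \row_i (lsubmx v 0 i * rsubmx v 0 i).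

Program Definition wsprod n : wmor (cubeW n) (wprod (cubeW n) (cubeW n)) :=
  @wmor_gen _ _ _ (@cube_genC R n) (wprod (cubeW n) (cubeW n)) (@sprod_map n) _ _ _.
Next Obligation.
move=> n i; under eq_fun do rewrite mxE.
by apply: CinfM; [exact: Cinf_lsub | exact: Cinf_rsub].
Qed.
Next Obligation. by move=> n; apply/rowP => i; rewrite !mxE mulr0. Qed.
Next Obligation.
move=> n _ [i ->].
have := @widlM _ (wprod (cubeW n) (cubeW n)) (fun v => rsubmx v 0 i ^+ 2) _ _
  (@widl_prodl _ (cubeW n) (cubeW n) _ (@cubeW_sqr R n i)).
have C : Cinf (fun v : 'rV[R]_(n + n) => rsubmx v 0 i ^+ 2) by exact/CinfX/Cinf_rsub.
move=> /(_ C); congr widl; apply/funext => v.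
by rewrite /= [in RHS]mxE exprMn mulrC.
Qed.

(** The index set of d_S r_S, which [sprod_map] substitutes for d_S. *)
Definition double n (S : {set 'I_n}) : {set 'I_(n + n)} :=
  (@lshift n n @: S :|: @rshift n n @: S)%SET.

Lemma double_inj n : injective (@double n).
Proof.
move=> S T /finset.setP ST; apply/finset.setP => i.
have dE (U : {set 'I_n}) : (lshift n i \in double U) = (i \in U).
  rewrite finset.in_setU mem_imset; last exact: lshift_inj.
  case: (i \in U) => //=; apply/negbTE/imsetP => -[j _] /eqP.
  by rewrite eq_lrshift.
by have := ST (lshift n i); rewrite !dE.
Qed.

Lemma setmon_double n (S : {set 'I_n}) v :
  setmon S (sprod_map v) = setmon (double S) v.
Proof.
rewrite /setmon /double (eq_bigl [predU (@lshift n n @: S)%SET & (@rshift n n @: S)%SET]); last first.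
  by move=> i; rewrite finset.in_setU.
rewrite bigU /=; last first.
  rewrite -finset.setI_eq0; apply/eqP/finset.setP => i; rewrite !inE; apply/negbTE/andP => -[].
  by move=> /imsetP[j _ ->] /imsetP[j' _] /eqP; rewrite eq_lrshift.
rewrite !big_imset /=; [|by move=> i j _ _; exact: rshift_inj|by move=> i j _ _; exact: lshift_inj].
rewrite -big_split; apply: eq_bigr => i _.
by rewrite !mxE.
Qed.

(** Distinct monomials d_S go to distinct multilinear monomials d_S r_S, whose coefficients are
    still detected modulo squares. This gives the injectivity of d |-> r d. *)
Lemma sprod_mono n (c : 'rV[R]_n -> R) : Cinf c ->
  widl (wprod (cubeW n) (cubeW n)) (c \o @sprod_map n) -> widl (cubeW n) c.
Proof.
move=> Cc Ic; have [s0 _] := sqfree_cubeW (R := R) n; have II := widlP (cubeW n : walg R).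
have [x xE] : exists x : {set 'I_n} -> R, cong (widl (cubeW n)) c (mlin x) := sq_normal II s0 Cc.
have xm := cong_mem (widlP _) (cong_sym (widlP _) (widl_comp (wsprod n) xE)) Ic.
refine (cong_mem II xE _); apply: (ideal_sum II) => U _.
pose y V := \sum_(S | double S == V) x S.
have yE : mlin x \o @sprod_map n = mlin y.
  apply/funext => v; rewrite /= /mlin (partition_big (@double n) xpredT) //=.
  apply: eq_bigr => V _; rewrite /y mulr_suml; apply: eq_bigr => S /eqP <-.
  by rewrite setmon_double.
have yU : y (double U) = x U.
  rewrite /y (big_pred1 U) // => S; exact: (inj_eq (@double_inj n)).
have J : widl (wprod (cubeW n : walg R) (cubeW n)) `<=` jet0 (enum (double U)).
  apply: wprod_min; first exact: jet0_ideal.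
    move=> a Ia.
    apply: (ideal_gen_comp (@Cinf_map_lsub _ _) (jet0_ideal _) _ (@cube_genC R n)) Ia => _ [i ->].
    have := jet0_sqr (R := R) (lshift n i) (enum_uniq (double U)); congr jet0.
    by apply/funext => v; rewrite /= mxE.
  move=> a Ia.
  apply: (ideal_gen_comp (@Cinf_map_rsub _ _) (jet0_ideal _) _ (@cube_genC R n)) Ia => _ [i ->].
  have := jet0_sqr (R := R) (rshift n i) (enum_uniq (double U)); congr jet0.
  by apply/funext => v; rewrite /= mxE.
have : jet0 (enum (double U)) (mlin y) by rewrite -yE; exact: J.
move=> /jet0_mlin H; rewrite -yU (H (double U)); last by move=> i; rewrite mem_enum.
by have := ideal0 II; congr widl; apply/funext => v; rewrite mul0r.
Qed.

End Conflict.

(** * Prolongations *)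

Section Tensors.
Context {R : realType}.
Implicit Types (X Y Z : frolicher R) (W : walg R).

Program Definition wid W : wmor W W := @Wmor _ W W id _ _ _.
Next Obligation. by move=> W j; exact: Cinf_coord. Qed.
Next Obligation. by []. Qed.
Next Obligation. by []. Qed.

Lemma tensr_wpi X W W' (t : wmor W W') f :
  tensr X t (wpi X W f) = wpi X W' (scomp f (wsmap t)).
Proof. exact: tensrE. Qed.

Lemma tensl_wpi X Y (u : smap X Y) W f : tensl u W (wpi X W f) = wpi Y W (scomp u f).
Proof. exact: tenslE. Qed.

Lemma wpi_ext X W (f g : smap (space (wdim W)) X) : f =1 g -> wpi X W f = wpi X W g.
Proof. by move=> /smap_ext ->. Qed.

Lemma tensr_id X W (t : wmor W W) (z : tens X W) : (forall s, t s = s) -> tensr X t z = z.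
Proof.
move=> tid; rewrite -(wreprK z) tensr_wpi; apply: wpi_ext => s /=.
by rewrite tid.
Qed.

Lemma tensr_comp X W W1 W' (t1 : wmor W W1) (t1' : wmor W1 W') (t : wmor W W')
  (z : tens X W) : (forall s, t1 (t1' s) = t s) -> tensr X t1' (tensr X t1 z) = tensr X t z.
Proof.
move=> tt; rewrite -(wreprK z) !tensr_wpi; apply: wpi_ext => s /=.
by rewrite tt.
Qed.

Lemma tensr_square X W W1 W2 W' (t1 : wmor W W1) (t1' : wmor W1 W')
  (t2 : wmor W W2) (t2' : wmor W2 W') (z : tens X W) :
  (forall s, t1 (t1' s) = t2 (t2' s)) ->
  tensr X t1' (tensr X t1 z) = tensr X t2' (tensr X t2 z).
Proof.
move=> tt; rewrite -(wreprK z) !tensr_wpi; apply: wpi_ext => s /=.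
by rewrite tt.
Qed.

Lemma tensl_tensr X Y (u : smap X Y) W W' (t : wmor W W') z :
  tensl u W' (tensr X t z) = tensr Y t (tensl u W z).
Proof.
by rewrite -(wreprK z) tensr_wpi !tensl_wpi tensr_wpi; apply: wpi_ext.
Qed.

Lemma tensl_cancel X Y (u : smap X Y) (v : smap Y X) W :
  cancel u v -> cancel (tensl u W) (tensl v W).
Proof.
move=> uv z; rewrite -(wreprK z) !tensl_wpi; apply: wpi_ext => s /=.
exact: uv.
Qed.

Lemma fib_ext X W (x : X) (z z' : fib W x) : sval z = sval z' -> z = z'.
Proof. by case: z z' => [z zP] [z' zP'] /= zz; subst z'; congr exist; exact: Prop_irrelevance. Qed.

(* A jointly injective family out of [W] exhibits [W] as the limit of two copies of
   [W] over the targets. *)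
Lemma tensr_mono X W (J : finType) (D : J -> walg R) (p : forall j, wmor W (D j)) :
  microlinear X -> weil W -> (forall j, weil (D j)) ->
  (forall c, Cinf c -> (forall j, widl (D j) (c \o p j)) -> widl W c) ->
  forall z z', (forall j, tensr X (p j) z = tensr X (p j) z') -> z = z'.
Proof.
move=> mX wW wD mono z z' zz'.
pose V := (bool + J)%type.
pose DV (v : V) := match v with inl _ => W | inr j => D j end.
pose src (e : bool * J) : V := inl e.1.
pose tgt (e : bool * J) : V := inr e.2.
pose a (e : bool * J) : wmor (DV (src e)) (DV (tgt e)) := p e.2.
pose P (v : V) : wmor W (DV v) := match v with inl _ => wid W | inr j => p j end.
have lim : alg_limit a P.
  split.
  - move=> [b j] c Cc /=; have := ideal0 (widlP (D j)).
    by congr widl; apply/funext => s; rewrite subrr.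
  - move=> b Cb be; exists (b (inl true)); first exact: Cb.
    move=> [b0|j] /=; last first.
      exact: (be (true, j)).
    suff H : widl W (fun s => b (inl true) s - b (inl false) s).
      case: b0 => //; have := ideal0 (widlP W); congr widl; apply/funext => s.
      by rewrite subrr.
    apply: mono => [|j].
      have := CinfD (Cb (inl true)) (CinfM (Cinf_cst (-1)) (Cb (inl false))).
      by congr Cinf; apply/funext => s; rewrite mulN1r.
    have := idealD (widlP (D j)) (be (true, j)) (idealZ (widlP (D j)) (-1) (be (false, j))).
    by congr widl; apply/funext => s /=; rewrite /a /=; ring.
  - by move=> c Cc /(_ (inl true)).
have wDV v : weil (DV v) by case: v => [b|j] /=.
have [_ /(_ line)] := mX _ _ _ _ _ _ _ _ wDV wW lim.
pose q (v : V) : smap line (tens X (DV v)) :=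
  match v with inl b => scst line (if b then z else z') | inr j => scst line (tensr X (p j) z) end.
move=> /(_ q) [|u [uq _]].
  by move=> [[] j] t //; exact: esym (zz' j).
have idE (y : tens X W) : tensr X (wid W) y = y by exact: tensr_id.
by rewrite -[LHS](uq (inl true) 0) -[RHS](uq (inl false) 0).
Qed.

Lemma comp_cong W k (u v : 'rV[R]_(wdim W) -> 'rV[R]_k) (b : 'rV[R]_k -> R) :
  Cinf_map u -> Cinf_map v -> Cinf b ->
  (forall j, widl W (fun s => u s 0 j - v s 0 j)) ->
  widl W (fun s => b (u s) - b (v s)).
Proof.
move=> Cu Cv /Hadamard[g Cg bE] uv.
have -> : (fun s => b (u s) - b (v s)) =
    fun s => \sum_j g j (row_mx (u s) (v s)) * (u s 0 j - v s 0 j).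
  by apply/funext => s; rewrite bE; apply: eq_bigr => j _; rewrite mulrC.
apply: (ideal_sum (widlP W)) => j _; apply: (idealM (widlP W)) => //.
exact: (Cinf_comp (Cg j) (Cinf_map_row_mx Cu Cv)).
Qed.

(* [h \o f] is only known to be smooth along curves, so that Hadamard's lemma does
   not apply to it without Boman's theorem. Microlinearity is used instead, for
   the ideal of the [a] such that [a \o u] and [a \o v] lie in that of [W]. *)
Lemma wpi_congr X W k (f : smap (space k) X) (u v : 'rV[R]_(wdim W) -> 'rV[R]_k)
    (Cu : Cinf_map u) (Cv : Cinf_map v) :
  microlinear X -> weil W -> u 0 = 0 -> v 0 = 0 ->
  (forall j, widl W (fun s => u s 0 j - v s 0 j)) ->
  wpi X W (scomp f (Smap (smooth_Cinf_map Cu))) =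
  wpi X W (scomp f (Smap (smooth_Cinf_map Cv))).
Proof.
move=> mX wW u0 v0 uv; have II := widlP W.
pose I0 := [set a : 'rV[R]_k -> R | [/\ Cinf a, widl W (a \o u) & widl W (a \o v)]].
have I0P : is_ideal I0.
  split=> [a []//||a b [Ca au av] [Cb bu bv]|c a Cc [Ca au av]]; split.
  - exact: Cinf_cst.
  - exact: ideal0.
  - exact: ideal0.
  - exact: CinfD.
  - exact: (idealD II au bu).
  - exact: (idealD II av bv).
  - exact: CinfM.
  - exact: (idealM II (Cinf_comp Cc Cu) au).
  - exact: (idealM II (Cinf_comp Cc Cv) av).
pose W0 := Walg I0P.
have wW0 : weil W0.
  have [W00 [r Wr]] := wW; split=> [a [_ au _]|]; first by have := W00 _ au; rewrite /= u0.
  exists r => a am; split.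
  - have -> : (fun s => \prod_i a i s) = fun s => \prod_(i <- index_enum 'I_r) a i s by [].
    elim: (index_enum _) => [|i l IH].
      by under eq_fun do rewrite big_nil; exact: Cinf_cst.
    by under eq_fun do rewrite big_cons; apply: CinfM => //; case: (am i).
  - apply: (Wr (fun i => a i \o u)) => i; have [Ca a0] := am i.
    by split; [exact: Cinf_comp | rewrite /= u0].
  - apply: (Wr (fun i => a i \o v)) => i; have [Ca a0] := am i.
    by split; [exact: Cinf_comp | rewrite /= v0].
pose tu : wmor W0 W := @Wmor _ W0 W u Cu u0 (fun a Ia => let: And3 _ au _ := Ia in au).
pose tv : wmor W0 W := @Wmor _ W0 W v Cv v0 (fun a Ia => let: And3 _ _ av := Ia in av).
pose D (b : bool) := if b then W0 else W.
pose a (e : unit) : wmor (D true) (D false) := tu.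
pose P (b : bool) : wmor W0 (D b) := if b return wmor W0 (D b) then wid W0 else tv.
have lim : @alg_limit R bool unit (fun=> true) (fun=> false) D a W0 P.
  split.
  - by move=> _ b Cb /=; exact: comp_cong.
  - move=> b Cb be; exists (b true); first exact: Cb.
    move=> [] /=.
      by have := ideal0 I0P; congr I0; apply/funext => s; rewrite subrr.
    have := cong_trans II (cong_sym II (comp_cong Cu Cv (Cb true) uv)) (be tt).
    by [].
  - by move=> c Cc /(_ true).
have wD b : weil (D b) by case: b.
have [+ _] := mX _ _ _ _ _ _ _ _ wD wW0 lim.
move=> /(_ tt (wpi X W0 f)); rewrite /= /tensr_fun.
have -> : wpi X W0 (scomp (wrepr (wpi X W0 f)) (wsmap (wid W0))) = wpi X W0 f.
  exact: (@tensr_id X W0 (wid W0)).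
move=> H; have := H; rewrite -/(tensr_fun tu _) -/(tensr_fun tv _) !tensrE.
by move=> E; apply: etrans (etrans E _); apply: wpi_ext.
Qed.

End Tensors.

(** * Iterated prolongations as prolongations by products *)

Section Exponentiable.
Context {R : realType} (X : frolicher R).
Hypothesis eX : weil_exponentiable X.

(** The terminal space. Exponentiability with this exponent turns statements about mapping spaces
    into statements about elements. *)
Definition point : frolicher R := initial (set0 : set (unit -> R)).

Lemma smooth_scst (Y : frolicher R) : smooth (@scst R point Y : Y -> expo point Y).
Proof. by apply: smooth_curry. Qed.

Lemma ev_pointK (Y : frolicher R) : cancel (ev Y (tt : point)) (Smap (@smooth_scst Y)).
Proof. by move=> u; apply: smap_ext => -[]. Qed.

(** Evaluation at the only element of [point] has an inverse, so [iter_tens] inherits injectivity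
    from the isomorphism [Phi]. *)
Lemma iter_tens_inj (W1 W2 : walg R) (z z' : tens X (wprod W1 W2)) :
  weil W1 -> weil W2 -> iter_tens z = iter_tens z' -> z = z'.
Proof.
move=> w1 w2; have [Phi [Psi [PhiK _]] PhiE] := eX w1 w2 point.
have E y : tensl (ev (tens X W1) (tt : point)) W2 (Phi (scst point y)) = iter_tens y.
  by apply: PhiE; rewrite wreprK.
rewrite -!E => /(can_inj (tensl_cancel (W := W2) (@ev_pointK _))) /(can_inj PhiK).
by move=> /(congr1 (fun u : smap point _ => u tt)).
Qed.

Lemma iter_tens_surj (W1 W2 : walg R) (y : tens (tens X W1) W2) :
  weil W1 -> weil W2 -> exists z : tens X (wprod W1 W2), iter_tens z = y.
Proof.
move=> w1 w2; have [Phi [Psi [_ PsiK]] PhiE] := eX w1 w2 point.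
pose u := Psi (tensl (Smap (@smooth_scst _)) W2 y).
exists (u tt).
have := PhiE u tt (wrepr (u tt)); rewrite wreprK => /(_ erefl).
rewrite /u PsiK => E; rewrite /iter_tens -E.
by apply: (tensl_cancel (W := W2)) => z.
Qed.

Lemma iter_tensr (W1 W2 W2' : walg R) (t : wmor W2 W2') (z : tens X (wprod W1 W2)) :
  weil W1 -> weil W2 -> weil W2' ->
  iter_tens (tensr X (wprodr W1 t) z) = tensr (tens X W1) t (iter_tens z).
Proof.
move=> w1 w2 w2'; rewrite -{1}(wreprK z) tensr_wpi iter_tensE // /iter_tens tensr_wpi.
apply: wpi_ext => r /=; apply: wpi_ext => s /=.
by rewrite row_mxKl row_mxKr.
Qed.

(** Classes of families correspond through [iter_tens] to elements of a single prolongation of [X],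
    where [tensr_mono] applies. Thus joint injectivity need only be checked on functions of both
    groups of variables. *)
Lemma wpi_iter_mono (W1 W2 : walg R) (J : finType) (D : J -> walg R) (p : forall j, wmor W2 (D j))
    (F G : smap (space (wdim W2)) (tens X W1)) :
  microlinear X -> weil W1 -> weil W2 -> weil (wprod W1 W2) -> (forall j, weil (D j)) ->
  (forall j, weil (wprod W1 (D j))) ->
  (forall c, Cinf c -> (forall j, widl (wprod W1 (D j)) (c \o wprodr W1 (p j))) ->
     widl (wprod W1 W2) c) ->
  (forall j s, F (p j s) = G (p j s)) ->
  wpi (tens X W1) W2 F = wpi (tens X W1) W2 G.
Proof.
move=> mX w1 w2 w12 wD w1D mono FG.
have [zF FE] := iter_tens_surj (wpi (tens X W1) W2 F) w1 w2.
have [zG GE] := iter_tens_surj (wpi (tens X W1) W2 G) w1 w2.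
rewrite -FE -GE; congr iter_tens.
apply: (tensr_mono mX w12 w1D mono) => j.
apply: iter_tens_inj => //; rewrite !iter_tensr // FE GE !tensr_wpi.
by apply: wpi_ext => s /=; rewrite FG.
Qed.

End Exponentiable.

(** * Pseudotangentials *)

Section Infinitesimals.
Context {R : realType}.

Definition scales_map n (r : 'rV[R]_n) (s : seq 'I_n) (d : 'rV[R]_n) : 'rV[R]_n :=
  \row_j if j \in s then r 0 j * d 0 j else d 0 j.

Program Definition wscales n (r : 'rV[R]_n) (s : seq 'I_n) : wmor (cubeW n) (cubeW n) :=
  @wmor_gen _ _ _ (@cube_genC R n) (cubeW n) (scales_map r s) _ _ _.
Next Obligation.
move=> n r s j; under eq_fun do rewrite mxE.
case: (j \in s); last exact: Cinf_coord.
apply: CinfM; [exact: Cinf_cst | exact: Cinf_coord].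
Qed.
Next Obligation. by move=> n r s; apply/rowP => j; rewrite !mxE mulr0 if_same. Qed.
Next Obligation.
move=> n r s _ [j ->].
have -> : (fun d : 'rV[R]_n => d 0 j ^+ 2) \o scales_map r s =
    fun d => (if j \in s then r 0 j ^+ 2 else 1) * d 0 j ^+ 2.
  by apply/funext => d; rewrite /= mxE; case: (j \in s); rewrite ?exprMn ?mul1r.
by apply: (@widlM _ (cubeW n)); [exact: Cinf_cst | exact: cubeW_sqr].
Qed.

Program Definition wincl n l (ln : (l <= n)%N) : wmor (ordW n) (ordW l) :=
  @wmor_gen _ _ _ (@ord_genC R n) (ordW l) id _ _ _.
Next Obligation. by move=> n l _ j; exact: Cinf_coord. Qed.
Next Obligation. by []. Qed.
Next Obligation.
move=> n l ln _ ->.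
have -> : (fun d : 'rV[R]_1 => d 0 0 ^+ n.+1) \o id =
    fun d => d 0 0 ^+ (n - l) * d 0 0 ^+ l.+1.
  by apply/funext => d; rewrite /= -exprD addnS subnK.
by apply: (@widlM _ (ordW l)); [exact/CinfX/Cinf_coord | exact: ordW_exp].
Qed.

Lemma plus_scales n r (d : 'rV[R]_n) : plus_map (scales_map (const_mx r) (enum 'I_n) d) = r *: plus_map d.
Proof.
apply/rowP => j; rewrite !mxE mulr_sumr; apply: eq_bigr => i _.
by rewrite !mxE mem_enum.
Qed.

Lemma ins_del n (d : 'rV[R]_n.+1) : ins_map ord_max (del_map ord_max d) = scale_map 0 ord_max d.
Proof.
apply/rowP => j; rewrite !mxE; case: unliftP => [k ->|->]; first by rewrite mxE eq_sym (negPf (neq_lift _ _)).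
by rewrite eqxx mul0r.
Qed.

Lemma scale_ins n (d : 'rV[R]_n) : scale_map 0 ord_max (ins_map ord_max d) = ins_map ord_max d.
Proof.
apply/rowP => j; rewrite !mxE; case: unliftP => [k ->|->]; first by rewrite eq_sym (negPf (neq_lift _ _)).
by rewrite eqxx mul0r.
Qed.

Lemma del_scale n (d : 'rV[R]_n.+1) : del_map ord_max (scale_map 0 ord_max d) = del_map ord_max d.
Proof. by apply/rowP => j; rewrite !mxE eq_sym (negPf (neq_lift _ _)). Qed.

Lemma plus_ins n (d : 'rV[R]_n) : plus_map (ins_map ord_max d) = plus_map d.
Proof.
apply/rowP => j; rewrite !mxE big_ord_recr /= !mxE unlift_none addr0.
apply: eq_bigr => i _; rewrite !mxE.
have -> : widen_ord (leqnSn n) i = lift ord_max i by apply: val_inj; rewrite /= /bump leqNgt ltn_ord.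
by rewrite liftK.
Qed.

End Infinitesimals.

Section Pseudotangentials.
Context {R : realType} {E M : frolicher R} (p : smap E M) (x : E).

Definition commutes (W : walg R) (nabla : fmap p x W) (t : wmor W W) : Prop :=
  forall g, nabla (fibr _ t g) = fibr _ t (nabla g).

Lemma fibr_comp (X : frolicher R) (y : X) (W W1 W' : walg R) (t1 : wmor W W1) (t1' : wmor W1 W')
    (t : wmor W W') (z : fib W y) : (forall s, t1 (t1' s) = t s) ->
  fibr y t1' (fibr y t1 z) = fibr y t z.
Proof. by move=> tt; apply: fib_ext; exact: tensr_comp. Qed.

Lemma fibr_square (X : frolicher R) (y : X) (W W1 W2 W' : walg R)
    (t1 : wmor W W1) (t1' : wmor W1 W') (t2 : wmor W W2) (t2' : wmor W2 W') (z : fib W y) :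
  (forall s, t1 (t1' s) = t2 (t2' s)) ->
  fibr y t1' (fibr y t1 z) = fibr y t2' (fibr y t2 z).
Proof. by move=> tt; apply: fib_ext; exact: tensr_square. Qed.

Lemma fibr_id (X : frolicher R) (y : X) (W : walg R) (t : wmor W W) (z : fib W y) :
  (forall s, t s = s) -> fibr y t z = z.
Proof. by move=> tt; apply: fib_ext; exact: tensr_id. Qed.

Lemma commutes_scales n (nabla : fmap p x (cubeW n)) (r : 'rV[R]_n) (s : seq 'I_n) :
  uniq s -> (forall alpha i, commutes nabla (wscale alpha i)) -> commutes nabla (wscales r s).
Proof.
move=> us ns; elim: s us => [_|i s IH] /=.
  by move=> g; rewrite !fibr_id // => d; apply/rowP => j; rewrite mxE.
move=> /andP[/negPf is_ us] g.
have sE d : wscale (r 0 i) i (wscales r s d) = wscales r (i :: s) d.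
  apply/rowP => j; rewrite !mxE in_cons; case: eqP => [->|//] /=.
  by rewrite is_.
by rewrite -!(fibr_comp _ sE) IH // ns.
Qed.

Lemma wpi_fmap (W W1 W2 : walg R) (nabla : fmap p x W1) (t : wmor W (wprod W1 W2))
    (tP : wfibred t) (g : fib W (p x)) :
  tensl (sval_smap _) W2 (tensl nabla W2 (fibr_iter tP g)) =
  wpi (tens E W1) W2 (scomp (sval_smap _) (scomp nabla (sfamily tP g))).
Proof. by rewrite /fibr_iter !tensl_wpi; exact: wpi_ext. Qed.

Lemma iter_tensr_wpi (X : frolicher R) (W W1 W2 : walg R) (t : wmor W (wprod W1 W2)) (z : tens X W) f :
  weil_exponentiable X -> weil W1 -> weil W2 -> z = wpi X W f ->
  iter_tens (tensr X t z) = wpi (tens X W1) W2 (scurry (scomp f (wsmap t))).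
Proof. by move=> eX w1 w2 ->; rewrite tensr_wpi iter_tensE. Qed.

(** Both sides are classes of families indexed by a real vector [r]. They agree at every [r], since
    [sfamily] at [r] is the image of [g] under [tr r]. *)
Lemma intertwines_commutes (W W2 : walg R) (t : wmor W (wprod W W2)) (tP : wfibred t)
    (nabla : fmap p x W) (tr : 'rV[R]_(wdim W2) -> wmor W W) :
  weil_exponentiable E -> weil W -> weil W2 ->
  (forall r s, t (row_mx s r) = tr r s) -> (forall r, commutes nabla (tr r)) ->
  intertwines tP nabla nabla.
Proof.
move=> eE w w2 trE nt g; rewrite wpi_fmap.
rewrite (iter_tensr_wpi t eE w w2 (esym (wreprK _))); apply: wpi_ext => r.
have gr : sfamily tP g r = fibr _ (tr r) g.
  by apply: fib_ext; apply: wpi_ext => s /=; rewrite trE.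
transitivity (sval (nabla (sfamily tP g r))) => //.
by rewrite gr nt; apply: wpi_ext => s /=; rewrite trE.
Qed.

Lemma plus_tens_mono (X : frolicher R) n (z z' : tens X (ordW n)) : microlinear X ->
  tensr X (wplus n) z = tensr X (wplus n) z' -> z = z'.
Proof.
move=> mX zz'; apply: (@tensr_mono R X _ unit _ (fun=> wplus n)) => //.
- exact: weil_ordW.
- by move=> _; exact: weil_cubeW.
- by move=> c Cc /(_ tt); exact: plus_mono.
Qed.

Lemma is_psi_exists n (nabla : fmap p x (cubeW n)) : microlinear E ->
  (forall sigma, commutes nabla (wperm sigma)) -> exists psi, is_psi nabla psi.
Proof.
move=> mE ns.
(* The diagram has two copies of [cubeW n] and an arrow for each permutation; the identity among
   them makes the two components equal. *)
pose D (b : bool) : walg R := cubeW n.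
pose a (sigma : {perm 'I_n}) : wmor (D true) (D false) := wperm sigma.
pose P (b : bool) : wmor (ordW n) (D b) := wplus n.
have plus_perm (sigma : 'S_n) (s : 'rV[R]_n) : plus_map (perm_map sigma s) = plus_map s.
  apply/rowP => j; rewrite !mxE [RHS](reindex_inj (@perm_inj _ sigma)).
  by apply: eq_bigr => i _; rewrite mxE.
have II := widlP (cubeW n : walg R).
have lim : @alg_limit R bool {perm 'I_n} (fun=> true) (fun=> false) D a (ordW n) P.
  split.
  - move=> sigma b Cb /=; have := ideal0 II; congr widl; apply/funext => s.
    by rewrite plus_perm subrr.
  - move=> b Cb be; have [c Cc cE] := plus_equalizer (Cb true) be.
    exists c => // -[] //=.
    apply: (cong_trans II cE); apply: (cong_trans II (cong_sym II (be 1%g))).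
    rewrite /cong; have := ideal0 II; congr widl; apply/funext => s.
    rewrite /= (_ : perm_map 1%g s = s) ?subrr //.
    by apply/rowP => i; rewrite mxE perm1.
  - by move=> c Cc /(_ true); exact: plus_mono.
have [_ /(_ (fib (ordW n) (p x)))] := mE _ _ _ _ _ _ _ _ (fun=> @weil_cubeW R n) (@weil_ordW R n) lim.
pose q (b : bool) : smap (fib (ordW n) (p x)) (tens E (D b)) :=
  scomp (sval_smap _) (scomp nabla (fibr _ (wplus n))).
move=> /(_ q) [|u [uq _]].
  move=> sigma g; rewrite /q /=.
  have -> : tensr_fun (a sigma) (sval (nabla (fibr (p x) (wplus n) g))) =
     sval (fibr x (wperm sigma) (nabla (fibr _ (wplus n) g))) by [].
  rewrite -ns; congr (sval (nabla _)).
  by apply: fibr_comp => s; exact: plus_perm.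
(* The limit only gives values in [tens E (ordW n)]; they lie in the fibre because [wplus] preserves
   [base]. *)
have ux g : base (u g) = x.
  rewrite -(base_tensr (wplus n)) (uq true) /q /=.
  exact: (proj2_sig (nabla (fibr _ (wplus n) g))).
exists (srestr ux) => g; split.
  by apply: fib_ext; rewrite [RHS](uq true).
move=> g' /(congr1 sval) gE; apply: fib_ext; apply: plus_tens_mono => //.
by rewrite [LHS](uq true).
Qed.

Section Psi.
Variables (n : nat) (nabla : fmap p x (cubeW n)) (psi : fmap p x (ordW n)).
Hypothesis psiP : is_psi nabla psi.

Lemma is_psiE g : nabla (fibr _ (wplus n) g) = fibr _ (wplus n) (psi g).
Proof. by case: (psiP g). Qed.

Lemma is_psi_uniq g g' : nabla (fibr _ (wplus n) g) = fibr _ (wplus n) g' -> psi g = g'.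
Proof. by case: (psiP g) => _; apply. Qed.

Lemma psi_pseudotangential : microlinear M -> weil_exponentiable E ->
  cube_pseudotangential nabla -> ord_pseudotangential psi.
Proof.
move=> mM eE [n1 n2 _ _].
have psiZ alpha : commutes psi (woscale n alpha).
  move=> g; apply: is_psi_uniq.
  (* Stated for a space with a chosen element, so as to serve over both [M] and [E]. *)
  have sE (y : {X : frolicher R & X}) (z : fib (ordW n) (projT2 y)) :
     fibr (projT2 y) (wplus n) (fibr _ (woscale n alpha) z) =
     fibr _ (wscales (const_mx alpha) (enum 'I_n)) (fibr _ (wplus n) z).
    by apply: fibr_square => s; rewrite /= plus_scales.
  rewrite (sE (existT _ M (p x))) commutes_scales //; last exact: enum_uniq.
  by rewrite is_psiE (sE (existT _ E x)).
split=> //.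
  move=> g; apply: plus_tens_mono => //.
  rewrite -tensl_tensr.
  have -> : tensr E (wplus n) (sval (psi g)) = sval (fibr x (wplus n) (psi g)) by [].
  by rewrite -is_psiE n1.
move=> m; apply: (@intertwines_commutes _ _ _ (@wmul_fibred R n m) psi (fun r => woscale n (r 0 0))) => //.
- exact: weil_ordW.
- exact: weil_ordW.
- move=> r s; apply/rowP => j; rewrite mxE /= row_mxKl row_mxKr mxE ord1.
  by rewrite mulrC.
Qed.

End Psi.
End Pseudotangentials.

(** * Projections to lower order *)

Section Projections.
Context {R : realType} {E M : frolicher R} (p : smap E M) (x : E).

Lemma cube_projE n (nabla : fmap p x (cubeW n.+1)) g :
  cube_proj nabla g = fibr _ (wins ord_max) (nabla (fibr _ (wdel ord_max) g)).
Proof. by []. Qed.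

Section CubeProj.
Variables (n : nat) (nabla : fmap p x (cubeW n.+1)).
Hypothesis nabla0 : commutes nabla (wscale 0 ord_max).

(** Deleting the last coordinate and inserting 0 amounts to scaling it by 0, with which [nabla]
    commutes. *)
Lemma cube_proj_ins g :
  fibr _ (wins ord_max) (nabla g) = cube_proj nabla (fibr _ (wins ord_max) g).
Proof.
rewrite cube_projE (fibr_comp (t := wscale 0 ord_max)); last exact: ins_del.
rewrite nabla0 (fibr_comp (t := wins ord_max)) //; exact: scale_ins.
Qed.

Lemma cube_proj_del g :
  nabla (fibr _ (wdel ord_max) g) = fibr _ (wdel ord_max) (cube_proj nabla g).
Proof.
rewrite cube_projE (fibr_comp (t := wscale 0 ord_max)); last exact: ins_del.
by rewrite -nabla0 (fibr_comp (t := wdel ord_max)) //; exact: del_scale.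
Qed.

End CubeProj.

Lemma cube_tangential_pseudo n (nabla : fmap p x (cubeW n)) :
  cube_tangential nabla -> cube_pseudotangential nabla.
Proof. by case: n nabla => [|n] nabla //= []. Qed.

Lemma cube_tangential_scale n (nabla : fmap p x (cubeW n)) :
  cube_tangential nabla -> forall alpha i, commutes nabla (wscale alpha i).
Proof. by move=> /cube_tangential_pseudo[]. Qed.

Lemma cube_tangential_proj n (nabla : fmap p x (cubeW n.+1)) :
  cube_tangential nabla -> cube_tangential (cube_proj nabla).
Proof.
case: n nabla => [|n] nabla [[n1 n2 n3 n4] nt]; last by case: nt.
(* At order 1 the definition says nothing about the projection to order 0. There are no coordinates
   at order 0, so only the condition of lying over [g] has content. *)
split=> [g|alpha []//|m []//|sigma g]; last first.
  by rewrite !fibr_id // => s; apply/rowP => -[].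
rewrite /=.
  have -> : tensl_fun p (tensr_fun (wins ord_max)
     (sval (nabla (fibr (p x) (wdel ord_max) g)))) =
     tensr M (wins ord_max) (tensl p _ (sval (nabla (fibr (p x) (wdel ord_max) g)))).
    by rewrite -tensl_tensr.
  rewrite n1; apply: etrans (tensr_comp (t := wid _) _ _) _; last exact: tensr_id.
  by move=> s; apply/rowP => -[].
Qed.

(** Setting the last coordinate to 0 turns the sum of n+1 coordinates into that of n, so [psi'] is
    the truncation of [psi]. *)
Lemma psi_incl n (nabla : fmap p x (cubeW n.+1)) psi psi' g :
  cube_tangential nabla -> is_psi nabla psi -> is_psi (cube_proj nabla) psi' ->
  psi' (fibr _ (wincl (leqnSn n)) g) = fibr _ (wincl (leqnSn n)) (psi g).
Proof.
move=> /cube_tangential_scale ns psiP psiP'; apply: (is_psi_uniq psiP').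
have pE (X : frolicher R) (y : X) (z : fib (ordW n.+1) y) :
    fibr y (wplus n) (fibr y (wincl (leqnSn n)) z) =
    fibr y (wins ord_max) (fibr y (wplus n.+1) z).
  by apply: fibr_square => s; rewrite /= plus_ins.
by rewrite !pE -cube_proj_ins // (is_psiE psiP).
Qed.

(* The class in [X (x) W_(D_(n+1))] depends on the chosen representative. *)
Definition lift_fib (X : frolicher R) (y : X) n (z : fib (ordW n) y) : fib (ordW n.+1) y :=
  exist _ (wpi X (ordW n.+1) (wrepr (sval z)))
    (etrans (base_pi (W := ordW n.+1) _) (proj2_sig z)).

Lemma lift_fibK (X : frolicher R) (y : X) n (z : fib (ordW n) y) :
  fibr y (wincl (leqnSn n)) (lift_fib z) = z.
Proof.
apply: fib_ext; rewrite /= -[RHS]wreprK; apply: etrans (tensr_wpi _ _) _.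
exact: wpi_ext.
Qed.

(** At a real value r of the second factor, multiplication scales a representative of [g] by r. The
    intertwining thus reduces to the homogeneity of [psi] on a lift [h] of [g]. *)
Lemma psi_ord_proj n (nabla : fmap p x (cubeW n.+1)) psi psi' :
  microlinear M -> weil_exponentiable E ->
  cube_tangential nabla -> is_psi nabla psi -> is_psi (cube_proj nabla) psi' ->
  is_ord_proj psi psi'.
Proof.
move=> mM eE nt psiP psiP'.
have nt' := cube_tangential_proj nt.
split; first exact: psi_pseudotangential (cube_tangential_pseudo nt').
have [_ psiZ _] := psi_pseudotangential psiP mM eE (cube_tangential_pseudo nt).
move=> g; rewrite wpi_fmap.
set h := lift_fib g.
(* By [psi_incl] the value [psi' g] is the truncation of [psi h], so both have a common
   representative. *)
have -> : sval (psi' g) = wpi E (ordW n) (wrepr (sval (psi h))).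
  rewrite -(lift_fibK g) (psi_incl _ nt psiP psiP') /= -[X in tensr_fun _ X]wreprK.
  by apply: etrans (tensr_wpi _ _) _; exact: wpi_ext.
rewrite (iter_tensr_wpi _ eE _ _ erefl); [|exact: weil_ordW..].
apply: wpi_ext => r.
have gr : sfamily (@wmul'_fibred R n) g r = fibr _ (woscale n.+1 (r 0 0)) h.
  apply: fib_ext; apply: esym; apply: etrans (tensr_wpi _ _) _; apply: wpi_ext => s /=.
  congr (sfun _ _); apply/rowP => j.
  by rewrite [LHS]mxE [RHS]mxE ord1 row_mxKl row_mxKr mulrC.
transitivity (sval (psi (sfamily (@wmul'_fibred R n) g r))) => //.
rewrite gr psiZ; apply: wpi_ext => s /=.
congr (sfun _ _); apply/rowP => j.
by rewrite [LHS]mxE [RHS]mxE ord1 row_mxKl row_mxKr mulrC.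
Qed.

(** The order indexes the type, and a relation avoids transport along equalities between orders. *)
Inductive cube_projs : forall n k, fmap p x (cubeW n) -> fmap p x (cubeW k) -> Prop :=
| cube_projs0 n (nabla : fmap p x (cubeW n)) : cube_projs nabla nabla
| cube_projsS n k (nabla : fmap p x (cubeW n.+1)) (nabla' : fmap p x (cubeW k)) :
    cube_projs (cube_proj nabla) nabla' -> cube_projs nabla nabla'.

Lemma cube_projs_leq n k (nabla : fmap p x (cubeW n)) (nabla' : fmap p x (cubeW k)) :
  cube_projs nabla nabla' -> (k <= n)%N.
Proof. by elim=> // m l _ _ _; exact: leqW. Qed.

Lemma cube_projs_exists n k (nabla : fmap p x (cubeW n)) : (k <= n)%N ->
  exists nabla' : fmap p x (cubeW k), cube_projs nabla nabla'.
Proof.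
elim: n nabla => [|n IH] nabla; rewrite leq_eqVlt.
  by rewrite ltn0 orbF => /eqP E0; subst k; exists nabla; exact: cube_projs0.
move=> /predU1P[E0|]; first by subst k; exists nabla; exact: cube_projs0.
rewrite ltnS => /(IH (cube_proj nabla))[nabla' H]; exists nabla'.
exact: cube_projsS.
Qed.

Lemma cube_projs_trans n k l (nabla : fmap p x (cubeW n)) (nabla' : fmap p x (cubeW k))
    (nabla'' : fmap p x (cubeW l)) :
  cube_projs nabla nabla' -> cube_projs nabla' nabla'' -> cube_projs nabla nabla''.
Proof. by elim=> // m j f f' _ IH H; apply: cube_projsS; exact: IH. Qed.

Lemma cube_projs_tangential n k (nabla : fmap p x (cubeW n)) (nabla' : fmap p x (cubeW k)) :
  cube_projs nabla nabla' -> cube_tangential nabla -> cube_tangential nabla'.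
Proof.
elim=> // m j f f' _ IH nt; apply: IH.
exact: cube_tangential_proj.
Qed.

(** Each intermediate projection is tangential and has its own map given by [is_psi_exists];
    consecutive ones are linked by [psi_ord_proj]. *)
Lemma is_psi_projs n k (nabla : fmap p x (cubeW n)) (nabla' : fmap p x (cubeW k)) :
  microlinear E -> microlinear M -> weil_exponentiable E ->
  cube_projs nabla nabla' -> cube_tangential nabla ->
  forall psi psi', is_psi nabla psi -> is_psi nabla' psi' -> is_ord_projs psi psi'.
Proof.
move=> mE mM eE; elim=> {n k nabla nabla'} [n nabla _ psi psi' psiP psiP'|].
  have -> : psi' = psi; last exact: ord_projs0.
  apply: smap_ext => g; apply: (is_psi_uniq psiP'); exact: (is_psiE psiP).
move=> n k nabla nabla' _ IH nt psi psi' psiP psiP'.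
have nt1 := cube_tangential_proj nt.
have [_ _ _ n4] := cube_tangential_pseudo nt1.
have [psi1 psi1P] := is_psi_exists mE n4.
apply: (ord_projsS (psi_ord_proj mM eE nt psiP psi1P)).
exact: IH.
Qed.

(** Setting the last coordinate to 0 sends f (d_1 + ... + d_(n+1)) to f (d_1 + ... + d_n). The same
    [f] and [F] serve at all orders, so the relation descends. *)
Lemma psi_plus_projs n k (nabla : fmap p x (cubeW n)) (nabla' : fmap p x (cubeW k))
   (f : smap (space 1) M) (F : smap (space 1) E) g G g' G' :
  cube_projs nabla nabla' -> cube_tangential nabla ->
  sval g = wpi M (cubeW n) (scomp f (wsmap (wplus n))) ->
  sval G = wpi E (cubeW n) (scomp F (wsmap (wplus n))) ->
  sval g' = wpi M (cubeW k) (scomp f (wsmap (wplus k))) ->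
  sval G' = wpi E (cubeW k) (scomp F (wsmap (wplus k))) ->
  nabla g = G -> nabla' g' = G'.
Proof.
move=> H; elim: H g G g' G' => {n k nabla nabla'} [n nabla|n k nabla nabla' _ IH] g G g' G' nt gE GE g'E G'E nE.
  by rewrite (_ : g' = g) ?nE; apply: fib_ext; rewrite ?gE ?GE.
have ns := cube_tangential_scale nt.
apply: (IH (fibr _ (wins ord_max) g) (fibr _ (wins ord_max) G) g' G') => //.
- exact: cube_tangential_proj.
- rewrite /= gE; apply: etrans (tensr_wpi _ _) _; apply: wpi_ext => s /=.
  by rewrite plus_ins.
- rewrite /= GE; apply: etrans (tensr_wpi _ _) _; apply: wpi_ext => s /=.
  by rewrite plus_ins.
- by rewrite -cube_proj_ins // nE.
Qed.

End Projections.

(** * Tangentials *)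

Section Blocks.
Context {R : realType}.

(* [(d_1, ..., d_n) |-> (d_(B_1), ..., d_(B_k))] for the disjoint blocks
   [B_j = tau^-1 (Some j)]; indices sent to [None] are dropped. *)
Definition block_map n k (tau : 'I_n -> option 'I_k) (d : 'rV[R]_n) : 'rV[R]_k :=
  \row_j \prod_(i | tau i == Some j) d 0 i.

(** An empty block would contribute the constant 1, and the substitution would not fix 0. *)
Definition covers n k (tau : 'I_n -> option 'I_k) := forall j, exists i, tau i = Some j.

Program Definition wblock n k (tau : 'I_n -> option 'I_k) (tauP : covers tau) :
    wmor (cubeW k) (cubeW n) :=
  @wmor_gen _ _ _ (@cube_genC R k) (cubeW n) (block_map tau) _ _ _.
Next Obligation.
move=> n k tau _ j; under eq_fun do rewrite mxE.
have -> : (fun d : 'rV[R]_n => \prod_(i | tau i == Some j) d 0 i) =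
    setmon [set i | tau i == Some j]%SET.
  by apply/funext => d; apply: eq_bigl => i; rewrite inE.
exact: Cinf_setmon.
Qed.
Next Obligation.
move=> n k tau tauP; apply/rowP => j; rewrite !mxE.
by have [i /eqP ij] := tauP j; rewrite (bigD1 i) //= mxE mul0r.
Qed.
Next Obligation.
move=> n k tau tauP _ [j ->]; have [i /eqP ij] := tauP j.
have -> : (fun d : 'rV[R]_k => d 0 j ^+ 2) \o block_map tau =
    fun d => setmon [set i' | (tau i' == Some j) && (i' != i)]%SET d ^+ 2 * d 0 i ^+ 2.
  apply/funext => d; rewrite /= mxE (bigD1 i) //= exprMn mulrC; congr (_ ^+ 2 * _).
  by apply: eq_bigl => i'; rewrite inE.
apply: (@widlM _ (cubeW n)); last exact: cubeW_sqr.
exact/CinfX/Cinf_setmon.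
Qed.

Lemma block_perm n k (tau : 'I_n -> option 'I_k) (sigma : 'S_n) d :
  block_map (tau \o sigma) (perm_map sigma d) = block_map tau d.
Proof.
apply/rowP => j; rewrite !mxE [RHS](reindex_inj (@perm_inj _ sigma)).
by apply: eq_bigr => i _; rewrite mxE.
Qed.

Lemma block_del n k (tau : 'I_n.+1 -> option 'I_k) d : tau ord_max = None ->
  block_map tau d = block_map (tau \o lift ord_max) (del_map ord_max d).
Proof.
move=> tmax; apply/rowP => j; rewrite !mxE.
rewrite big_mkcond big_ord_recr /= tmax mulr1 [RHS]big_mkcond.
apply: eq_bigr => i _; rewrite mxE.
by have -> : widen_ord (leqnSn n) i = lift ord_max i by apply: val_inj; rewrite /= /bump leqNgt ltn_ord.
Qed.

(** When the last two coordinates share a block, or are both dropped, their product can be formed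
    first. *)
Lemma block_kappa n k (tau : 'I_n.+2 -> option 'I_k) d :
  tau ord_max = tau (widen_ord (leqnSn _) ord_max) ->
  block_map tau d = block_map (tau \o widen_ord (leqnSn _)) (kappa_map d).
Proof.
move=> tmax; apply/rowP => j; rewrite !mxE.
rewrite big_mkcond 2!big_ord_recr /= tmax [RHS]big_mkcond big_ord_recr /=.
rewrite -mulrA; congr (_ * _); last first.
  by rewrite mxE eqxx; case: ifP => _; rewrite ?mulr1.
apply: eq_bigr => i _; rewrite mxE /=.
by rewrite eqSS ltn_eqF.
Qed.

Lemma covers_perm n k (tau : 'I_n -> option 'I_k) (sigma : 'S_n) :
  covers tau -> covers (tau \o sigma).
Proof. by move=> tauP j; have [i ij] := tauP j; exists (sigma^-1%g i); rewrite /= permKV. Qed.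

Lemma covers_del n k (tau : 'I_n.+1 -> option 'I_k) : tau ord_max = None ->
  covers tau -> covers (tau \o lift ord_max).
Proof.
move=> tmax tauP j; have [i ij] := tauP j.
case: (unliftP ord_max i) ij => [i' -> ij|->]; first by exists i'.
by rewrite tmax.
Qed.

Lemma covers_kappa n k (tau : 'I_n.+2 -> option 'I_k) :
  tau ord_max = tau (widen_ord (leqnSn _) ord_max) ->
  covers tau -> covers (tau \o widen_ord (leqnSn _)).
Proof.
move=> tmax tauP j; have [i ij] := tauP j.
case: (unliftP ord_max i) ij => [i' -> ij|-> ij]; last by exists ord_max; rewrite /= -tmax.
exists i' => /=; rewrite -ij; congr tau; apply: val_inj.
by rewrite /= /bump leqNgt ltn_ord.
Qed.

Lemma covers_bij n (tau : 'I_n -> option 'I_n) : covers tau ->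
  exists sigma : 'S_n, forall i, tau i = Some (sigma i).
Proof.
move=> tauP; pose h j := sval (cid (tauP j)).
have hE j : tau (h j) = Some j by rewrite /h; case: cid.
have h_inj : injective h by move=> i j /(congr1 tau); rewrite !hE => -[].
exists (perm h_inj)^-1%g => i.
by rewrite -{1}(permKV (perm h_inj) i) permE hE.
Qed.

Lemma covers_noninj n k (tau : 'I_n.+1 -> option 'I_k) : (k <= n)%N ->
  (forall i, tau i != None) -> exists i1 i2, i1 != i2 /\ tau i1 = tau i2.
Proof.
move=> kn tauN; have [/injectiveP inj|/injectivePn[i1 [i2 ne eq]]] := boolP (injectiveb tau); last first.
  by exists i1, i2.
have : (#|'I_n.+1| <= #|[set~ (None : option 'I_k)]%SET|)%N.
  rewrite -(card_imset _ inj); apply/subset_leq_card/fintype.subsetP => y /imsetP[i _ ->].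
  by rewrite !inE.
by rewrite cardsC1 card_option !card_ord /= ltnNge kn.
Qed.

Section Tangential.
Context {E M : frolicher R} (p : smap E M) (x : E).

Lemma fibr_ext (X : frolicher R) (y : X) (W W' : walg R) (t t' : wmor W W') (z : fib W y) :
  (forall s, t s = t' s) -> fibr y t z = fibr y t' z.
Proof. by move=> tt'; apply: fib_ext; apply: wpi_ext => s /=; rewrite tt'. Qed.

Definition block_natural n k (nabla : fmap p x (cubeW n)) (nabla' : fmap p x (cubeW k))
    (tau : 'I_n -> option 'I_k) :=
  forall (tauP : covers tau) g,
    nabla (fibr _ (wblock tauP) g) = fibr _ (wblock tauP) (nabla' g).

Lemma block_natural_perm n k (nabla : fmap p x (cubeW n)) (nabla' : fmap p x (cubeW k))
    (tau : 'I_n -> option 'I_k) (sigma : 'S_n) :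
  commutes nabla (wperm sigma) ->
  block_natural nabla nabla' (tau \o sigma) -> block_natural nabla nabla' tau.
Proof.
move=> ns nt tauP g; have tauP' := covers_perm sigma tauP.
have tE s : wblock tauP' (wperm sigma s) = wblock tauP s by exact: block_perm.
by rewrite -!(fibr_comp _ tE) ns nt.
Qed.

(** Induction on the number of projections; without any, the blocks are singletons and form a
    permutation. Otherwise a dropped index is moved to the end and deleted; if none is dropped, two
    indices share a block by the pigeonhole principle, and they are moved to the last two places and
    multiplied by kappa. *)
Lemma tangential_block n k (nabla : fmap p x (cubeW n)) (nabla' : fmap p x (cubeW k)) :
  cube_projs nabla nabla' -> cube_tangential nabla ->
  forall tau, block_natural nabla nabla' tau.
Proof.
elim=> {n k nabla nabla'} [n nabla|n k nabla nabla' proj IH] nt tau.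
  move=> tauP g; have [sigma sE] := covers_bij tauP.
  have tE s : wblock tauP s = wperm sigma^-1%g s.
    apply/rowP => j; rewrite !mxE (big_pred1 (sigma^-1%g j)) // => i.
    rewrite sE /=; apply/eqP/eqP => [[<-]|->]; first by rewrite permK.
    by rewrite permKV.
  have [_ _ _ ns] := cube_tangential_pseudo nt.
  by rewrite !(fibr_ext _ tE) ns.
have kn := cube_projs_leq proj.
have [_ _ _ ns] := cube_tangential_pseudo nt.
have sc := cube_tangential_scale nt.
have {}IH := IH (cube_tangential_proj nt).
have [/existsP[i0 /eqP i0N]|/existsPn tauN] := boolP [exists i, tau i == None].
  apply: (@block_natural_perm _ _ _ _ _ (tperm i0 ord_max)) => // tauP g.
  have tmax : (tau \o tperm i0 ord_max) ord_max = None by rewrite /= tpermR.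
  have tE s : wblock (covers_del tmax tauP) (wdel ord_max s) = wblock tauP s.
    by rewrite /= -block_del.
  by rewrite -!(fibr_comp _ tE) cube_proj_del // IH.
have [i1 [i2 [i12 tau12]]] := covers_noninj kn tauN.
apply: (@block_natural_perm _ _ _ _ _ (tperm i1 ord_max)) => //.
set tau1 := tau \o _.
pose i3 := tperm i1 ord_max i2.
have i3max : i3 != ord_max.
  apply/eqP => /(congr1 (tperm i1 ord_max)); rewrite /i3 tpermK tpermR => i21.
  by rewrite i21 eqxx in i12.
have tau13 : tau1 i3 = tau1 ord_max by rewrite /tau1 /i3 /= tpermK tpermR.
(* Two distinct indices force order at least 2, from which on the definition includes the condition
   on kappa. *)
case: n nabla proj IH kn nt ns sc tau tauN i1 i2 i12 tau12 tau1 i3 i3max tau13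
  => [|n] nabla proj IH kn nt ns sc tau tauN i1 i2 i12 tau12 tau1 i3 i3max tau13.
  by rewrite [i3]ord1 [ord_max]ord1 eqxx in i3max.
pose pen := widen_ord (leqnSn _) (ord_max : 'I_n.+1).
have penmax : pen != ord_max by rewrite -val_eqE /= ltn_eqF.
apply: (@block_natural_perm _ _ _ _ _ (tperm i3 pen)) => // tauP g.
have tmax : (tau1 \o tperm i3 pen) ord_max = (tau1 \o tperm i3 pen) pen.
  by rewrite /comp tpermD // tpermR tau13.
have tE s : wblock (covers_kappa tmax tauP) (wkappa _ s) = wblock tauP s.
  by rewrite /= -block_kappa.
have [_ /(_ isT)[_ nk]] := nt.
by rewrite -!(fibr_comp _ tE) nk IH.
Qed.

End Tangential.
End Blocks.

(** * Sums of products of coordinates weighted by parameters *)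

Section Core.
Context {R : realType}.

Section PolyDim.
Variables (n l : nat) (rho : {poly R}).
Hypothesis rho_dvd : 'X^(n.+1) %| rho ^+ l.+1.

(** The coefficient of degree v (l + 1) in rho^(l + 1) is a power of the lowest nonzero coefficient
    of [rho], so this degree exceeds n. *)
Lemma poly_order v : rho`_v != 0 -> (forall i, (i < v)%N -> rho`_i = 0) ->
  (n < v * l.+1)%N.
Proof.
move=> rv rlt; rewrite ltnNge; apply/negP => vn.
have rE : rho = drop_poly v rho * 'X^v.
  rewrite -{1}(poly_take_drop v rho) (_ : take_poly v rho = 0) ?add0r //.
  apply/polyP => i; rewrite coef_take_poly coef0; case: ltnP => // iv; exact: rlt.
move: rho_dvd => /Pdiv.Field.dvdpP[q qE].
have := congr1 (fun p : {poly R} => p`_(v * l.+1)) qE.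
rewrite coefMXn ltnS vn rE exprMn -exprM coefMXn ltnn subnn => /eqP.
by rewrite -horner_coef0 horner_exp expf_eq0 horner_coef0 coef_drop_poly add0n (negPf rv).
Qed.

(** For v the lowest degree occurring in [rho], the k disjoint blocks have at least v elements each,
    whence v k <= n < v (l + 1). *)
Lemma poly_dim_card k (B : 'I_k -> {set 'I_n}) (tau : 'I_n -> option 'I_k) :
  (forall j, rho`_(#|B j|) != 0) -> (forall i j, (tau i == Some j) = (i \in B j)) -> (k <= l)%N.
Proof.
move=> rB tauE; rewrite leqNgt; apply/negP => lk.
have j0 : 'I_k by exists l.
have ex : exists v, rho`_v != 0 by exists #|B j0|.
have [v rv vmin] := ex_minnP ex.
have rlt i : (i < v)%N -> rho`_i = 0.
  by move=> iv; apply/eqP; apply: contraTT iv => /vmin; rewrite -leqNgt.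
have := poly_order rv rlt; rewrite ltnNge => /negP; apply.
apply: (@leq_trans (v * k)%N); first by rewrite leq_mul2l lk orbT.
apply: (@leq_trans (\sum_(j < k) #|B j|)%N).
  rewrite mulnC -[X in (X * _)%N]card_ord -sum_nat_const; apply: leq_sum => j _.
  exact: vmin.
rewrite (eq_bigr (fun j => \sum_(i < n) (tau i == Some j))%N); last first.
  move=> j _; rewrite -sum1_card big_mkcond; apply: eq_bigr => i _.
  by rewrite tauE; case: (i \in B j).
rewrite exchange_big /= -[leqRHS]card_ord -sum1_card; apply: leq_sum => i _.
case: (tau i) => [j|]; last by rewrite big1.
rewrite (bigD1 j) //= eqxx big1 // => j' j'j.
by rewrite (_ : Some j == Some j' = false) //; apply/eqP => -[E]; rewrite E eqxx in j'j.
Qed.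

End PolyDim.

(** ['X] divides [rho], so n is among the exponents over which [l] is minimal. *)
Lemma simple_poly_dim n l (rho : {poly R}) : simple_poly rho -> poly_dim n rho l -> (l <= n)%N.
Proof.
move=> [rho0 _] [_]; apply.
have rE : rho = drop_poly 1 rho * 'X^1.
  rewrite -{1}(poly_take_drop 1 rho) (_ : take_poly 1 rho = 0) ?add0r //.
  apply/polyP => i; rewrite coef_take_poly coef0; case: ltnP => //.
  by rewrite ltnS leqn0 => /eqP ->.
by rewrite rE exprMn -exprM mul1n dvdp_mull.
Qed.

Variable n : nat.
Let N := #|{set 'I_n}|.
Let st (a : 'I_N) : {set 'I_n} := enum_val a.

Definition overlap (a b : 'I_#|{set 'I_n}|) : bool := ~~ [disjoint st a & st b].

(** The point t_S = r_S. The empty set gets 0 instead of the empty product 1, because the map has to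
    fix 0; its coefficient vanishes by [c0]. *)
Definition power_map (r : 'rV[R]_n) : 'rV[R]_#|{set 'I_n}| :=
  \row_a if st a == finset.set0 then 0 else setmon (st a) r.

Program Definition wpower : wmor (conflictW overlap) (cubeW n) :=
  @wmor_gen _ _ _ (@conflict_genC R N overlap) (cubeW n) power_map _ _ _.
Next Obligation.
move=> a; under eq_fun do rewrite mxE.
by case: (st a == _); [exact: Cinf_cst | exact: Cinf_setmon].
Qed.
Next Obligation.
apply/rowP => a; rewrite !mxE; case: eqP => // /eqP/finset.set0Pn[i ia].
by rewrite (setmonD1 _ ia) mxE mul0r.
Qed.
Next Obligation.
move=> _ [a [b [ab ->]]]; have II := widlP (cubeW n : walg R).
have z0 (f : 'rV[R]_n -> R) : (forall r, f r = 0) -> widl (cubeW n) f.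
  by move=> f0; have := ideal0 II; congr widl; apply/funext => r; rewrite f0.
have [a0|a0] := eqVneq (st a) finset.set0.
  by apply: z0 => r; rewrite /= mxE a0 eqxx mul0r.
have [b0|b0] := eqVneq (st b) finset.set0.
  by apply: z0 => r; rewrite /= [X in _ * X]mxE b0 eqxx mulr0.
(* Nonempty sets that coincide or overlap share an index, whose square divides the product of their
   monomials. *)
have [i ia ib] : exists2 i, i \in st a & i \in st b.
  move: ab => /orP[/eqP <-|]; first by have /finset.set0Pn[i ia] := a0; exists i.
  by rewrite /overlap => /pred0Pn[i /andP[]]; exists i.
have := idealM II (CinfM (Cinf_setmon (st a :\ i)%SET) (Cinf_setmon (st b :\ i)%SET)) (@cubeW_sqr R n i).
congr widl; apply/funext => r; rewrite /= !mxE (negPf a0) (negPf b0).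
by rewrite (setmonD1 r ia) (setmonD1 r ib); ring.
Qed.

Variable c : 'I_N -> R.
Hypothesis c0 : forall a, st a = finset.set0 -> c a = 0.

(* [(d, t) |-> sum_S t_S c_S d_S] *)
Definition param_map (v : 'rV[R]_(n + N)) : 'rV[R]_1 :=
  const_mx (\sum_a rsubmx v 0 a * (c a * setmon (st a) (lsubmx v))).

Lemma Cinf_param_map : Cinf_map param_map.
Proof.
move=> j; under eq_fun do rewrite mxE.
apply: Cinf_sum => a; apply: CinfM; first exact: Cinf_rsub.
apply: CinfM; first exact: Cinf_cst.
exact: (Cinf_comp (Cinf_setmon _) (@Cinf_map_lsub _ _ _)).
Qed.

Lemma param_map0 t : param_map (row_mx 0 t) = 0.
Proof.
apply/rowP => j; rewrite [LHS]mxE [RHS]mxE big1 // => a _; rewrite row_mxKl.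
have [/c0 ->|/finset.set0Pn[i ia]] := eqVneq (st a) finset.set0; first by rewrite mul0r mulr0.
by rewrite (setmonD1 _ ia) [(0 : 'rV[R]_n) 0 i]mxE mul0r !mulr0.
Qed.

(** r_S d_S is the product of the r_i d_i over S, and the empty set contributes 0 on both sides. *)
Lemma param_power r d :
  param_map (row_mx d (power_map r)) = param_map (row_mx (scales_map r (enum 'I_n) d) (const_mx 1)).
Proof.
apply/rowP => j; rewrite [LHS]mxE [RHS]mxE !row_mxKl !row_mxKr; apply: eq_bigr => a _.
rewrite !mxE mul1r; case: eqP => [/c0 ->|_]; first by rewrite !mul0r.
rewrite mulrCA; congr (_ * _); rewrite /setmon -big_split; apply: eq_bigr => i _.
by rewrite mxE mem_enum.
Qed.

Section Family.
Variables (X : frolicher R) (f : smap (space 1) X).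

Definition param_fam : smap (space (wdim (conflictW overlap : walg R))) (tens X (cubeW n)) :=
  scurry (W1 := cubeW n) (W2 := conflictW overlap) (scomp f (Smap (smooth_Cinf_map Cinf_param_map))).

Lemma base_param_fam t : base (param_fam t) = f 0.
Proof. by apply: etrans (base_pi _) _; rewrite /= param_map0. Qed.

Lemma param_fam_power r :
  param_fam (power_map r) = tensr X (wscales r (enum 'I_n)) (param_fam (const_mx 1)).
Proof.
apply: esym; apply: etrans (tensr_wpi _ _) _; apply: wpi_ext => s /=.
by rewrite param_power.
Qed.

End Family.

Section Scaling.
Variables (X : frolicher R).
Hypotheses (mX : microlinear X) (eX : weil_exponentiable X).

(** The scalings r |-> r z form the curried substitution of the coordinatewise product, which moves
    the family into a single prolongation. *)
Lemma wpi_scales (H : smap (space n) (tens X (cubeW n))) z :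
  (forall r, H r = tensr X (wscales r (enum 'I_n)) z) ->
  wpi (tens X (cubeW n)) (cubeW n) H = iter_tens (tensr X (wsprod n) z).
Proof.
move=> HE; rewrite (iter_tensr_wpi _ eX _ _ (esym (wreprK _))); [|exact: weil_cubeW..].
apply: wpi_ext => r; rewrite HE; apply: wpi_ext => s /=.
congr (sfun _ _); apply/rowP => i; rewrite [LHS]mxE [RHS]mxE mem_enum.
by rewrite row_mxKl row_mxKr mulrC.
Qed.

(* The scalings [d |-> r d] turn values at [power_map r] into values at 1, and
   [power_map] maps D^n into the locus where conflicting parameters multiply to 0. *)
Lemma scaled_eq (Z K : smap (space (wdim (conflictW overlap : walg R))) (tens X (cubeW n))) :
  (forall r, Z (power_map r) = tensr X (wscales r (enum 'I_n)) (Z (const_mx 1))) ->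
  (forall r, K (power_map r) = tensr X (wscales r (enum 'I_n)) (K (const_mx 1))) ->
  (forall A t, indep overlap A -> Z (keep_map A t) = K (keep_map A t)) ->
  Z (const_mx 1) = K (const_mx 1).
Proof.
move=> Zr Kr ZK.
have wQ : weil (conflictW overlap : walg R) by exact/sqfree_weil/sqfree_conflictW.
have wC : weil (cubeW n : walg R) := @weil_cubeW R n.
have wCQ : weil (wprod (cubeW n) (conflictW overlap) : walg R).
  by apply/sqfree_weil/sqfree_wprod; [exact: sqfree_cubeW | exact: sqfree_conflictW].
have wCC : weil (wprod (cubeW n) (cubeW n) : walg R).
  by apply/sqfree_weil/sqfree_wprod; exact: sqfree_cubeW.
(* The two families have the same class, since by [keep_mono] the independent coordinate subspaces
   jointly detect it. *)
have E : wpi (tens X (cubeW n)) (conflictW overlap) Z = wpi (tens X (cubeW n)) (conflictW overlap) K.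
  apply: (@wpi_iter_mono R X eX (cubeW n) (conflictW overlap) {A : {set 'I_N} | indep overlap A}
     (fun=> conflictW overlap) (fun j => wkeep overlap (val j))) => //.
    move=> b Cb bI; apply: keep_mono => // A iA; exact: (bI (exist _ A iA)).
  by move=> [A iA] s; exact: ZK.
have := congr1 (tensr _ wpower) E; rewrite !tensr_wpi (@wpi_scales (scomp Z (wsmap wpower)) _ Zr)
  (@wpi_scales (scomp K (wsmap wpower)) _ Kr).
move=> /(iter_tens_inj eX wC wC) E2.
apply: (@tensr_mono R X _ unit _ (fun=> wsprod n)) => // b Cb /(_ tt).
exact: sprod_mono.
Qed.

End Scaling.
End Core.

(** * Tangentials and substitution of a polynomial in the sum *)

Section Substitution.
Context {R : realType} {E M : frolicher R} (p : smap E M) (x : E).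
Hypotheses (mE : microlinear E) (mM : microlinear M) (eE : weil_exponentiable E).
Variables (n l : nat) (rho : {poly R}).
Variables (nabla : fmap p x (cubeW n)) (nabla' : fmap p x (cubeW l)).
Hypotheses (nt : cube_tangential nabla) (proj : cube_projs nabla nabla').
Hypothesis rho0 : rho`_0 = 0.
Hypothesis rho_dvd : 'X^(n.+1) %| rho ^+ l.+1.

Let N := #|{set 'I_n}|.
Let st (a : 'I_N) : {set 'I_n} := enum_val a.
(** The coefficient of d_S in rho (d_1 + ... + d_n) modulo squares, by [horner_sumE]. *)
Let c (a : 'I_N) : R := rho`_(#|st a|) * ((#|st a|)`!)%:R.

Lemma coef_empty a : st a = finset.set0 -> c a = 0.
Proof. by rewrite /c => ->; rewrite cards0 rho0 mul0r. Qed.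

Lemma coef_neq0 a : (c a != 0) = (rho`_(#|st a|) != 0).
Proof. by rewrite /c mulf_eq0 negb_or pnatr_eq0 -lt0n fact_gt0 andbT. Qed.

Section Blocks.
Variable A : {set 'I_N}.
Hypothesis indepA : indep (@overlap n) A.

(** Discarding zero coefficients removes the empty set and lets [poly_dim_card] bound the number of
    blocks by [l]. *)
Let A' := [set a in A | c a != 0]%SET.
Let block (j : 'I_#|A'|) : {set 'I_n} := st (enum_val j).
Let index (i : 'I_n) : option 'I_#|A'| := [pick j | i \in block j].

Lemma indexE i j : (index i == Some j) = (i \in block j).
Proof.
rewrite /index; case: pickP => [j' ij'|/(_ j) -> //].
apply/eqP/idP => [[<-]//|ij]; congr Some; apply: enum_val_inj; apply/eqP.
have: enum_val j' \in A' := enum_valP j'; have: enum_val j \in A' := enum_valP j.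
rewrite !inE => /andP[jA _] /andP[j'A _].
have := forall_inP indepA _ j'A => /forall_inP /(_ _ jA) /implyP H.
apply/negPn/negP => /H; rewrite /overlap negbK => /pred0P /(_ i) /=.
by rewrite -/(st _) -/(block _) ij' -/(st _) -/(block _) ij.
Qed.

Lemma block_coef j : rho`_(#|block j|) != 0.
Proof.
have: enum_val j \in A' := enum_valP j.
by rewrite inE => /andP[_]; rewrite coef_neq0.
Qed.

Lemma index_covers : covers index.
Proof.
move=> j; have /finset.set0Pn[i ij] : block j != finset.set0.
  by apply/eqP => j0; have := block_coef j; rewrite j0 cards0 rho0 eqxx.
by exists i; apply/eqP; rewrite indexE.
Qed.

Lemma block_card : (#|A'| <= l)%N.
Proof. exact: (poly_dim_card rho_dvd block_coef indexE). Qed.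

Lemma param_block t d :
  param_map c (row_mx d (keep_map A t)) =
  plus_map (scales_map (\row_j (t 0 (enum_val j) * c (enum_val j))) (enum 'I_#|A'|)
    (block_map index d)).
Proof.
apply/rowP => i; rewrite [LHS]mxE [RHS]mxE row_mxKl row_mxKr.
rewrite (bigID (fun a => a \in A')) /= [X in _ + X]big1 ?addr0; last first.
  move=> a; rewrite inE negb_and negbK mxE => /orP[/negPf ->|/eqP ->]; first by rewrite mul0r.
  by rewrite mul0r mulr0.
rewrite big_enum_val; apply: eq_bigr => j _.
have: enum_val j \in A' := enum_valP j; rewrite inE => /andP[jA _].
rewrite !mxE jA mem_enum mulrA; congr (_ * _).
by apply: eq_bigl => i'; rewrite indexE.
Qed.

End Blocks.

Variables (f : smap (space 1) M) (F : smap (space 1) E).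
Variables (g : fib (cubeW l) (p x)) (G : fib (cubeW l) x).
Hypotheses (gE : sval g = wpi M (cubeW l) (scomp f (wsmap (wplus l))))
  (GE : sval G = wpi E (cubeW l) (scomp F (wsmap (wplus l)))) (gG : nabla' g = G).

Lemma base_plus (X : frolicher R) (h : smap (space 1) X) k :
  base (wpi X (cubeW k) (scomp h (wsmap (wplus k)))) = h 0.
Proof. by apply: etrans (base_pi _) _; rewrite -[in RHS](wfun0 (wplus k)). Qed.

Lemma rep0 (X : frolicher R) (y : X) (h : smap (space 1) X) (z : fib (cubeW l) y) :
  sval z = wpi X (cubeW l) (scomp h (wsmap (wplus l))) -> h 0 = y.
Proof.
by move=> zE; rewrite -(proj2_sig z) zE base_plus.
Qed.

Definition source_fam : smap (space (wdim (conflictW (@overlap n) : walg R))) (fib (cubeW n) (p x)) :=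
  srestr (u := param_fam c f)
    (fun t => etrans (base_param_fam coef_empty f t) (rep0 gE)).

Definition image_fam : smap (space (wdim (conflictW (@overlap n) : walg R))) (tens E (cubeW n)) :=
  scomp (sval_smap _) (scomp nabla source_fam).

(** On an independent coordinate subspace the argument of [f] is a sum of scaled block products,
    with at most [l] blocks. The relation [gG] descends to that order by [psi_plus_projs], and
    [nabla] respects scalings and blocks. *)
Lemma image_fam_keep A t : indep (@overlap n) A ->
  image_fam (keep_map A t) = param_fam c F (keep_map A t).
Proof.
move=> indepA; set A' := [set a in A | c a != 0]%SET.
have kl := block_card indepA; rewrite -/A' in kl.
have [nabla'' proj'] := cube_projs_exists nabla' kl.
pose g2 : fib (cubeW #|A'|) (p x) :=
  exist _ _ (etrans (base_plus f _) (rep0 gE)).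
pose G2 : fib (cubeW #|A'|) x :=
  exist _ _ (etrans (base_plus F _) (rep0 GE)).
have nt' := cube_projs_tangential proj nt.
have E2 : nabla'' g2 = G2 := psi_plus_projs (g' := g2) (G' := G2) proj' nt' gE GE erefl erefl gG.
pose r : 'rV[R]_#|A'| := \row_j (t 0 (enum_val j) * c (enum_val j)).
have cov := index_covers indepA.
have famE (X : frolicher R) (y : X) (h : smap (space 1) X) (z : fib (cubeW #|A'|) y) :
    sval z = wpi X (cubeW _) (scomp h (wsmap (wplus _))) ->
    param_fam c h (keep_map A t) =
    sval (fibr y (wblock cov) (fibr y (wscales r (enum 'I_#|A'|)) z)).
  move=> zE; rewrite /= zE /tensr_fun.
  apply: esym; apply: etrans (congr1 (tensr X (wblock cov)) (tensr_wpi _ _)) _.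
  apply: etrans (tensr_wpi _ _) _; apply: wpi_ext => s /=.
  by rewrite param_block.
have -> : image_fam (keep_map A t) = sval (nabla (fibr _ (wblock cov)
    (fibr _ (wscales r (enum 'I_#|A'|)) g2))).
  by rewrite /image_fam /=; congr (sval (nabla _)); apply: fib_ext; exact: (famE _ _ f g2 erefl).
rewrite (tangential_block (cube_projs_trans proj proj') nt).
rewrite (commutes_scales _ (enum_uniq _)); last first.
  exact: cube_tangential_scale (cube_projs_tangential proj' nt').
by rewrite E2 (famE _ _ F G2 erefl).
Qed.

Lemma image_fam1 : image_fam (const_mx 1) = param_fam c F (const_mx 1).
Proof.
apply: (scaled_eq mE eE) => [r|r|A t iA]; last exact: image_fam_keep.
  have -> : image_fam (power_map r) = sval (nabla (fibr _ (wscales r (enum 'I_n)) (source_fam (const_mx 1)))).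
    by rewrite /image_fam /=; congr (sval (nabla _)); apply: fib_ext; exact: (param_fam_power coef_empty f r).
  by rewrite (commutes_scales _ (enum_uniq _)) //; exact: cube_tangential_scale nt.
exact: (param_fam_power coef_empty F r).
Qed.

(** At t = 1 the weighted sum of the d_S is congruent to rho (d_1 + ... + d_n) modulo squares, and
    [wpi_congr] carries this over to [X]. *)
Lemma param_fam1 (X : frolicher R) (h : smap (space 1) X) (v : 'rV[R]_n -> 'rV[R]_1) (Cv : Cinf_map v) :
  microlinear X -> (forall d, v d 0 0 = rho.[\sum_i d 0 i]) ->
  param_fam c h (const_mx 1) = wpi X (cubeW n) (scomp h (Smap (smooth_Cinf_map Cv))).
Proof.
move=> mX vE; have II := widlP (cubeW n : walg R).
pose u (d : 'rV[R]_n) : 'rV[R]_1 := param_map c (row_mx d (const_mx 1)).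
have uE d : u d 0 0 = mlin (fun S : {set 'I_n} => rho`_(#|S|) * ((#|S|)`!)%:R) d.
  rewrite mxE row_mxKl row_mxKr /mlin [RHS](reindex_onto (fun a : 'I_N => st a) enum_rank); last first.
    by move=> S _; exact: enum_rankK.
  apply: eq_big => [a|a _]; last by rewrite mxE mul1r.
  by rewrite enum_valK eqxx.
have Cu : Cinf_map u.
  move=> j; rewrite ord1.
  have -> : (fun d => u d 0 0) = mlin (fun S : {set 'I_n} => rho`_(#|S|) * ((#|S|)`!)%:R).
    by apply/funext => d; exact: uE.
  exact: Cinf_mlin.
have -> : param_fam c h (const_mx 1) = wpi X (cubeW n) (scomp h (Smap (smooth_Cinf_map Cu))).
  exact: wpi_ext.
apply: wpi_congr => //.
- exact: weil_cubeW.
- exact: (param_map0 coef_empty).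
- apply/rowP => j; rewrite ord1 vE big1 => [|i _]; rewrite mxE //.
  by rewrite horner_coef0 rho0.
- have [s0 _] := sqfree_cubeW (R := R) n.
  move=> j; rewrite ord1; have := cong_sym II (horner_sumE II s0 rho).
  by congr widl; apply/funext => d; rewrite uE vE.
Qed.

End Substitution.

(** * Tangentiality of the induced map *)

Section Main.
Context {R : realType} {E M : frolicher R} (p : smap E M) (x : E).
Hypotheses (mE : microlinear E) (mM : microlinear M) (eE : weil_exponentiable E).

(** By uniqueness it suffices to compare after substituting d_1 + ... + d_n. There the two sides
    become [image_fam] and [param_fam] at t = 1, which agree by [image_fam1]. *)
Lemma psi_poly n l (nabla : fmap p x (cubeW n)) (nabla' : fmap p x (cubeW l)) psi psi'
    (rho : {poly R}) (rhoS : simple_poly rho) (rhol : poly_dim n rho l) g :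
  cube_tangential nabla -> cube_projs nabla nabla' ->
  is_psi nabla psi -> is_psi nabla' psi' ->
  psi (fibr _ (wpoly rhoS rhol) g) = fibr _ (wpoly rhoS rhol) (psi' g).
Proof.
move=> nt proj psiP psiP'; apply: (is_psi_uniq psiP).
have [rho0 _] := rhoS; have [rdvd _] := rhol.
have Cv : Cinf_map (@poly_map R rho \o @plus_map R n).
  exact: (Cinf_map_comp (wfunC (wplus n)) (wfunC (wpoly rhoS rhol))).
have vE (d : 'rV[R]_n) : (poly_map rho \o @plus_map R n) d 0 0 = rho.[\sum_i d 0 i].
  by rewrite /= !mxE.
have repE (X : frolicher R) (y : X) (z : fib (ordW l) y) :
   sval (fibr y (wplus n) (fibr y (wpoly rhoS rhol) z)) =
   wpi X (cubeW n) (scomp (wrepr (sval z)) (Smap (smooth_Cinf_map Cv))).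
  rewrite /= -{1}[sval z]wreprK; apply: etrans (congr1 (tensr X (wplus n)) (tensr_wpi _ _)) _.
  by apply: etrans (tensr_wpi _ _) _; exact: wpi_ext.
pose g1 := fibr (p x) (wplus l) g; pose G1 := fibr x (wplus l) (psi' g).
have g1G1 : nabla' g1 = G1 by exact: is_psiE.
have main := image_fam1 mE eE nt proj rho0 rdvd (f := wrepr (sval g)) (F := wrepr (sval (psi' g)))
  (g := g1) (G := G1) erefl erefl g1G1.
apply: fib_ext; rewrite repE -(param_fam1 rho0 _ Cv mE vE) -main /=.
congr (sval (nabla _)); apply: fib_ext; rewrite repE.
by rewrite -(param_fam1 rho0 _ Cv mM vE).
Qed.

End Main.

Theorem theorem79 (R : realType) (E M : frolicher R)
  (microE : microlinear E) (microM : microlinear M)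
  (weilE : weil_exponentiable E) (weilM : weil_exponentiable M)
  (p : smap E M) (x : E) (n : nat) (nabla : fmap p x (cubeW n)) :
  cube_tangential nabla ->
  exists2 psi : fmap p x (ordW n), is_psi nabla psi & ord_tangential psi.
Proof.
move=> nt; have [_ _ _ ns] := cube_tangential_pseudo nt.
have [psi psiP] := is_psi_exists microE ns; exists psi => //.
(* Both [nabla] and [psi] are generalized, since the induction hypothesis is applied to the
   projection and the map it induces. *)
elim: n nabla nt {ns} psi psiP => [|n IH] nabla nt psi psiP.
  exact: (psi_pseudotangential psiP microM weilE (cube_tangential_pseudo nt)).
split; first exact: (psi_pseudotangential psiP microM weilE (cube_tangential_pseudo nt)).
move=> n0; split.
  have nt' := cube_tangential_proj nt; have [_ _ _ ns'] := cube_tangential_pseudo nt'.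
  have [psi' psiP'] := is_psi_exists microE ns'; exists psi'; last exact: IH psiP'.
  exact: psi_ord_proj psiP psiP'.
move=> rho l rhoS rhol.
have [nabla' proj] := cube_projs_exists nabla (simple_poly_dim rhoS rhol).
have nt' := cube_projs_tangential proj nt; have [_ _ _ ns'] := cube_tangential_pseudo nt'.
have [psi' psiP'] := is_psi_exists microE ns'; exists psi' => [|g].
  exact: (is_psi_projs microE microM weilE proj nt psiP psiP').
exact: (psi_poly microE microM weilE rhoS rhol g nt proj psiP psiP').
Qed.
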